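(* Let $n\geq 7$ and $p\geq 2$. Among all unicyclic graphs of order $n$, $S_{n}+e$, $U_{1}$, $U_{2}$, $U_{3}$ and $U_{4}$ are, respectively, the unique unicyclic graphs with the first five maximum $p$-Sombor spectral radii; that is, for every unicyclic graph $G$ of order $n$ not isomorphic to any of these five graphs, $$\rho(\mathbf{S}_{p}(G))<\rho(\mathbf{S}_{p}(U_4))<\rho(\mathbf{S}_{p}(U_3))<\rho(\mathbf{S}_{p}(U_2))<\rho(\mathbf{S}_{p}(U_1))<\rho(\mathbf{S}_{p}(S_n+e)).$$
   Context: All graphs are simple and connected; $d_i$ is the degree of $v_i$. The $p$-Sombor matrix $\mathbf{S}_{p}(G)$ has $(i,j)$-entry $(d_i^{p}+d_j^{p})^{1/p}$ if $v_iv_j\in E(G)$ and $0$ otherwise; $\rho(\mathbf{S}_{p}(G))$ is its largest eigenvalue. A unicyclic graph is a connected graph with exactly one cycle. The graphs (all of order $n$): $S_n+e$ is the star $S_n$ with one edge added between two leaves (a triangle $xyz$ with $n-3$ pendant vertices at $x$); $U_1$ is a triangle $xyz$ with $n-4$ pendant vertices at $x$ and one pendant vertex at $y$; $U_2$ is a triangle $xyz$ where $x$ is adjacent to $n-5$ pendant vertices and to a further vertex $a$, and $a$ is adjacent to one pendant vertex; $U_3$ is a $4$-cycle with $n-4$ pendant vertices at one of its vertices; $U_4$ is a triangle $xyz$ with $n-5$ pendant vertices at $x$ and $2$ pendant vertices at $y$. *)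

(* Defs.v *)
From HB Require Import structures.
From mathcomp Require Import all_boot all_order all_algebra perm.
From mathcomp Require Import classical_sets reals exp.
Set Implicit Arguments. Unset Strict Implicit. Unset Printing Implicit Defensive.
Import Order.TTheory GRing.Theory Num.Theory.
Local Open Scope ring_scope.

Definition simple_graph n (e : rel 'I_n) : Prop := irreflexive e /\ symmetric e.

Definition connected_graph n (e : rel 'I_n) : Prop := forall x y, connect e x y.

Definition is_cycle n (e : rel 'I_n) (s : seq 'I_n) : bool :=
  ucycleb e s && (2 < size s)%N.

Definition cycle_edges n (s : seq 'I_n) : {set {set 'I_n}} :=
  [set [set x; next s x] | x in s].

Definition unicyclic n (e : rel 'I_n) : Prop :=
  connected_graph e /\
  exists s, is_cycle e s /\ forall t, is_cycle e t -> cycle_edges t = cycle_edges s.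

Definition graph_iso n (e1 e2 : rel 'I_n) : Prop :=
  exists f : {perm 'I_n}, forall x y, e1 x y = e2 (f x) (f y).

Definition deg n (e : rel 'I_n) (i : 'I_n) : nat := #|[set j | e i j]|.

Definition psombor_mx (R : realType) n (p : R) (e : rel 'I_n) : 'M[R]_n :=
  \matrix_(i, j) (if e i j
                  then ((deg e i)%:R `^ p + (deg e j)%:R `^ p) `^ p^-1
                  else 0).

(* Largest eigenvalue (supremum of the finite set of real eigenvalues). *)
Definition rho (R : realType) n (A : 'M[R]_n) : R :=
  sup [set a : R | eigenvalue A a].

Definition sym_of n (b : nat -> nat -> bool) : rel 'I_n :=
  fun x y => b x y || b y x.

Definition Sne n : rel 'I_n :=
  sym_of (fun x y => ((x == 0) && (0 < y)) || ((x == 1) && (y == 2)))%N.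
(* U1 : triangle 0 1 2, pendants 4..n-1 at 0, pendant 3 at 1. *)
Definition U1 n : rel 'I_n :=
  sym_of (fun x y => ((x == 0) && [|| y == 1, y == 2 | 4 <= y])
                     || ((x == 1) && ((y == 2) || (y == 3))))%N.
(* U2 : triangle 0 1 2, 0 ~ a=3, 3 ~ 4, pendants 5..n-1 at 0. *)
Definition U2 n : rel 'I_n :=
  sym_of (fun x y => ((x == 0) && [|| y == 1, y == 2, y == 3 | 5 <= y])
                     || ((x == 1) && (y == 2)) || ((x == 3) && (y == 4)))%N.
(* U3 : 4-cycle 0 1 2 3, pendants 4..n-1 at 0. *)
Definition U3 n : rel 'I_n :=
  sym_of (fun x y => ((x == 0) && [|| y == 1, y == 3 | 4 <= y])
                     || ((x == 1) && (y == 2)) || ((x == 2) && (y == 3)))%N.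
(* U4 : triangle 0 1 2, pendants 5..n-1 at 0, pendants 3,4 at 1. *)
Definition U4 n : rel 'I_n :=
  sym_of (fun x y => ((x == 0) && [|| y == 1, y == 2 | 5 <= y])
                     || ((x == 1) && [|| y == 2, y == 3 | y == 4]))%N.
Arguments Sne n : clear implicits.
Arguments U1 n : clear implicits.
Arguments U2 n : clear implicits.
Arguments U3 n : clear implicits.
Arguments U4 n : clear implicits.

(* Main.v *)
(* Every weight (d_i^p + d_j^p)^(1/p) is a symmetric convex norm of the two degrees, and
   rho(S_p(G)) is the maximum of the Rayleigh quotient, attained at a positive vector y. Moving
   the private neighbours of v over to u, where u and v are adjacent or have a common neighbour
   and y_v <= y_u, strictly increases the quadratic form at y, hence the spectral radius. It keeps
   the graph unicyclic, and keeps the maximum degree at most n - 3 if enough vertices lie outside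
   the neighbourhoods of u and v. A breadth-first tree from a vertex of maximum degree shows that
   a unicyclic graph with maximum degree at most n - 3 always admits such a move inside that
   class, unless it is a triangle whose two hubs x, u are adjacent to everything (then moving one
   leaf from u to x works, down to U4), or a star centre x with a leaf replaced by the apex of a
   triangle (compared with U4 directly). So U4 is the maximum of this class. The unicyclic graphs
   with a vertex of degree at least n - 2 are S_n + e, U1, U2 and U3; consecutive ones are compared
   by inserting the Perron vector of the smaller into the form of the larger. Only U4 < U3 uses
   the characteristic equations: ratios of weights are monotone in balance and worst at p = 2,
   which reduces it to polynomial inequalities, with n = 7 as a tight separate case. *)
Require Import Defs.
From HB Require Import structures.
From mathcomp Require Import all_boot all_order all_algebra perm.
From mathcomp Require Import classical_sets reals exp.
From mathcomp Require Import boolp interval_inference convex hoelder.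
From mathcomp Require Import topology normedtype derive.
From mathcomp Require Import ring lra zify.
Set Implicit Arguments. Unset Strict Implicit. Unset Printing Implicit Defensive.
Import Order.TTheory GRing.Theory Num.Theory.
Local Open Scope ring_scope.

(** * The p-norm weights *)

(** The obstacle to a move is that the degree of v drops, so the edges that stay at v become
    lighter. Their loss is charged to the edges at u, which gain at least as much because the weight
    is convex in one degree; so every neighbour kept by v has to be matched injectively with a
    neighbour of u of the same degree and no smaller coordinate. In a full Kelmans move the kept
    neighbours are common to u and v and match themselves; when a single leaf changes hub, the
    leaves of the two hubs have to be matched. Unicyclicity is handled as connectedness with degree
    sum 2n, which a move visibly preserves and which turns an edge-preserving bijection from one of
    the five graphs into an isomorphism. Improvement terminates because the spectral radius strictly
    increases and there are finitely many graphs on n vertices. The exponent p = 2 is the worst one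
    because z^p = (z^2)^(p/2) with p/2 >= 1, so that majorization of squares is enough. *)

HB.lock Definition pnorm (R : realType) (p a b : R) : R :=
  (a `^ p + b `^ p) `^ p^-1.

Section PowerNorm.
Context {R : realType}.
Implicit Types (q a b c d k t x y : R).

Lemma powR_conv q (t x y : R) : 1 <= q -> 0 <= t <= 1 -> 0 <= x -> 0 <= y ->
  (t * x + (1 - t) * y) `^ q <= t * x `^ q + (1 - t) * y `^ q.
Proof.
move=> q1 t01 x0 y0; have /andP[t0 t1] := t01.
have := convex_powR q1 (Itv01 t0 t1) (x := x) (y := y).
rewrite !inE /= !in_itv /= !andbT => /(_ x0 y0).
by rewrite !convRE /=.
Qed.

(** Convexity between 0 and x + y bounds z^q by z / (x + y) times (x + y)^q for z = x and z = y; the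
    two bounds add up. *)
Lemma powR_superadd q x y : 1 <= q -> 0 <= x -> 0 <= y ->
  x `^ q + y `^ q <= (x + y) `^ q.
Proof.
move=> q1 x0 y0; have q0 : q != 0 by rewrite gt_eqF // (lt_le_trans ltr01).
have [s0|s0] := eqVneq (x + y) 0.
  have -> : x = 0 by lra.
  have -> : y = 0 by lra.
  by rewrite addr0 powR0 // addr0.
have sp : 0 < x + y by rewrite lt_neqAle eq_sym s0 addr_ge0.
have H (z : R) : 0 <= z <= x + y -> z `^ q <= z / (x + y) * (x + y) `^ q.
  move=> /andP[z0 zs].
  have -> : z `^ q = (z / (x + y) * (x + y) + (1 - z / (x + y)) * 0) `^ q.
    by rewrite mulr0 addr0 divfK.
  apply: le_trans (powR_conv q1 _ (ltW sp) (lexx 0)) _.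
    by rewrite divr_ge0 ?(ltW sp) //= ler_pdivrMr // mul1r.
  by rewrite powR0 // mulr0 addr0.
have Hx : 0 <= x <= x + y by lra.
have Hy : 0 <= y <= x + y by lra.
apply: le_trans (lerD (H _ Hx) (H _ Hy)) _.
by rewrite -mulrDl -mulrDl divff // mul1r.
Qed.

Lemma powR_weak_majorization q c d x y : 1 <= q -> 0 <= x -> 0 <= y -> 0 <= d ->
  x <= c -> y <= c -> x + y <= c + d -> x `^ q + y `^ q <= c `^ q + d `^ q.
Proof.
move=> q1; have q0 : 0 <= q by rewrite (le_trans ler01).
have mon (u v : R) : 0 <= u -> u <= v -> u `^ q <= v `^ q.
  by move=> u0 uv; apply: ge0_ler_powR; rewrite // nnegrE // (le_trans u0).
wlog xy : x y / y <= x => [W|] x0 y0 d0 xc yc s.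
  have [/W|/ltW/W] := leP y x; first exact.
  by rewrite [x `^ q + _]addrC; apply=> //; rewrite addrC.
have [yd|dy] := leP y d; first by apply: lerD; apply: mon.
have [h|h] := leP (x + y) c.
  apply: le_trans (powR_superadd q1 x0 y0) _.
  by rewrite -[leLHS]addr0 lerD ?powR_ge0 // mon // addr_ge0.
have [e|e] := eqVneq (2 * c) (x + y).
  by lra.
(* Lowering d to d' makes the two sums equal; x and y are then convex combinations of c and d' with
   exchanged coefficients t and 1 - t. *)
pose d' := x + y - c.
have d'0 : 0 <= d' by rewrite /d'; lra.
have cd' : 0 < c - d' by rewrite /d'; lra.
pose t := (x - d') / (c - d').
have t01 : 0 <= t <= 1.
  rewrite /t divr_ge0 //=; last by rewrite ltW.
    rewrite ler_pdivrMr // mul1r; lra.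
  rewrite /d'; lra.
have Ex : x = t * c + (1 - t) * d' by rewrite /t; field; rewrite gt_eqF.
have Ey : y = (1 - t) * c + (1 - (1 - t)) * d'.
  by have : x + y = c + d' by [rewrite /d'; lra | ]; rewrite {1}Ex; lra.
have c0 : 0 <= c by lra.
have t01' : 0 <= 1 - t <= 1 by lra.
have A1 := powR_conv q1 t01 c0 d'0.
have A2 := powR_conv q1 t01' c0 d'0.
rewrite -Ex in A1; rewrite -Ey in A2.
have : d' `^ q <= d `^ q by apply: mon => //; rewrite /d'; lra.
lra.
Qed.

Section Exponent.
Variables (p : R) (p2 : 2 <= p).

Let p1 : 1 <= p. Proof. by apply: le_trans p2; rewrite ler1n. Qed.
Let p0 : 0 < p. Proof. exact: lt_le_trans p1. Qed.
Let pn0 : p != 0. Proof. by rewrite gt_eqF. Qed.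
Let ip0 : 0 <= p^-1. Proof. by rewrite invr_ge0 ltW. Qed.

Lemma pnormC a b : pnorm p a b = pnorm p b a.
Proof. by rewrite pnorm.unlock addrC. Qed.

Lemma pnorm_ge0 a b : 0 <= pnorm p a b.
Proof. by rewrite pnorm.unlock powR_ge0. Qed.

Lemma pnorm_powR a b : (pnorm p a b) `^ p = a `^ p + b `^ p.
Proof. by rewrite pnorm.unlock -powRrM mulVf // powRr1 // addr_ge0 // powR_ge0. Qed.

Lemma pnormr0 a : 0 <= a -> pnorm p a 0 = a.
Proof.
by move=> a0; rewrite pnorm.unlock powR0 // addr0 -powRrM mulfV // powRr1.
Qed.

Lemma pnorm_gt0 a b : 0 < a -> 0 < pnorm p a b.
Proof. by move=> a0; rewrite pnorm.unlock powR_gt0 // ltr_pwDl ?powR_ge0 ?powR_gt0. Qed.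

Lemma ler_pnorm_powR a b c d :
  a `^ p + b `^ p <= c `^ p + d `^ p -> pnorm p a b <= pnorm p c d.
Proof.
move=> h; rewrite pnorm.unlock; apply: ge0_ler_powR; rewrite // nnegrE.
  by rewrite addr_ge0 // powR_ge0.
by rewrite addr_ge0 // powR_ge0.
Qed.

Lemma ltr_pnorm_powR a b c d :
  a `^ p + b `^ p < c `^ p + d `^ p -> pnorm p a b < pnorm p c d.
Proof.
move=> h; rewrite pnorm.unlock; apply: gt0_ltr_powR; rewrite ?invr_gt0 // nnegrE.
  by rewrite addr_ge0 // powR_ge0.
by rewrite addr_ge0 // powR_ge0.
Qed.

Lemma ler_pnorm a b c d : 0 <= a <= c -> 0 <= b <= d -> pnorm p a b <= pnorm p c d.
Proof.
move=> /andP[a0 ac] /andP[b0 bd]; apply: ler_pnorm_powR.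
by apply: lerD; apply: ge0_ler_powR;
  rewrite ?nnegrE ?(ltW p0) ?(le_trans a0 ac) ?(le_trans b0 bd).
Qed.

Lemma ltr_pnorm a b c d : 0 <= a < c -> 0 <= b <= d -> pnorm p a b < pnorm p c d.
Proof.
move=> /andP[a0 ac] /andP[b0 bd]; apply: ltr_pnorm_powR.
apply: ltr_leD.
  by apply: gt0_ltr_powR; rewrite ?nnegrE // (le_trans a0) // ltW.
by apply: ge0_ler_powR; rewrite ?nnegrE ?(ltW p0) // (le_trans b0).
Qed.

Lemma pnorm_homo t a b : 0 <= t -> 0 <= a -> 0 <= b ->
  pnorm p (t * a) (t * b) = t * pnorm p a b.
Proof.
move=> t0 a0 b0; rewrite pnorm.unlock !powRM // -mulrDr powRM ?powR_ge0 //.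
  by rewrite -powRrM mulfV // powRr1.
by rewrite addr_ge0 // powR_ge0.
Qed.

(** Minkowski's inequality for (a, b) and (a', b). Divided by their norms S and S' both are unit
    vectors, the left-hand vector is T times their convex combination with weight h, and the unit
    ball is convex by [powR_conv]. The hypothesis 0 < b keeps S and S' positive. *)
Lemma pnorm_conv t a a' b : 0 <= t <= 1 -> 0 <= a -> 0 <= a' -> 0 < b ->
  pnorm p (t * a + (1 - t) * a') b <= t * pnorm p a b + (1 - t) * pnorm p a' b.
Proof.
move=> t01 a0 a'0 b0.
set S := pnorm p a b; set S' := pnorm p a' b.
have S0 : 0 < S by rewrite /S pnormC pnorm_gt0.
have S'0 : 0 < S' by rewrite /S' pnormC pnorm_gt0.
have eS : S `^ p = a `^ p + b `^ p by apply: pnorm_powR.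
have eS' : S' `^ p = a' `^ p + b `^ p by apply: pnorm_powR.
clearbody S S'.
move ET : (t * S + (1 - t) * S') => T.
have T0 : 0 < T by rewrite -ET; nra.
pose h := t * S / T.
have h01 : 0 <= h <= 1.
  rewrite /h divr_ge0 ?(ltW T0) //=; last by nra.
  by rewrite ler_pdivrMr // mul1r -ET; nra.
have E1h : 1 - h = (1 - t) * S' / T.
  by apply: (mulIf (lt0r_neq0 T0)); rewrite mulrBl !divfK ?gt_eqF // -ET; ring.
have ratio (s z u : R) : 0 < u -> T * (s * u / T * (z / u)) = s * z.
  by move=> u0; field; rewrite !gt_eqF.
have Ea : t * a + (1 - t) * a' = T * (h * (a / S) + (1 - h) * (a' / S')).
  by rewrite E1h /h mulrDr !ratio.
have Eb : b = T * (h * (b / S) + (1 - h) * (b / S')).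
  by rewrite E1h /h mulrDr !ratio //; ring.
have dS (z u : R) : 0 <= z -> 0 < u -> 0 <= z / u by move=> z0 u0; rewrite divr_ge0 // ltW.
have b0' := ltW b0.
have c1 := dS _ _ a0 S0; have c2 := dS _ _ a'0 S'0.
have c3 := dS _ _ b0' S0; have c4 := dS _ _ b0' S'0.
have /andP[h0 h0'] := h01; rewrite -subr_ge0 in h0'.
have h1 : 0 <= h * (a / S) + (1 - h) * (a' / S') by rewrite addr_ge0 // mulr_ge0.
have h2 : 0 <= h * (b / S) + (1 - h) * (b / S') by rewrite addr_ge0 // mulr_ge0.
rewrite Ea [X in pnorm p _ X]Eb pnorm_homo ?(ltW T0) // ger_pMr //.
apply: le_trans (_ : pnorm p 1 0 <= 1); last by rewrite pnormr0.
apply: ler_pnorm_powR.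
rewrite powR1 powR0 // addr0.
have := powR_conv p1 h01 c1 c2; have := powR_conv p1 h01 c3 c4.
have unit (z u : R) : 0 <= z -> 0 < u -> (z / u) `^ p = z `^ p / u `^ p.
  move=> z0 u0; have E : z `^ p = (z / u) `^ p * u `^ p.
    by rewrite -powRM ?(ltW u0) ?dS // divfK // gt_eqF.
  by rewrite E mulfK // gt_eqF // powR_gt0.
have e1 : (a / S) `^ p + (b / S) `^ p = 1.
  by rewrite !unit // -mulrDl -eS divff // gt_eqF // powR_gt0.
have e2 : (a' / S') `^ p + (b / S') `^ p = 1.
  by rewrite !unit // -mulrDl -eS' divff // gt_eqF // powR_gt0.
move=> A1 A2; apply: le_trans (lerD A2 A1) _.
by rewrite addrACA -!mulrDr e1 e2 !mulr1 subrKC.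
Qed.

(** Both a and c + k lie between c and a + k, with complementary coefficients t and 1 - t, so the
    two convexity bounds add up to the claim. *)
Lemma pnorm_increment a c k b : 0 <= c <= a -> 0 <= k -> 0 < b ->
  pnorm p (c + k) b - pnorm p c b <= pnorm p (a + k) b - pnorm p a b.
Proof.
move=> /andP[c0 ca]; rewrite le_eqVlt => /predU1P[<-|k0] b0.
  by rewrite !addr0 !subrr.
pose L := a + k - c; have L0 : 0 < L by rewrite /L; lra.
pose t := (a - c) / L.
have t01 : 0 <= t <= 1.
  by rewrite /t divr_ge0 ?(ltW L0) ?subr_ge0 //= ler_pdivrMr // mul1r /L; lra.
have t01' : 0 <= 1 - t <= 1 by lra.
have ak0 : 0 <= a + k by lra.
have A1 := pnorm_conv t01 ak0 c0 b0.
have A2 := pnorm_conv t01' ak0 c0 b0.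
have E1 : t * (a + k) + (1 - t) * c = a.
  by rewrite /t /L; field; rewrite gt_eqF.
have E2 : (1 - t) * (a + k) + (1 - (1 - t)) * c = c + k.
  by rewrite /t /L; field; rewrite gt_eqF.
rewrite E1 in A1; rewrite E2 in A2.
lra.
Qed.

(** Serves the edge uv of a move, whose end degrees are driven apart by k. *)
Lemma pnorm_spread a b k : 0 <= k <= b -> b <= a + k ->
  pnorm p a b <= pnorm p (a + k) (b - k).
Proof.
move=> kb ba; have [a0|a0] := leP 0 a; last first.
  (* A negative a would give b <= a + k < k <= b. *)
  by apply: ler_pnorm_powR; move: (powR_ge0 a p); lra.
by apply: ler_pnorm_powR; apply: powR_weak_majorization => //; lra.
Qed.

(** Writing z^p as (z^2)^(p/2) uses p >= 2 in full: p/2 >= 1 is a legitimate exponent for weak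
    majorization of the squares. *)
Lemma pnorm_majorization a b c d : 0 <= a -> 0 <= b -> 0 <= c -> 0 <= d ->
  a <= c -> b <= c -> a ^+ 2 + b ^+ 2 <= c ^+ 2 + d ^+ 2 ->
  pnorm p a b <= pnorm p c d.
Proof.
move=> a0 b0 c0 d0 ac bc s; apply: ler_pnorm_powR.
have E (z : R) : 0 <= z -> z `^ p = (z ^+ 2) `^ (p / 2).
  by move=> z0; rewrite -powR_mulrn // -powRrM mulrC divfK ?pnatr_eq0.
rewrite !E //; apply: powR_weak_majorization; rewrite ?sqr_ge0 //.
- by rewrite ler_pdivlMr // mul1r.
- by rewrite ler_sqr ?nnegrE.
- by rewrite ler_sqr ?nnegrE.
Qed.

(* Among all p >= 2, the ratio of a balanced weight to a less balanced one is largest at p = 2. *)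
Lemma pnorm_ratio a b c d : 0 < a -> 0 <= b <= a -> 0 < c -> 0 <= d -> a * d <= b * c ->
  pnorm p a b ^+ 2 * (c ^+ 2 + d ^+ 2) <= pnorm p c d ^+ 2 * (a ^+ 2 + b ^+ 2).
Proof.
move=> a0 /andP[b0 ba] c0 d0 h.
have s0 : 0 < c ^+ 2 + d ^+ 2 by nra.
(* The factor t gives t(c, d) the Euclidean norm of (a, b). The hypothesis a d <= b c makes t(c, d)
   the less balanced of the two, so majorization compares their p-norms. *)
pose t := Num.sqrt ((a ^+ 2 + b ^+ 2) / (c ^+ 2 + d ^+ 2)).
have t0 : 0 <= t by apply: sqrtr_ge0.
have t2 : t ^+ 2 * (c ^+ 2 + d ^+ 2) = a ^+ 2 + b ^+ 2.
  rewrite sqr_sqrtr; first by rewrite divfK // gt_eqF.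
  by rewrite divr_ge0 ?(ltW s0) //; nra.
rewrite -t2 mulrCA mulrA ler_pM2r // -exprMn ler_sqr ?nnegrE ?mulr_ge0 ?pnorm_ge0 //.
rewrite -pnorm_homo ?(ltW c0) //.
have ac : a <= t * c.
  rewrite -ler_sqr ?nnegrE ?(ltW a0) ?mulr_ge0 ?(ltW c0) // exprMn.
  rewrite -(ler_pM2r s0) [leRHS]mulrAC t2.
  have : (a * d) ^+ 2 <= (b * c) ^+ 2.
    by rewrite ler_sqr ?nnegrE ?mulr_ge0 ?(ltW c0) ?(ltW a0).
  by nra.
apply: pnorm_majorization; rewrite ?mulr_ge0 ?(ltW a0) ?(ltW c0) //.
  exact: le_trans ac.
by rewrite !exprMn -mulrDr t2.
Qed.

End Exponent.
End PowerNorm.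

(** * Rayleigh quotients and Perron vectors *)

Section Spectral.
Import numFieldNormedType.Exports.
Context {R : realType} {n : nat}.
Implicit Types (A : 'M[R]_n) (y z : 'I_n -> R).

Definition qform A y : R := \sum_i \sum_j A i j * (y i * y j).
Definition sqnorm y : R := \sum_i y i ^+ 2.

Lemma sqnorm_gt0 y i : y i != 0 -> 0 < sqnorm y.
Proof.
move=> yi; rewrite /sqnorm (bigD1 i) //= ltr_pwDl ?exprn_even_gt0 //.
by apply: sumr_ge0 => j _; apply: sqr_ge0.
Qed.

Lemma qformZ A (t : R) y : qform A (fun i => t * y i) = t ^+ 2 * qform A y.
Proof.
rewrite /qform mulr_sumr; apply: eq_bigr => i _; rewrite mulr_sumr.
by apply: eq_bigr => j _; ring.
Qed.

Lemma sqnormZ (t : R) y : sqnorm (fun i => t * y i) = t ^+ 2 * sqnorm y.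
Proof. by rewrite /sqnorm mulr_sumr; apply: eq_bigr => i _; rewrite exprMn. Qed.

Let coords (v : 'rV[R]_n) : 'I_n -> R := v ord0.

Let sphere : set 'rV[R]_n := [set v | sqnorm (coords v) = 1].

Let coords_continuous i (v : 'rV[R]_n) : {for v, continuous (fun v => coords v i)}.
Proof. exact: (@coord_continuous _ _ _ ord0 i). Qed.

Let qform_continuous A : continuous (fun v => qform A (coords v)).
Proof.
apply: continuous_big => [|i _]; first exact: add_continuous.
apply: continuous_big => [|j _]; first exact: add_continuous.
move=> v; exact: (cvgM (cvg_cst _) (cvgM (@coords_continuous i v) (@coords_continuous j v))).
Qed.

Let sqnorm_continuous : continuous (fun v => sqnorm (coords v)).
Proof.
apply: continuous_big => [|i _]; first exact: add_continuous.
move=> v; exact: (cvgM (@coords_continuous i v) (@coords_continuous i v)).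
Qed.

Let compact_sphere : compact sphere.
Proof.
apply: bounded_closed_compact.
  exists 1; split=> // M M1 v /= sv.
  rewrite [leLHS]/Num.norm /= mx_normrE; apply/bigmax_leP; split=> [|[k i] _] /=.
    by rewrite ltW // (lt_trans ltr01).
  apply: le_trans (ltW M1); rewrite (ord1 k) -ler_sqr ?nnegrE //.
  rewrite expr1n real_normK ?num_real // -sv /sqnorm (bigD1 i) //= lerDl.
  by apply: sumr_ge0 => j _; apply: sqr_ge0.
apply: (@preimage_closed _ _ (fun v => sqnorm (coords v)) [set x : R | x = 1]).
  by move=> v _; apply: sqnorm_continuous.
exact: closed_eq.
Qed.

Lemma qform_add A y z (t : R) : A^T = A ->
  qform A (fun i => y i + t * z i) =
  qform A y + 2 * t * (\sum_i z i * \sum_j A i j * y j) + t ^+ 2 * qform A z.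
Proof.
move=> symA; rewrite /qform.
have E : \sum_i \sum_j A i j * (y i * z j) = \sum_i z i * \sum_j A i j * y j.
  rewrite exchange_big /=; apply: eq_bigr => i _; rewrite mulr_sumr.
  by apply: eq_bigr => j _; rewrite -{1}symA mxE; ring.
have E' : \sum_i \sum_j A i j * (z i * y j) = \sum_i z i * \sum_j A i j * y j.
  by apply: eq_bigr => i _; rewrite mulr_sumr; apply: eq_bigr => j _; ring.
set S := \sum_i _ * _ in E E' *.
have -> : 2 * t * S = t * S + t * S by ring.
rewrite -{1}E -E' !mulr_sumr -!big_split /=.
apply: eq_bigr => i _; rewrite !mulr_sumr -!big_split /=.
by apply: eq_bigr => j _; ring.
Qed.

Lemma sqnorm_add y z (t : R) :
  sqnorm (fun i => y i + t * z i) =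
  sqnorm y + 2 * t * (\sum_i z i * y i) + t ^+ 2 * sqnorm z.
Proof.
rewrite /sqnorm !mulr_sumr -!big_split /=; apply: eq_bigr => i _; ring.
Qed.

(** For k > 0 the difference of the two sides is extremal at t = b / (2k), where the hypothesis
    reads b^2 / (2k) <= b^2 / (4k). *)
Lemma linear_le_quadratic_eq0 (b k : R) : (forall t, t * b <= t ^+ 2 * k) -> b = 0.
Proof.
move=> h; have [k0|k0] := leP k 0.
  have := h 1; have := h (-1); rewrite sqrrN expr1n !mul1r mulN1r; lra.
have := h (b / (2 * k)).
have -> : b / (2 * k) * b = b ^+ 2 / k / 2 by field; rewrite gt_eqF.
have -> : (b / (2 * k)) ^+ 2 * k = b ^+ 2 / k / 4 by field; rewrite gt_eqF.
have : 0 <= b ^+ 2 / k by rewrite divr_ge0 ?sqr_ge0 // ltW.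
move=> h1 h2; have /eqP : b ^+ 2 / k = 0 by lra.
by rewrite mulf_eq0 invr_eq0 (gt_eqF k0) orbF sqrf_eq0 => /eqP.
Qed.

Lemma qform_eigen A y (a : R) :
  (forall i, \sum_j A i j * y j = a * y i) -> qform A y = a * sqnorm y.
Proof.
move=> h; rewrite /qform /sqnorm mulr_sumr; apply: eq_bigr => i _.
transitivity (y i * \sum_j A i j * y j); last by rewrite h; ring.
by rewrite mulr_sumr; apply: eq_bigr => j _; ring.
Qed.

(* Any maximizer of the Rayleigh quotient is an eigenvector: the first variation vanishes. *)
Lemma rayleigh_max_eigen A y (m : R) : A^T = A ->
  (forall z, qform A z <= m * sqnorm z) -> qform A y = m * sqnorm y ->
  forall i, \sum_j A i j * y j = m * y i.
Proof.
move=> symA ub ym i; pose z (j : 'I_n) : R := (j == i)%:R.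
have pick (F : 'I_n -> R) : \sum_j z j * F j = F i.
  rewrite (bigD1 i) //= /z eqxx mul1r big1 ?addr0 // => j /negPf ->.
  by rewrite mul0r.
apply/eqP; rewrite -subr_eq0; apply/eqP.
apply: (@linear_le_quadratic_eq0 _ ((m * sqnorm z - qform A z) / 2)) => t.
have := ub (fun j => y j + t * z j).
by rewrite qform_add // sqnorm_add !pick ym; lra.
Qed.

(** The form attains its maximum m on the compact unit sphere. There m is an eigenvalue by the first
    variation, and it bounds every eigenvalue, so it is the supremum in [rho]. *)
Lemma eigenvalue_max A : A^T = A -> (0 < n)%N ->
  exists2 y, sqnorm y = 1 &
    (forall z, qform A z <= rho A * sqnorm z) /\ qform A y = rho A.
Proof.
move=> symA n0; pose i0 := Ordinal n0.
have sph0 : (sphere !=set0)%classic.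
  exists (\row_j (j == i0)%:R); rewrite /sphere /= /sqnorm /coords (bigD1 i0) //=.
  rewrite mxE eqxx expr1n big1 ?addr0 // => j /negPf jn.
  by rewrite mxE jn expr0n.
have [|c cS cmax] := @compact_EVT_max _ _ (fun v => qform A (coords v)) _ sph0 compact_sphere.
  by apply: continuous_subspaceT; apply: qform_continuous.
have nc : sqnorm (coords c) = 1 by move: cS; rewrite inE.
set m := qform A (coords c).
have ub z : qform A z <= m * sqnorm z.
  have [/existsP[i zi]|] := boolP [exists i, z i != 0]; last first.
    rewrite negb_exists => /forallP z0.
    have {}z0 i : z i = 0 by apply/eqP; have := z0 i; rewrite negbK.
    rewrite /qform big1 => [|i _]; last first.
      by rewrite big1 // => j _; rewrite z0 mul0r mulr0.
    by rewrite /sqnorm big1 ?mulr0 // => i _; rewrite z0 expr0n.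
  have s0 := sqnorm_gt0 zi; set s := sqnorm z in s0 *.
  have r0 : 0 < Num.sqrt s by rewrite sqrtr_gt0.
  pose w : 'rV[R]_n := \row_i ((Num.sqrt s)^-1 * z i).
  have wE : coords w = fun i => (Num.sqrt s)^-1 * z i.
    by apply/funext => k; rewrite /coords mxE.
  have sV : (Num.sqrt s)^-1 ^+ 2 = s^-1 by rewrite exprVn sqr_sqrtr // ltW.
  have wS : w \in sphere.
    by rewrite inE /sphere /= wE sqnormZ sV -/s mulVf // gt_eqF.
  have := cmax w wS; rewrite wE qformZ sV mulrC ler_pdivrMr //.
have eig := rayleigh_max_eigen symA ub _.
have {}eig : forall i, \sum_j A i j * coords c j = m * coords c i.
  by apply: eig; rewrite nc mulr1.
(* [eigenvalue] speaks of row vectors; symmetry of A gives the column form. *)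
have evP (v : 'rV[R]_n) (a : R) : v *m A = a *: v -> forall i, \sum_j A i j * v ord0 j = a * v ord0 i.
  move=> h i; have := congr1 (fun u : 'rV[R]_n => u ord0 i) h; rewrite !mxE => <-.
  by apply: eq_bigr => j _; rewrite -{1}symA mxE mulrC.
have mE : eigenvalue A m.
  apply/eigenvalueP; exists c; last first.
    apply/eqP => c0; move: nc; rewrite /sqnorm big1 => [|i _]; last first.
      by rewrite /coords c0 mxE expr0n.
    by move/eqP; rewrite eq_sym oner_eq0.
  apply/rowP => i; rewrite !mxE -[RHS]eig; apply: eq_bigr => j _.
  by rewrite -{1}symA mxE mulrC.
have evm : ubound [set a | eigenvalue A a]%classic m.
  move=> a /eigenvalueP[v /evP/qform_eigen va] /rV0Pn[i vi].
  by have := ub (v ord0); rewrite va ler_pM2r // (sqnorm_gt0 vi).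
have rE : rho A = m.
  apply/eqP; rewrite eq_le ge_sup //=; last by exists m.
  by apply: ub_le_sup => //; exists m.
by exists (coords c); rewrite // rE; split.
Qed.

End Spectral.

Section Perron.
Context {R : realType} {n : nat}.
Implicit Types (A B : 'M[R]_n) (y z : 'I_n -> R) (e : rel 'I_n).

Lemma rho_ge A y (a : R) i : A^T = A -> y i != 0 ->
  a * sqnorm y <= qform A y -> a <= rho A.
Proof.
move=> symA yi h; have n0 : (0 < n)%N by case: (n) i {yi} => [[]|].
have [z _ [ub _]] := eigenvalue_max symA n0.
by have := le_trans h (ub y); rewrite ler_pM2r // (sqnorm_gt0 yi).
Qed.

Lemma rho_gt A y (a : R) i : A^T = A -> y i != 0 ->
  a * sqnorm y < qform A y -> a < rho A.
Proof.
move=> symA yi h; have n0 : (0 < n)%N by case: (n) i {yi} => [[]|].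
have [z _ [ub _]] := eigenvalue_max symA n0.
by have := lt_le_trans h (ub y); rewrite ltr_pM2r // (sqnorm_gt0 yi).
Qed.

(** Taking absolute values of a maximizer cannot lower the form, since the entries are nonnegative,
    so the result is again a maximizer and an eigenvector. A zero coordinate would spread along the
    edges and, by connectedness, kill the whole vector. *)
Lemma perron A e : A^T = A -> (0 < n)%N -> (forall i j, 0 <= A i j) ->
  (forall i j, e i j -> 0 < A i j) -> connected_graph e ->
  exists2 y, (forall i, 0 < y i) & forall i, \sum_j A i j * y j = rho A * y i.
Proof.
move=> symA n0 A0 Ae con.
have [y ny [ub yr]] := eigenvalue_max symA n0.
pose z i := `|y i|.
have nz : sqnorm z = 1.
  by rewrite -ny; apply: eq_bigr => i _; rewrite real_normK // num_real.
have zr : qform A z = rho A * sqnorm z.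
  apply/eqP; rewrite eq_le ub nz mulr1 -yr /=.
  apply: ler_sum => i _; apply: ler_sum => j _.
  by rewrite ler_wpM2l // -normrM ler_norm.
have eig := rayleigh_max_eigen symA ub zr.
exists z => // i; rewrite lt_neqAle normr_ge0 andbT eq_sym; apply/negP => /eqP zi.
have step a b : z a = 0 -> e a b -> z b = 0.
  move=> za ab; have /eqP := eig a; rewrite za mulr0 psumr_eq0 => [|j _]; last first.
    by rewrite mulr_ge0 // normr_ge0.
  move=> /allP/(_ b); rewrite mem_index_enum => /(_ isT) /implyP /(_ isT).
  by rewrite mulf_eq0 (gt_eqF (Ae _ _ ab)) => /eqP.
have all0 j : z j = 0.
  have /connectP[q + ->] := con i j.
  elim: q i zi => //= k q IH a za /andP[/(step _ _ za) zk]; exact: IH.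
move: nz; rewrite /sqnorm big1 => [/eqP|k _]; last by rewrite all0 expr0n.
by rewrite eq_sym oner_eq0.
Qed.

Lemma perron_ltP A B y : B^T = B -> (0 < n)%N -> (forall i, 0 < y i) ->
  (forall i, \sum_j A i j * y j = rho A * y i) ->
  qform A y < qform B y -> rho A < rho B.
Proof.
move=> symB n0 y0 eig; rewrite (qform_eigen eig).
by apply: (@rho_gt _ _ _ (Ordinal n0)) => //; rewrite gt_eqF.
Qed.

End Perron.

(** * The form, spectral radius and Perron vector of a graph *)

Section Sombor.
Context {R : realType} {n : nat} (p : R).
Implicit Types (y : 'I_n -> R) (e : rel 'I_n).

Definition wt e i j : R := if e i j then pnorm p (deg e i)%:R (deg e j)%:R else 0.

Lemma psombor_mxE e i j : psombor_mx p e i j = wt e i j.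
Proof. by rewrite mxE /wt pnorm.unlock. Qed.

Lemma wtC e i j : symmetric e -> wt e i j = wt e j i.
Proof. by move=> s; rewrite /wt s pnormC. Qed.

Lemma psombor_sym e : symmetric e -> (psombor_mx p e)^T = psombor_mx p e.
Proof. by move=> s; apply/matrixP => i j; rewrite mxE !psombor_mxE wtC. Qed.

Lemma wt_ge0 e i j : 0 <= wt e i j.
Proof. by rewrite /wt; case: ifP => // _; apply: pnorm_ge0. Qed.

Lemma deg_gt0 e i j : e i j -> (0 < deg e i)%N.
Proof. by move=> ij; rewrite /deg card_gt0; apply/set0Pn; exists j; rewrite inE. Qed.

Lemma wt_gt0 e i j : e i j -> 0 < wt e i j.
Proof. by move=> ij; rewrite /wt ij pnorm_gt0 // ltr0n (deg_gt0 ij). Qed.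

Definition sform e y : R := \sum_i \sum_j wt e i j * (y i * y j).

Lemma qform_psombor e y : qform (psombor_mx p e) y = sform e y.
Proof.
by apply: eq_bigr => i _; apply: eq_bigr => j _; rewrite psombor_mxE.
Qed.

Definition srho e : R := rho (psombor_mx p e).

Definition perron_vec e y :=
  (forall i, 0 < y i) /\ forall i, \sum_j wt e i j * y j = srho e * y i.

Lemma perron_exists e : (0 < n)%N -> symmetric e -> connected_graph e ->
  exists y, perron_vec e y.
Proof.
move=> n0 se ce; have [i j|i j|y y0 eig] := perron (psombor_sym se) n0 _ _ ce.
- by rewrite psombor_mxE wt_ge0.
- by move=> ij; rewrite psombor_mxE wt_gt0.
exists y; split=> // i; rewrite /srho -eig.
by apply: eq_bigr => j _; rewrite psombor_mxE.
Qed.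

Lemma perron_lt e e' y : (0 < n)%N -> symmetric e' -> perron_vec e y ->
  sform e y < sform e' y -> srho e < srho e'.
Proof.
move=> n0 se [y0 eig]; rewrite -!qform_psombor; apply: perron_ltP => //.
  exact: psombor_sym.
by move=> i; rewrite -eig; apply: eq_bigr => j _; rewrite psombor_mxE.
Qed.

Lemma graph_iso_sym e1 e2 : graph_iso e1 e2 -> graph_iso e2 e1.
Proof.
by case=> f h; exists (f^-1)%g => x z; rewrite h !permKV.
Qed.

Lemma deg_iso e1 e2 (f : {perm 'I_n}) i :
  (forall x z, e1 x z = e2 (f x) (f z)) -> deg e1 i = deg e2 (f i).
Proof.
move=> h; rewrite /deg -(card_imset _ (@perm_inj _ f)); apply: eq_card => j.
rewrite !inE; apply/imsetP/idP => [[k + ->]|]; first by rewrite inE h.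
move=> jn; exists ((f^-1)%g j); last by rewrite permKV.
by rewrite inE h permKV.
Qed.

Lemma srho_iso e1 e2 : (0 < n)%N -> symmetric e1 -> symmetric e2 ->
  graph_iso e1 e2 -> srho e1 = srho e2.
Proof.
move=> n0.
suff le e e' : symmetric e -> symmetric e' -> graph_iso e e' -> srho e <= srho e'.
  move=> s1 s2 iso; apply/eqP; rewrite eq_le !le //.
  exact: graph_iso_sym.
move=> se se' [f h]; have [y ny [_ yr]] := eigenvalue_max (psombor_sym se) n0.
have [i yi] : exists i, y i != 0.
  apply/existsP; apply: contraT; rewrite negb_exists => /forallP y0.
  move: ny; rewrite /sqnorm big1 => [/eqP|i _]; first by rewrite eq_sym oner_eq0.
  by have := y0 i; rewrite negbK => /eqP ->; rewrite expr0n.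
apply: (@rho_ge _ _ _ (fun k => y ((f^-1)%g k)) _ (f i) (psombor_sym se')).
  by rewrite permK.
rewrite {1}/sqnorm (reindex_inj (@perm_inj _ f)) /=.
under eq_bigr do rewrite permK.
rewrite -/(sqnorm y) ny mulr1 /srho -yr !qform_psombor /sform.
rewrite [leRHS](reindex_inj (@perm_inj _ f)) /=; apply: ler_sum => k _.
rewrite [leRHS](reindex_inj (@perm_inj _ f)) /=; apply: ler_sum => l _.
by rewrite /wt h !(deg_iso _ h) !permK.
Qed.

End Sombor.

(** * Moving edges *)

Section Move.
Context {n : nat}.
Implicit Types (e : rel 'I_n) (T : {set 'I_n}).

(* The edges joining T to v are redirected to u: a Kelmans move when T is all of N(v) \ N[u]. *)
Definition mv e (u v : 'I_n) T : rel 'I_n := fun x y =>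
  [|| [&& e x y, ~~ ((x == v) && (y \in T)) & ~~ ((y == v) && (x \in T))],
      (x == u) && (y \in T) | (y == u) && (x \in T)].

Definition nbrs e u : {set 'I_n} := [set j | e u j].

Definition private_nbrs e u v : {set 'I_n} := [set j | [&& e v j, j != u & ~~ e u j]].

Variables (e : rel 'I_n) (u v : 'I_n) (T : {set 'I_n}).
Hypotheses (irr_e : irreflexive e) (sym_e : symmetric e).
Hypothesis T_private : T \subset private_nbrs e u v.
Hypothesis uv : u != v.

Lemma private_nbrP j : j \in T -> [/\ e v j, j != u, ~~ e u j & j != v].
Proof.
move=> jT; have := fintype.subsetP T_private j jT; rewrite inE => /and3P[vj -> ->].
by split=> //; apply: contraTneq vj => ->; rewrite irr_e.
Qed.

Let TP := private_nbrP.

Let uT : (u \in T) = false.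
Proof. by apply/negP => /TP[_ /eqP]. Qed.
Let vT : (v \in T) = false.
Proof. by apply/negP => /TP[_ _ _ /eqP]. Qed.

Lemma mv_sym : symmetric (mv e u v T).
Proof.
move=> x y; rewrite /mv (sym_e x y); congr (_ || _); last exact: orbC.
by congr andb; exact: andbC.
Qed.

Lemma mv_irr : irreflexive (mv e u v T).
Proof.
move=> x; rewrite /mv irr_e /= orbb; apply/negP => /andP[/eqP ->].
by rewrite uT.
Qed.

Lemma mv_u j : mv e u v T u j = e u j || (j \in T).
Proof.
rewrite /mv eqxx (negPf uv) uT !andbF /= andbT orbF.
by case: (j == v) => //=; rewrite andbT.
Qed.

Lemma mv_v j : mv e u v T v j = e v j && (j \notin T).
Proof.
rewrite /mv eqxx [v == u]eq_sym (negPf uv) vT !andbF /= !orbF.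
by rewrite andbT.
Qed.

Lemma mv_other i j : i != u -> i != v -> j != u -> j != v -> mv e u v T i j = e i j.
Proof. by rewrite /mv => /negPf -> /negPf -> /negPf -> /negPf ->; rewrite /= !andbT !orbF. Qed.

Lemma deg_mv_u : deg (mv e u v T) u = (deg e u + #|T|)%N.
Proof.
rewrite /deg -cardsUI [X in (_ = _ + X)%N]eq_card0 => [|j]; last first.
  by rewrite !inE; apply/negP => /andP[uj /TP[_ _ /negP]].
by rewrite addn0; apply: eq_card => j; rewrite !inE mv_u.
Qed.

Lemma deg_mv_v : (deg (mv e u v T) v + #|T|)%N = deg e v.
Proof.
rewrite /deg -cardsUI [X in (_ + X)%N]eq_card0 => [|j]; last first.
  by rewrite !inE mv_v -andbA andNb andbF.
rewrite addn0; apply: eq_card => j; rewrite !inE mv_v.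
by have [/TP[->]|] := boolP (j \in T); rewrite ?orbT // orbF andbT.
Qed.

Lemma deg_mv_other i : i != u -> i != v -> deg (mv e u v T) i = deg e i.
Proof.
move=> iu iv; rewrite /deg; have [iT|iT] := boolP (i \in T); last first.
  apply: eq_card => j; rewrite !inE /mv (negPf iu) (negPf iv) (negPf iT) /=.
  by rewrite !andbF /= andbT orbF.
have [vi _ ui _] := TP iT.
(* A vertex of T trades its neighbour v for u, which was not a neighbour before. *)
have E : [set j | mv e u v T i j] = u |: ([set j | e i j] :\ v).
  apply/setP => j; rewrite !inE /mv (negPf iu) (negPf iv) iT /= !andbT.
  by rewrite orbC [(j != v) && _]andbC.
rewrite E cardsU1 !inE sym_e (negPf ui) andbF /=.
by rewrite [RHS](cardsD1 v) inE sym_e vi.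
Qed.

Lemma sum_deg_mv : (\sum_i deg (mv e u v T) i = \sum_i deg e i)%N.
Proof.
rewrite (bigD1 u) //= (bigD1 v) /=; last by rewrite eq_sym.
rewrite [RHS](bigD1 u) //= [X in _ = (_ + X)%N](bigD1 v) /=; last by rewrite eq_sym.
rewrite (eq_bigr (deg e)) => [|i /andP[iu iv]]; last by rewrite deg_mv_other.
by have := deg_mv_v; rewrite deg_mv_u; lia.
Qed.

End Move.

Section MoveForm.
Context {R : realType} {n : nat}.
Variables (p : R) (e : rel 'I_n) (u v : 'I_n) (T : {set 'I_n}) (y : 'I_n -> R).
Hypothesis p2 : 2 <= p.
Hypotheses (irr_e : irreflexive e) (sym_e : symmetric e).
Hypothesis T_private : T \subset private_nbrs e u v.
Hypothesis uv : u != v.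

Let TP := private_nbrP irr_e T_private.

(** The difference of the forms before and after a move has this shape: only the rows and columns of
    u and v change. *)
Lemma sum_two_rows (g : 'I_n -> 'I_n -> R) :
  (forall i j, g i j = g j i) -> g u u = 0 -> g v v = 0 ->
  (forall i j, i != u -> i != v -> j != u -> j != v -> g i j = 0) ->
  \sum_i \sum_j g i j =
  2 * (g u v + \sum_(j | (j != u) && (j != v)) (g u j + g v j)).
Proof.
move=> gC guu gvv g0; have vu : v != u by rewrite eq_sym.
have row i : \sum_j g i j = g i u + (g i v + \sum_(j | (j != u) && (j != v)) g i j).
  by rewrite (bigD1 u) //= [X in _ + X](bigD1 v).
rewrite (bigD1 u) //= [X in _ + X](bigD1 v) //= !row guu gvv.
rewrite [X in _ + (_ + X)](eq_bigr (fun j => g u j + g v j)); last first.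
  move=> i /andP[iu iv]; rewrite row big1 => [|j /andP[ju jv]]; last exact: g0.
  by rewrite addr0 !(gC i).
rewrite !big_split /= (gC v u); ring.
Qed.

Let du : R := (deg e u)%:R.
Let dv : R := (deg e v)%:R.
Let k : R := #|T|%:R.
Let rest := [set j in nbrs e v | (j \notin T) && (j != u)].

(* What the edges from v to rest lose is dominated, through phi, by what the edges at u gain,
   because the weights are convex in each degree. *)
Lemma mv_sform_lt (phi : 'I_n -> 'I_n) : (forall i, 0 < y i) -> y v <= y u ->
  (0 < #|T|)%N -> (deg e v < deg e u + #|T|)%N ->
  {in rest &, injective phi} ->
  {in rest, forall j, [/\ e u (phi j), phi j != v, deg e (phi j) = deg e j & y j <= y (phi j)]} ->
  sform p e y < sform p (mv e u v T) y.
Proof.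
move=> y0 yuv T0 dvu phi_inj phiP.
have symm := @mv_sym _ _ u v T sym_e; have irrm := mv_irr irr_e T_private.
have k0 : 0 < k by rewrite ltr0n.
have du0 : 0 <= du by rewrite ler0n.
have dvk : 0 <= dv - k.
  by rewrite subr_ge0 ler_nat -(deg_mv_v irr_e T_private uv) leq_addl.
have dvu' : dv < du + k by rewrite -natrD ltr_nat.
have Eu : (deg (mv e u v T) u)%:R = du + k.
  by rewrite (deg_mv_u irr_e T_private uv) natrD.
have Ev : (deg (mv e u v T) v)%:R = dv - k.
  by rewrite /dv -(deg_mv_v irr_e T_private uv) natrD addrK.
have Eo j : j != u -> j != v -> deg (mv e u v T) j = deg e j.
  by move=> ju jv; rewrite (deg_mv_other irr_e sym_e T_private).
pose d j : R := (deg e j)%:R.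
rewrite -subr_gt0 /sform -sumrB.
under eq_bigr do rewrite -sumrB.
rewrite (@sum_two_rows (fun i j => wt p (mv e u v T) i j * (y i * y j) - wt p e i j * (y i * y j))); first last.
- move=> i j iu iv ju jv; rewrite /wt mv_other // !Eo // subrr //.
- by rewrite /wt irrm irr_e !mul0r subrr.
- by rewrite /wt irrm irr_e !mul0r subrr.
- by move=> i j; rewrite (wtC _ _ _ symm) (wtC _ _ _ sym_e) [y i * _]mulrC.
(* The edge uv, if present, does not lose by [pnorm_spread]; the other edges at u and v must gain
   strictly. *)
rewrite pmulr_rgt0 //; apply: ltr_wpDl.
  rewrite subr_ge0 ler_pM2r ?mulr_gt0 // /wt (mv_u irr_e T_private) //.
  have -> : (v \in T) = false by apply/negP => /TP[_ _ _ /eqP].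
  rewrite orbF; case: ifP => // _; rewrite Eu Ev; apply: pnorm_spread => //.
    by rewrite (ltW k0) -subr_ge0.
  exact: ltW.
(* [al] is the gain of an edge already at u, [ta] the gain of a redirected edge, [be] the loss of an
   edge that stays at v. Strictness comes from [ta], as T is nonempty and dv < du + k. *)
pose al j := (pnorm p (du + k) (d j) - pnorm p du (d j)) * (y u * y j).
pose ta j := (pnorm p (du + k) (d j) * y u - pnorm p dv (d j) * y v) * y j.
pose be j := (pnorm p dv (d j) - pnorm p (dv - k) (d j)) * (y v * y j).
rewrite (eq_bigr (fun j => (if e u j then al j else 0) + (if j \in T then ta j else 0)
    - (if j \in rest then be j else 0))); last first.
  move=> j /andP[ju jv]; rewrite /wt (mv_u irr_e T_private) // (mv_v irr_e T_private) //.
  rewrite !inE ju andbT Eu Ev Eo // /al /ta /be -/du -/dv -/(d j).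
  have [/TP[-> _ /negPf -> _]|_] := boolP (j \in T); first by rewrite /=; ring.
  by rewrite orbF !andbT; case: (e u j); case: (e v j); rewrite /=; ring.
rewrite sumrB big_split /= -!big_mkcondr /=.
have dd j : 0 <= d j <= d j by rewrite /d ler0n lexx.
have al0 j : 0 <= al j.
  apply: mulr_ge0; last by rewrite mulr_ge0 // ltW.
  by rewrite subr_ge0 ler_pnorm // du0 lerDl ltW.
have restE j : j \in rest -> [&& e v j, j \notin T & j != u] by rewrite !inE.
have be_le j : j \in rest -> be j <= al (phi j).
  move=> jR; have [ufj _ dj yj] := phiP j jR; have /and3P[vj _ _] := restE j jR.
  have dj0 : 0 < d j by rewrite ltr0n (@deg_gt0 _ _ j v) // sym_e.
  rewrite /be /al /d dj -/(d j); apply: ler_pM.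
  - by rewrite subr_ge0 ler_pnorm // dvk gerBl ltW.
  - by rewrite mulr_ge0 // ltW.
  (* The degree of v rises from dv - k to dv before u's rises from du to du + k, so convexity makes
     the second increment the larger. *)
  - have h : 0 <= dv - k <= du by rewrite dvk; lra.
    by have := pnorm_increment p2 h (ltW k0) dj0; rewrite subrK.
  - by apply: ler_pM => //; exact: ltW.
have h1 : \sum_(j | ((j != u) && (j != v)) && (j \in rest)) be j <=
    \sum_(j | ((j != u) && (j != v)) && e u j) al j.
  have -> : \sum_(j | ((j != u) && (j != v)) && (j \in rest)) be j = \sum_(j in rest) be j.
    apply: eq_bigl => j; rewrite !inE; have [vj|] := boolP (e v j); last by rewrite andbF.
    have -> : j != v by apply: contraTneq vj => ->; rewrite irr_e.
    by case: (j != u); rewrite /= ?andbT ?andbF.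
  apply: le_trans (ler_sum _ be_le) _.
  rewrite -(big_imset al phi_inj) /=.
  rewrite [leRHS](bigID (mem [set phi j | j in rest])) /=.
  rewrite -[leLHS]addr0 lerD ?sumr_ge0 // le_eqVlt; apply/orP; left; apply/eqP.
  apply: eq_bigl => j; apply/idP/andP => [|[]//].
  move=> jI; split=> //; have /imsetP[i iR ->] := jI.
  have [ufi fiv _ _] := phiP i iR; rewrite ufi fiv !andbT.
  by apply: contraTneq ufi => ->; rewrite irr_e.
have h2 : 0 < \sum_(j | ((j != u) && (j != v)) && (j \in T)) ta j.
  have ta0 j : j \in T -> 0 < ta j.
    move=> jT; rewrite mulr_gt0 // subr_gt0.
    have [vj _ _ _] := TP jT; have dv0 : 0 < dv by rewrite ltr0n (deg_gt0 vj).
    have lt : pnorm p dv (d j) < pnorm p (du + k) (d j).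
      by apply: ltr_pnorm; rewrite ?dvu' ?(ltW dv0) ?lexx ?ler0n.
    apply: lt_le_trans (_ : pnorm p (du + k) (d j) * y v <= _).
      by rewrite ltr_pM2r.
    by rewrite ler_wpM2l // pnorm_ge0.
  have /card_gt0P[t tT] := T0; have [vt tu _ tv] := TP tT.
  rewrite (bigD1 t) /= ?tT ?tu ?tv //; apply: ltr_pwDl; first exact: ta0.
  by apply: sumr_ge0 => j /andP[/andP[_ /ta0/ltW]].
lra.
Qed.

End MoveForm.

(** * Unicyclic graphs *)

(** Counting edges through degrees turns unicyclicity into an invariant that is easy to follow under
    a move. *)
Definition unicyc n (e : rel 'I_n) : Prop :=
  [/\ irreflexive e, symmetric e, connected_graph e & (\sum_i deg e i = 2 * n)%N].

(** * Kelmans moves that raise the spectral radius and respect a degree bound *)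

Section Kelmans.
Context {R : realType} {n : nat} (p : R).
Hypothesis p2 : 2 <= p.
Implicit Types (e : rel 'I_n) (u v : 'I_n).

(** This is what keeps v connected to u once its private neighbours are gone. *)
Definition linked e u v := e u v \/ exists z, e u z /\ e v z.

Lemma linked_sym e u v : symmetric e -> linked e u v -> linked e v u.
Proof.
by move=> s [|[z [a b]]]; [rewrite s; left | right; exists z].
Qed.

(** A redirected edge from v to z is replaced by a path from v to u followed by the new edge uz; u
    and v stay joined by their own edge or through a common neighbour, which is never in T. *)
Lemma mv_connected e u v (T : {set 'I_n}) : irreflexive e -> symmetric e -> u != v ->
  connected_graph e -> linked e u v -> T \subset private_nbrs e u v ->
  connected_graph (mv e u v T).
Proof.
move=> irr_e sym_e uv con_e nuv TT; set e' := mv e u v T.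
have symc : connect_sym e' by apply: sym_connect_sym; exact: mv_sym.
have uvc : connect e' u v.
  case: nuv => [euv|[z [uz vz]]].
    apply: connect1; rewrite /e' (mv_u irr_e TT uv) euv //.
  apply: connect_trans (_ : connect e' z v); first by rewrite connect1 // /e' (mv_u irr_e TT uv) uz.
  rewrite symc connect1 // /e' (mv_v irr_e TT uv) vz /=.
  by apply: contraL uz => /(fintype.subsetP TT); rewrite inE => /and3P[].
suff step x y : e x y -> connect e' x y.
  move=> x y; have /connectP[q + ->] := con_e x y.
  elim: q x => //= a q IH x /andP[xa /IH]; apply: connect_trans; exact: step.
have step_v z : e v z -> connect e' v z.
  move=> vz; have [zT|zT] := boolP (z \in T); last first.
    by rewrite connect1 // /e' (mv_v irr_e TT uv) vz.
  rewrite symc; apply: connect_trans (_ : connect e' u v) => //.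
  by rewrite symc connect1 // /e' (mv_u irr_e TT uv) zT orbT.
move=> exy; have [xv|xv] := eqVneq x v; first by rewrite xv; apply: step_v; rewrite -xv.
have [yv|yv] := eqVneq y v.
  by rewrite symc yv; apply: step_v; rewrite -yv sym_e.
by rewrite connect1 // /e' /mv exy (negPf xv) (negPf yv).
Qed.

Lemma card_private e u v : irreflexive e ->
  (#|nbrs e v :\: nbrs e u| = #|private_nbrs e u v| + e v u)%N.
Proof.
move=> irr_e; rewrite (cardsD1 u) !inE irr_e /= addnC; congr (_ + _)%N.
by apply: eq_card => j; rewrite !inE; case: (j == u); case: (e u j); case: (e v j).
Qed.

(** The degree of u after a full Kelmans move is [deg e u + #|private_nbrs e u v|], so the size of
    the joint neighbourhood controls the new maximum degree. *)
Lemma card_union_private e u v : irreflexive e -> symmetric e ->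
  (#|nbrs e u :|: nbrs e v| = deg e u + #|private_nbrs e u v| + e u v)%N.
Proof.
move=> irr_e sym_e; rewrite -addnA (sym_e u v) -card_private //.
have -> : nbrs e u :|: nbrs e v = nbrs e u :|: (nbrs e v :\: nbrs e u).
  by apply/setP => j; rewrite !inE; case: (e u j).
rewrite -cardsUI [X in (_ = _ + X)%N]eq_card0 ?addn0 // => j.
by rewrite !inE; case: (e u j); rewrite ?andbF.
Qed.

(** The private neighbour t of v makes the move nontrivial. The private neighbour s of u gives deg v
    < deg u + |T|; without it the move would only exchange the roles of u and v. The kept neighbours
    of v are common neighbours, so the matching is the identity. *)
Lemma kelmans_improve_ordered e u v y s t (m : nat) : unicyc e -> u != v -> linked e u v ->
  perron_vec p e y -> y v <= y u ->
  e u s -> s != v -> ~~ e v s -> e v t -> t != u -> ~~ e u t ->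
  (#|nbrs e u :|: nbrs e v| <= m + e u v)%N -> (forall i, (deg e i <= m)%N) ->
  exists e', [/\ unicyc e', forall i, (deg e' i <= m)%N & srho p e < srho p e'].
Proof.
move=> [irr_e sym_e con_e cnt_e] uv nuv pv yuv us sv vs vt tu ut Dm degm.
set T := private_nbrs e u v; have TT : T \subset T by [].
exists (mv e u v T).
have n0 : (0 < n)%N by case: (n) u {uv nuv us ut yuv Dm T TT tu} => [[]|].
have dT : (deg e u + #|T| <= m)%N.
  by move: Dm; rewrite card_union_private // leq_add2r.
split.
- split; [exact: mv_irr irr_e TT | exact: mv_sym | exact: mv_connected |].
  by rewrite sum_deg_mv.
- move=> i; have [->|iu] := eqVneq i u; first by rewrite (deg_mv_u irr_e TT uv).
  have [->|iv] := eqVneq i v.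
    by apply: leq_trans (degm v); rewrite -(deg_mv_v irr_e TT uv) leq_addr.
  by rewrite (deg_mv_other irr_e sym_e TT).
apply: (perron_lt n0 _ pv); first exact: mv_sym.
have [y0 _] := pv.
apply: (@mv_sform_lt _ _ _ _ _ _ _ _ p2 irr_e sym_e TT uv id) => //.
- by apply/card_gt0P; exists t; rewrite inE vt tu ut.
- have E1 : (deg e v = #|nbrs e v :&: nbrs e u| + #|T| + e v u)%N.
    by rewrite -addnA -card_private // cardsID.
  have E2 : (deg e u = #|nbrs e v :&: nbrs e u| + #|private_nbrs e v u| + e u v)%N.
    by rewrite -addnA -card_private // finset.setIC cardsID.
  have : (0 < #|private_nbrs e v u|)%N.
    by apply/card_gt0P; exists s; rewrite inE us sv vs.
  rewrite {1}E1 E2 (sym_e v u) -/T; move: #|_ :&: _| #|T| #|private_nbrs e v u| (nat_of_bool _).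
  by clear; lia.
move=> j; rewrite !inE => /and3P[vj jT ju]; split=> //.
  by apply: contraNT jT => uj; rewrite vj ju.
by apply: contraTneq vj => ->; rewrite irr_e.
Qed.

(** The hypotheses are symmetric in u and v, so the end with the larger Perron coordinate can be
    chosen to receive the edges. *)
Lemma kelmans_improve e u v s t (m : nat) : unicyc e -> u != v -> linked e u v ->
  e u s -> s != v -> ~~ e v s -> e v t -> t != u -> ~~ e u t ->
  (#|nbrs e u :|: nbrs e v| <= m + e u v)%N -> (forall i, (deg e i <= m)%N) ->
  exists e', [/\ unicyc e', forall i, (deg e' i <= m)%N & srho p e < srho p e'].
Proof.
move=> ue uv nuv us sv vs vt tu ut Dm degm.
have n0 : (0 < n)%N by case: (n) u {uv nuv us ut Dm tu} => [[]|].
have [irr_e sym_e con_e _] := ue.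
have [y pv] := perron_exists p n0 sym_e con_e.
have [yvu|/ltW yuv] := leP (y v) (y u).
  exact: (kelmans_improve_ordered ue uv nuv pv yvu us sv vs vt tu ut).
apply: (kelmans_improve_ordered ue _ (linked_sym sym_e nuv) pv yuv vt tu ut us sv vs) => //.
  by rewrite eq_sym.
by rewrite finset.setUC (sym_e v u).
Qed.

End Kelmans.

(** * Breadth-first trees, extra edges and cycles *)

Section Tree.
Context {n : nat}.
Implicit Types (e : rel 'I_n) (x : 'I_n) (d : 'I_n -> nat) (f : 'I_n -> 'I_n).

Definition bfs e x d f :=
  [/\ forall v, (d v == 0)%N = (v == x),
      forall v, v != x -> e v (f v) /\ d v = (d (f v)).+1
    & forall u v, e u v -> (d v <= (d u).+1)%N].

Lemma bfs_exists e x : symmetric e -> connected_graph e -> exists d f, bfs e x d f.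
Proof.
move=> sym_e con_e.
(* B k is the ball of radius k around x, and d v the first k for which it contains v. *)
pose B k := iter k (fun S : {set 'I_n} => S :|: \bigcup_(i in S) nbrs e i) [set x].
have BS k v : (v \in B k.+1) = (v \in B k) || [exists u, (u \in B k) && e u v].
  rewrite /= !inE; congr orb; apply/bigcupP/existsP => [[u uB]|[u /andP[uB uv]]].
    by rewrite inE => uv; exists u; rewrite uB uv.
  by exists u; rewrite ?inE.
have exB v : exists k, v \in B k.
  have /connectP[q + ->] := con_e x v.
  have : x \in B 0%N by rewrite inE.
  elim: q 0%N (x) => [k a aB _|b q IH k a aB /= /andP[ab]]; first by exists k.
  by apply: (IH k.+1); rewrite BS; apply/orP; right; apply/existsP; exists a; rewrite aB.
pose d v := ex_minn (exB v).
have dP v : v \in B (d v) by rewrite /d; case: ex_minnP.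
have dmin v k : v \in B k -> (d v <= k)%N.
  by move=> vk; rewrite /d; case: ex_minnP => j _; apply.
have d0 v : (d v == 0)%N = (v == x).
  apply/eqP/eqP => [v0|->]; first by have := dP v; rewrite v0 inE => /eqP.
  by apply/eqP; rewrite -leqn0 dmin // inE.
have de u v : e u v -> (d v <= (d u).+1)%N.
  move=> uv; apply: dmin; rewrite BS; apply/orP; right.
  by apply/existsP; exists u; rewrite dP.
pose f v := odflt x [pick u | e v u && (d v == (d u).+1)].
exists d, f; split=> // v vx; rewrite /f; case: pickP => [u /andP[vu /eqP ->] //|none].
have := dP v; case E: (d v) => [|k]; first by move/eqP: E; rewrite d0 (negPf vx).
rewrite BS => /orP[/dmin|/existsP[u /andP[/dmin uk uv]]]; first by rewrite E ltnn.
by have := none u; rewrite sym_e uv E eqSS eqn_leq uk -ltnS -E de.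
Qed.

Lemma sum_deg_pairs e : (\sum_i deg e i = #|[set ab : 'I_n * 'I_n | e ab.1 ab.2]|)%N.
Proof.
rewrite -sum1_card (eq_bigl (fun ab : 'I_n * 'I_n => xpredT ab.1 && e ab.1 ab.2)).
  rewrite -(pair_big_dep xpredT e (fun _ _ => 1%N)) /=; apply: eq_bigr => i _.
  by rewrite sum1_card; apply: eq_card => j; rewrite inE.
by move=> ab; rewrite inE.
Qed.

(** [bfs] says nothing about the parent of the root, hence the two guards. *)
Definition tree_edge x f : rel 'I_n :=
  fun a b => (b != x) && (f b == a) || (a != x) && (f a == b).

Lemma tree_edge_sym x f : symmetric (tree_edge x f).
Proof. by move=> a b; rewrite /tree_edge orbC. Qed.

Section Bfs.
Variables (e : rel 'I_n) (x : 'I_n) (d : 'I_n -> nat) (f : 'I_n -> 'I_n).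
Hypotheses (irr_e : irreflexive e) (sym_e : symmetric e) (B : bfs e x d f).

Let t := tree_edge x f.

Lemma tree_edgeW a b : t a b -> e a b.
Proof.
have [_ h _] := B; case/orP=> /andP[/h[]]; first by rewrite sym_e => ab _ /eqP <-.
by move=> ab _ /eqP <-.
Qed.

Lemma tree_connected a b : connect t a b.
Proof.
have [d0 h _] := B; have tsym : connect_sym t by apply: sym_connect_sym; exact: tree_edge_sym.
suff toroot v : connect t x v by apply: connect_trans (toroot b); rewrite tsym.
have [m] := ubnP (d v); elim: m v => // m IH v; rewrite ltnS => dv.
have [->//|vx] := eqVneq v x; have [_ E] := h v vx.
apply: connect_trans (_ : connect t (f v) v); first by apply: IH; rewrite -E.
by apply: connect1; rewrite /t /tree_edge vx eqxx.
Qed.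

(* Each non-tree edge is counted in both orientations. *)
Definition extra_edges : {set 'I_n * 'I_n} := [set ab | e ab.1 ab.2 && ~~ t ab.1 ab.2].

(** Each vertex other than x contributes the pairs (v, f v) and (f v, v). The two families are
    disjoint because depth drops from v to f v. *)
Lemma card_edges : (\sum_i deg e i = (n.-1).*2 + #|extra_edges|)%N.
Proof.
have [d0 h _] := B.
rewrite sum_deg_pairs.
pose T1 := [set (v, f v) | v in [set~ x]]; pose T2 := [set (f v, v) | v in [set~ x]].
have cT : #|[set~ x] : {set 'I_n}| = n.-1.
  by rewrite cardsC1 card_ord.
have c1 : #|T1| = n.-1 by rewrite card_imset ?cT // => a b [].
have c2 : #|T2| = n.-1 by rewrite card_imset ?cT // => a b [].
have T12 ab : (ab \in T1 :|: T2) = t ab.1 ab.2.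
  case: ab => a b; rewrite inE /t /tree_edge /= orbC; congr orb.
    apply/imsetP/andP => [[v]|[vx /eqP E]]; first by rewrite !inE => vx [-> ->].
    by exists b; rewrite ?inE ?E.
  apply/imsetP/andP => [[v]|[vx /eqP E]]; first by rewrite !inE => vx [-> ->].
  by exists a; rewrite ?inE ?E.
have I0 : #|T1 :&: T2| = 0%N.
  apply: eq_card0 => ab.
  rewrite [RHS]inE finset.in_setI; apply/negP => /andP[/imsetP[v + ->] /imsetP[w + [E1 E2]]].
  rewrite !inE => /h[_ dv] /h[_ dw]; move: dv; rewrite E2 dw -E1; lia.
have c12 : (#|T1 :|: T2| = n.-1 + n.-1)%N by rewrite -(addn0 #|_|) -I0 cardsUI c1 c2.
rewrite -(cardsID (T1 :|: T2)) -addnn -c12; congr addn; apply: eq_card => ab.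
  by rewrite inE T12 inE; case: (boolP (t _ _)) => [/tree_edgeW ->|]; rewrite ?andbF.
by rewrite !inE -[(ab \in T1) || _]finset.in_setU T12 andbC.
Qed.

Lemma extra_edgesP c c' : (c, c') \in extra_edges -> #|extra_edges| = 2%N ->
  forall a b, e a b -> [\/ t a b, a = c /\ b = c' | a = c' /\ b = c].
Proof.
move=> cE c2 a b ab; have [tab|tab] := boolP (t a b); first by constructor 1.
move: (cE); rewrite inE /= => /andP[ecc tcc].
have sub : [set (c, c'); (c', c)] \subset extra_edges.
  apply/fintype.subsetP => z; rewrite !inE => /orP[/eqP ->|/eqP ->] /=; first by rewrite ecc.
  by rewrite sym_e ecc /t tree_edge_sym.
have : (a, b) \in extra_edges by rewrite inE /= ab.
have <- : [set (c, c'); (c', c)] = extra_edges.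
  apply/eqP; rewrite eqEcard sub c2 cards2; case: eqVneq => // -[E _].
  by move: ecc; rewrite E irr_e.
by rewrite !inE => /orP[/eqP[-> ->]|/eqP[-> ->]]; [constructor 2 | constructor 3].
Qed.

(** A simple tree path from c to c' is closed by the extra edge. The last clause lets the cycle
    determine its extra edge. *)
Lemma fundamental_cycle c c' : (c, c') \in extra_edges ->
  exists s, [/\ is_cycle e s, [set c; c'] \in cycle_edges s &
    forall a b, [set a; b] \in cycle_edges s -> t a b \/ [set a; b] = [set c; c']].
Proof.
rewrite inE /= => /andP[ecc tcc].
have /connectP[q0 pq0] := tree_connected c c'.
case/shortenP: pq0 => q pq uq _ lq; rewrite lq in ecc tcc *.
have size_q : (1 < size q)%N.
  case: (q) pq lq ecc tcc => [|a [|b r]] //=; first by rewrite irr_e.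
  by rewrite andbT => ->.
exists (c :: q); split.
- rewrite /is_cycle /ucycleb uq /= ltnS size_q !andbT rcons_path.
  rewrite (sub_path _ pq) /=; first by rewrite sym_e.
  by move=> a b; apply: tree_edgeW.
- apply/imsetP; exists (last c q); first exact: mem_last.
  rewrite finset.setUC; congr (_ :|: [set _]); rewrite next_nth mem_last.
  by rewrite index_last // nth_default.
move=> a b /imsetP[z zs E].
(* This relation records whether a step is a tree step or the closing one, so [next_cycle]
   classifies every edge of the cycle. *)
have cyc : cycle (fun a b => t a b || (a == last c q) && (b == c)) (c :: q).
  rewrite /= rcons_path !eqxx orbT andbT; apply: sub_path pq => u v ->; exact: isT.
have /orP[tz|/andP[/eqP zl /eqP nz]] := next_cycle cyc zs; last first.
  by right; rewrite E nz zl finset.setUC.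
left; have : a \in [set z; next (c :: q) z] by rewrite -E !inE eqxx.
have : b \in [set z; next (c :: q) z] by rewrite -E !inE eqxx orbT.
have : z \in [set a; b] by rewrite E !inE eqxx.
have : next (c :: q) z \in [set a; b] by rewrite E !inE eqxx orbT.
have ez : z != next (c :: q) z.
  by apply: contraTneq (tree_edgeW tz) => E1; rewrite -E1 irr_e.
rewrite !inE => /orP[]/eqP E1 /orP[]/eqP E2; rewrite ?E1 ?E2 in tz ez *.
- by rewrite eqxx in ez.
- by rewrite /t tree_edge_sym.
- by [].
- by rewrite eqxx in ez.
Qed.

(** At a deepest vertex z of a cycle in a tree, both neighbours on the cycle would have to be the
    parent of z. *)
Lemma tree_acyclic s : extra_edges = finset.set0 -> ~~ is_cycle e s.
Proof.
move=> X0; apply/negP => /andP[/andP[cyc uni] size_s].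
have et a b : e a b -> t a b.
  move=> ab; apply: contraT => tab; have : (a, b) \in extra_edges by rewrite inE /= ab.
  by rewrite X0 inE.
have [z0 z0s] : exists z, z \in s by case: (s) size_s => // a ? _; exists a; rewrite inE eqxx.
pose z := [arg max_(i > z0 in s) d i].
have [zs zmax] : z \in s /\ forall j, j \in s -> (d j <= d z)%N.
  by rewrite /z; case: arg_maxnP.
have [i r rotE] := rot_to zs.
have := size_s; rewrite -(size_rot i) rotE.
have := cyc; rewrite -(rot_cycle i) rotE.
have := uni; rewrite -(rot_uniq i) rotE.
have rs b : b \in r -> b \in s by move=> br; rewrite -(mem_rot i) rotE inE br orbT.
have par b : b \in r -> e z b -> f z = b.
  move=> /rs/zmax db /et /orP[/andP[bx /eqP E]|/andP[_ /eqP //]].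
  by have [_ h _] := B; have [_] := h b bx; rewrite E; lia.
case: r {rotE rs} par => [|b [|b' r]] // par; rewrite /= => /and3P[_ br _] /and3P[zb _].
rewrite rcons_path => /andP[_ lz] _; have E1 := par b (mem_head _ _) zb.
have lr : last b' r \in b' :: r by apply: mem_last.
have := par (last b' r); rewrite inE lr orbT sym_e lz E1 => /(_ isT isT) E2.
by rewrite E2 lr in br.
Qed.

End Bfs.

(** There is an extra edge because a tree has no cycle, and only one because the cycles of two extra
    edges would have equal edge sets while each contains only its own extra edge. *)
Lemma unicyclic_unicyc e : simple_graph e -> unicyclic e -> unicyc e.
Proof.
move=> [irr_e sym_e] [con_e [s [cs suniq]]]; split=> //.
have x : 'I_n by case: (s) cs => [|a ? _]; rewrite /is_cycle ?andbF.
have [d [f B]] := bfs_exists x sym_e con_e.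
rewrite (card_edges sym_e B).
have n0 : (0 < n)%N by apply: leq_ltn_trans (ltn_ord x).
suff -> : #|extra_edges e x f| = 2%N by lia.
have [X0|[[c c'] cE]] := set_0Vmem (extra_edges e x f).
  by have /negP := tree_acyclic sym_e B s X0.
have [s1 [cs1 ccs1 _]] := fundamental_cycle irr_e sym_e B cE.
move: (cE); rewrite inE /= => /andP[ecc tcc].
have cc : c != c' by apply: contraTneq ecc => ->; rewrite irr_e.
have -> : extra_edges e x f = [set (c, c'); (c', c)].
  apply/setP => -[a b]; apply/idP/idP => [abE|]; last first.
    rewrite !inE => /orP[/eqP[-> ->]|/eqP[-> ->]]; first by rewrite ecc.
    by rewrite sym_e ecc tree_edge_sym.
  have [s2 [cs2 _ s2E]] := fundamental_cycle irr_e sym_e B abE.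
  have := s2E c c'; rewrite (suniq _ cs2) -(suniq _ cs1) => /(_ ccs1).
  case=> [tc|E]; first by rewrite tc in tcc.
  have : a \in [set c; c'] by rewrite E !inE eqxx.
  have : b \in [set c; c'] by rewrite E !inE eqxx orbT.
  have ab : a != b.
    by move: abE; rewrite inE /= => /andP[ab _]; apply: contraTneq ab => ->; rewrite irr_e.
  rewrite !inE !xpair_eqE => /orP[]/eqP E1 /orP[]/eqP E2; subst; rewrite ?eqxx ?orbT //.
    by rewrite eqxx in ab.
  by rewrite eqxx in ab.
by rewrite cards2 xpair_eqE (negPf cc).
Qed.

End Tree.

(** Degree sum 2n leaves exactly one extra edge cc'. Every edge at the root is a tree edge, so c and
    c' have positive depth. The four alternatives then decide any adjacency from depths, parents and
    c, c'. *)
Lemma unicyc_structure n (e : rel 'I_n) x : unicyc e ->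
  exists d f c c', [/\ bfs e x d f, e c c', (0 < d c)%N /\ (0 < d c')%N, ~~ tree_edge x f c c' &
    forall a b, e a b -> [\/ d b = (d a).+1 /\ f b = a, d a = (d b).+1 /\ f a = b,
      a = c /\ b = c' | a = c' /\ b = c]].
Proof.
move=> [irr_e sym_e con_e cnt]; have [d [f B]] := bfs_exists x sym_e con_e.
have [d0 h de] := B.
have n0 : (0 < n)%N by apply: leq_ltn_trans (ltn_ord x).
have c2 : #|extra_edges e x f| = 2%N.
  by apply/eqP; rewrite -(eqn_add2l (n.-1).*2) -(card_edges sym_e B) cnt; apply/eqP; lia.
have [[c c'] cE] : exists z, z \in extra_edges e x f.
  by apply/card_gt0P; rewrite c2.
exists d, f, c, c'; move: (cE); rewrite inE /= => /andP[ecc tcc].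
have root a : e x a -> tree_edge x f x a.
  move=> xa; have ax : a != x by apply: contraTneq xa => ->; rewrite irr_e.
  have [_ da] := h a ax; have dx : d x = 0%N by apply/eqP; rewrite d0.
  have := de _ _ xa; rewrite dx da ltnS leqn0 d0 => fx.
  by rewrite /tree_edge ax fx.
split=> //.
  split; first by rewrite lt0n d0; apply: contra tcc => /eqP E; move: ecc; rewrite E => /root.
  rewrite lt0n d0; apply: contra tcc => /eqP E; move: ecc; rewrite E sym_e => /root.
  by rewrite tree_edge_sym.
move=> a b /(extra_edgesP irr_e sym_e cE c2)[|//|//]; last 2 first.
- by constructor 3.
- by constructor 4.
case/orP=> /andP[/h[_ E1] /eqP E2]; [constructor 1 | constructor 2]; by rewrite -{1}E2.
Qed.

(** * Unicyclic graphs of maximum degree at most n - 3 *)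

Section Improve.
Context {R : realType} {n : nat} (p : R).
Hypotheses (p2 : 2 <= p) (n7 : (7 <= n)%N).
Implicit Types (e : rel 'I_n).

Definition small_deg e := forall i, (deg e i <= n - 3)%N.

Definition improvable e :=
  exists e', [/\ unicyc e', small_deg e' & srho p e < srho p e'].

Lemma card_disjoint_le (A B : {set 'I_n}) : [disjoint A & B] -> (#|A| + #|B| <= n)%N.
Proof.
by rewrite -leq_card_setU => /eqP <-; rewrite -[X in (_ <= X)%N](card_ord n) max_card.
Qed.

(** Two vertices outside leave a joint neighbourhood of at most n - 2. It includes u and v
    themselves, so the new degree of u is at most n - 3. *)
Lemma improve_adjacent e u v s t o1 o2 : unicyc e -> small_deg e -> e u v ->
  e u s -> s != v -> ~~ e v s -> e v t -> t != u -> ~~ e u t ->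
  o1 != o2 -> ~~ e u o1 -> ~~ e v o1 -> ~~ e u o2 -> ~~ e v o2 -> improvable e.
Proof.
move=> ue sd uv us sv vs vt tu ut oo u1 v1 u2 v2.
have [irr_e _ _ _] := ue.
have nuv : u != v by apply: contraTneq uv => ->; rewrite irr_e.
apply: (kelmans_improve p2 ue nuv (or_introl uv) us sv vs vt tu ut) sd.
have : [disjoint nbrs e u :|: nbrs e v & [set o1; o2]].
  rewrite disjoint_sym finset.disjoints_subset; apply/fintype.subsetP => j.
  by rewrite !inE negb_or => /orP[]/eqP ->; apply/andP.
move/card_disjoint_le; rewrite cards2 oo uv /=; clear -n7; lia.
Qed.

(** Here u and v lie outside both neighbourhoods themselves, so one further vertex outside brings
    the joint neighbourhood down to n - 3. *)
Lemma improve_nonadjacent e u v z s t o : unicyc e -> small_deg e -> u != v -> ~~ e u v ->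
  e u z -> e v z -> e u s -> s != v -> ~~ e v s -> e v t -> t != u -> ~~ e u t ->
  o != u -> o != v -> ~~ e u o -> ~~ e v o -> improvable e.
Proof.
move=> ue sd nuv uv uz vz us sv vs vt tu ut ou ov u1 v1.
have [irr_e sym_e _ _] := ue.
have lk : linked e u v by right; exists z.
apply: (kelmans_improve p2 ue nuv lk us sv vs vt tu ut) sd.
have : [disjoint nbrs e u :|: nbrs e v & o |: [set u; v]].
  rewrite disjoint_sym finset.disjoints_subset; apply/fintype.subsetP => j.
  rewrite !inE negb_or => /or3P[]/eqP ->; rewrite ?u1 ?v1 ?irr_e //= ?(sym_e v) ?uv //.
move/card_disjoint_le; rewrite cardsU1 cards2 nuv !inE negb_or ou ov (negPf uv) /=; clear -n7; lia.
Qed.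

Definition double_hub e := exists x u z, [/\ uniq [:: x; u; z], [&& e x u, e x z & e u z],
  (deg e u <= deg e x)%N & forall w, w \notin [:: x; u; z] -> e x w || e u w].

Definition hung_triangle e := exists x u w1 w2,
  [/\ uniq [:: x; u; w1; w2], [&& e x u, e u w1, e u w2 & e w1 w2] &
    forall w, w \notin [:: x; u; w1; w2] -> e x w].

(** * Graphs without an improving move, seen from a vertex x of maximum degree *)

Section Cases.
Variables (e : rel 'I_n) (x : 'I_n).
Hypotheses (ue : unicyc e) (sd : small_deg e) (xmax : forall i, (deg e i <= deg e x)%N).
Hypothesis stuck : ~ improvable e.
Variables (d : 'I_n -> nat) (f : 'I_n -> 'I_n) (c c' : 'I_n).
Hypotheses (B : bfs e x d f) (ecc : e c c') (dc : (0 < d c)%N) (dc' : (0 < d c')%N).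
Hypothesis tcc : ~~ tree_edge x f c c'.
Hypothesis edgeP : forall a b, e a b ->
  [\/ d b = (d a).+1 /\ f b = a, d a = (d b).+1 /\ f a = b,
      a = c /\ b = c' | a = c' /\ b = c].

Let irr_e : irreflexive e. Proof. by case: ue. Qed.
Let sym_e : symmetric e. Proof. by case: ue. Qed.

Let d0 v : (d v == 0)%N = (v == x). Proof. by case: B. Qed.
Let dx : d x = 0%N. Proof. by apply/eqP; rewrite d0. Qed.
Let fP v : d v != 0%N -> e v (f v) /\ d v = (d (f v)).+1.
Proof. by rewrite d0; case: B => _ h _; apply: h. Qed.
Let dlip u v : e u v -> (d v <= (d u).+1)%N. Proof. by case: B => _ _; apply. Qed.

Let d1P v : (d v == 1)%N = e x v.
Proof.
apply/eqP/idP => [v1|xv].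
  have [|vf] := @fP v; first by rewrite v1.
  by rewrite v1 => -[/esym/eqP]; rewrite d0 => /eqP <-; rewrite sym_e.
have := dlip xv; rewrite dx leq_eqVlt => /orP[/eqP //|].
by rewrite ltnS leqn0 d0 => /eqP E; move: xv; rewrite E irr_e.
Qed.

Let f1 v : d v = 1%N -> f v = x.
Proof.
by move=> v1; have [|_] := @fP v; rewrite v1 // => -[/esym/eqP]; rewrite d0 => /eqP.
Qed.

Let fE v : d v != 0%N -> e (f v) v. Proof. by move=> /fP[]; rewrite sym_e. Qed.

Let pick_nbr (l : seq 'I_n) : (size l < deg e x)%N -> exists y, d y = 1%N /\ y \notin l.
Proof.
move=> sl; have /set0Pn[y] : [set j | e x j] :\: [set y in l] != finset.set0.
  rewrite -card_gt0 cardsD subn_gt0; apply: leq_trans sl; rewrite ltnS.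
  apply: leq_trans (subset_leq_card (finset.subsetIr _ _)) _.
  by rewrite cardsE card_size.
by rewrite !inE -d1P => /andP[yl /eqP]; exists y.
Qed.

Let W : {set 'I_n} := [set w | (1 < d w)%N].

Let cardW : (#|W| + (deg e x).+1 = n)%N.
Proof.
have E : [set: 'I_n] = W :|: (x |: [set j | e x j]).
  apply/setP => v; rewrite !inE -d0 -d1P; clear; lia.
have I0 : #|W :&: (x |: [set j | e x j])| = 0%N.
  by apply: eq_card0 => v; rewrite !inE -d0 -d1P; clear; lia.
have := cardsT 'I_n; rewrite E card_ord -(addn0 #|_|) -I0 cardsUI cardsU1 !inE irr_e.
by rewrite addnA addn1 addnC addnS addnC.
Qed.

Let W2 : (1 < #|W|)%N.
Proof. by have := sd x; have := cardW; clear -n7; lia. Qed.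

(** Otherwise o1 and o2 would be the two outside vertices for a move between x and u. A private
    neighbour s of x exists since deg u <= deg x and u already spends two edges on x and t. *)
Let miss u t o1 o2 : d u = 1%N -> (1 < d t)%N -> e u t -> (1 < d o1)%N -> (1 < d o2)%N ->
  ~~ e u o1 -> ~~ e u o2 -> o1 = o2.
Proof.
move=> u1 t2 ut o12 o22 uo1 uo2; apply/eqP; apply/negPn/negP => oo; apply: stuck.
have xu : e x u by rewrite -d1P u1.
have far w : (1 < d w)%N -> ~~ e x w by rewrite -d1P; clear; lia.
have [s /andP[xs us]] : exists s, e x s && ((s != u) && ~~ e u s).
  apply/existsP; apply: contraT; rewrite negb_exists => /forallP none.
  have sub : [set j | e x j] :\ u \subset [set j | e u j] :\: [set x; t].
    apply/fintype.subsetP => j; rewrite !inE => /andP[ju xj].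
    have := none j; rewrite xj ju /= negbK => ->; rewrite andbT negb_or.
    apply/andP; split; first by apply: contraTneq xj => ->; rewrite irr_e.
    by apply: contraTneq xj => ->; exact: far.
  have sxt : [set x; t] \subset [set j | e u j].
    by apply/fintype.subsetP => j; rewrite !inE => /orP[]/eqP ->; rewrite // sym_e.
  have xt : x != t by apply: contraTneq t2 => <-; rewrite dx.
  have := subset_leq_card sub; rewrite [X in (_ <= X)%N]cardsDS //.
  have := subset_leq_card sxt; rewrite cards2 xt.
  have := cardsD1 u [set j | e x j]; rewrite inE xu -/(deg e x) -/(deg e u).
  by have := xmax u; clear; lia.
have /andP[su nus] := us.
apply: (improve_adjacent ue sd xu xs su nus ut _ (far _ t2) oo) => //; try exact: far.
by apply: contraTneq t2 => ->; rewrite dx.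
Qed.

Let wide0 u t : d u = 1%N -> (1 < d t)%N -> e u t -> (#|W| <= #|W :&: nbrs e u| + 1)%N.
Proof.
move=> u1 t2 ut; rewrite -(cardsID (nbrs e u) W) leq_add2l leqNgt.
apply/card_gt1P => -[a [b [+ + /eqP]]]; rewrite !inE => /andP[ua a2] /andP[ub b2].
by case; apply: (miss u1 t2 ut).
Qed.

Let wide u t : d u = 1%N -> (1 < d t)%N -> e u t -> (#|W| <= deg e u)%N.
Proof.
move=> u1 t2 ut; apply: leq_trans (wide0 u1 t2 ut) _.
have : x |: (W :&: nbrs e u) \subset nbrs e u.
  apply/fintype.subsetP => j; rewrite !inE => /orP[/eqP ->|/andP[]//].
  by rewrite sym_e -d1P u1.
by move/subset_leq_card; rewrite cardsU1 !inE dx addnC.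
Qed.

(** The neighbours of u include x, y and all but at most one vertex of W, so |W| + 1 <= deg u <= deg
    x. With |W| + deg x + 1 = n >= 7 this forces deg x >= 4, which supplies spare neighbours of x
    for later moves. *)
Let wider u t y : d u = 1%N -> (1 < d t)%N -> e u t -> d y = 1%N -> e u y ->
  (4 <= deg e x)%N.
Proof.
move=> u1 t2 ut y1 uy; have := wide0 u1 t2 ut.
have : y |: (x |: (W :&: nbrs e u)) \subset nbrs e u.
  apply/fintype.subsetP => j; rewrite !inE => /or3P[/eqP -> //|/eqP ->|/andP[]//].
  by rewrite sym_e -d1P u1.
have yx : y != x by rewrite -d0 y1.
move/subset_leq_card; rewrite !cardsU1 !inE dx y1 (negPf yx) /= -[#|nbrs e u|]/(deg e u).
have := cardW; have := xmax u; move: (deg e u) (deg e x) #|W :&: nbrs e u| #|W|.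
by clear -n7; lia.
Qed.

Let all_children u : d u = 1%N -> (forall w, (1 < d w)%N -> e u w) -> (4 <= deg e x)%N.
Proof.
move=> u1 uW; have : x |: W \subset nbrs e u.
  apply/fintype.subsetP => j; rewrite !inE => /orP[/eqP ->|/uW //].
  by rewrite sym_e -d1P u1.
move/subset_leq_card; rewrite cardsU1 !inE dx /= -[#|nbrs e u|]/(deg e u).
have := cardW; have := xmax u; move: (deg e u) (deg e x) #|W|.
by clear -n7; lia.
Qed.

(** [edgeP] turns a supposed edge into equations on depths, parents, c and c'. Once the quantified
    facts are cleared, [congruence] and [lia] refute them. *)
Ltac ground :=
  clear ue sd xmax stuck B tcc irr_e sym_e d0 fP dlip d1P f1 fE pick_nbr cardW W2 miss
    wide0 wide wider all_children edgeP;
  repeat match goal with H : forall _ : ordinal _, _ |- _ => clear H end.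
Ltac nonedge :=
  let H := fresh "H" in
  apply/negP => H; case: (edgeP H) => -[]; clear H; ground; intros; first [congruence | lia].
Ltac diff := ground; apply/eqP; intro; first [congruence | subst; lia].
Ltac wit :=
  first [done | match goal with |- is_true (_ != _) => diff | |- is_true (~~ _) => nonedge end
        | by rewrite sym_e | by rewrite -d1P; apply/eqP | by rewrite sym_e -d1P; apply/eqP].
Ltac distinct := rewrite /= !inE !negb_or !andbT; repeat (apply/andP; split); diff.

(** With u the parent of all of W, the place of the extra edge decides: at u inside N(x) it makes a
    double hub; inside W with |W| = 2 it makes a hung triangle; anywhere else some move improves the
    graph. *)
Let case_children u : d u = 1%N -> (forall w, (1 < d w)%N -> d w = 2%N /\ f w = u) ->
  double_hub e \/ hung_triangle e.
Proof.
move=> u1 uW; have eW w : (1 < d w)%N -> e u w.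
  by move=> w2; have [dw <-] := uW w w2; rewrite fE // dw.
have x4 := all_children u1 eW.
have xu : e x u by rewrite -d1P u1.
have [w0 w02] : exists w, (1 < d w)%N.
  have /card_gt0P[w] : (0 < #|W|)%N by exact: ltnW W2.
  by rewrite inE; exists w.
have [dw0 fw0] := uW w0 w02; have uw0 := eW w0 w02.
have fu := f1 u1.
have Nedge v : d v = 1%N -> e x v by rewrite -d1P => ->.
have cc : c <> c' by move=> E; move: ecc; rewrite E irr_e.
have covered w : w != x -> e x w || e u w.
  rewrite -d0 => w0'; have [w2|w1] := ltnP 1 (d w); first by rewrite eW // orbT.
  by rewrite Nedge //; lia.
(* An extra edge inside N(x) not at u, or between N(x) and W, is removed by a Kelmans move. *)
have inN a b : e a b -> (a = c /\ b = c' \/ a = c' /\ b = c) -> d a = 1%N -> d b = 1%N ->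
    double_hub e.
  move=> eab cab a1 b1; have fa := f1 a1; have fb := f1 b1.
  have [au|au] := eqVneq a u.
    have bu : b <> u by rewrite -au => E; move: eab; rewrite E irr_e.
    exists x, u, b; split.
    - by distinct.
    - by rewrite xu Nedge //= -au.
    - exact: xmax.
    - by move=> w; rewrite !inE !negb_or => /and3P[/covered].
  have [bu|bu] := eqVneq b u.
    exists x, u, a; split.
    - by move/eqP: au => au; distinct.
    - by rewrite xu Nedge //= -bu sym_e.
    - exact: xmax.
    - by move=> w; rewrite !inE !negb_or => /and3P[/covered].
  exfalso; apply: stuck; move/eqP: au => au; move/eqP: bu => bu.
  have [o [o1 ]] : exists y, d y = 1%N /\ y \notin [:: u; a; b] by apply: pick_nbr.
  rewrite !inE !negb_or => /and3P[/eqP ou /eqP oa /eqP ob].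
  have fo := f1 o1.
  by case: cab => -[ac bc]; apply: (@improve_nonadjacent e u a x w0 b o); wit.
have mixed a b : e a b -> (a = c /\ b = c' \/ a = c' /\ b = c) -> d a = 1%N ->
    (1 < d b)%N -> False.
  move=> eab cab a1 b2; have fa := f1 a1; have [db fb] := uW b b2; apply: stuck.
  (* With a = u the edge ab would be the tree edge from u to its child b. *)
  have au : a <> u.
    move=> E; move: tcc; rewrite /tree_edge -!d0 -!lt0n dc dc' /=.
    by case: cab => -[<- <-]; rewrite fb E eqxx ?orbT.
  have [o [o1 ]] : exists y, d y = 1%N /\ y \notin [:: u; a] by apply: pick_nbr; exact: ltnW.
  rewrite !inE !negb_or => /andP[/eqP ou /eqP oa]; have fo := f1 o1.
  have [o' [o'1 ]] : exists y, d y = 1%N /\ y \notin [:: u; a; o] by apply: pick_nbr.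
  rewrite !inE !negb_or => /and3P[/eqP o'u /eqP o'a /eqP o'o]; have fo' := f1 o'1.
  have ub := eW b b2.
  by case: cab => -[ac bc]; apply: (@improve_adjacent e u b x a o o'); wit.
have ecc' : e c' c by rewrite sym_e.
have [c2|c1] := ltnP 1 (d c); have [c'2|c'1] := ltnP 1 (d c').
- have [dc2 fc] := uW c c2; have [dc'2 fc'] := uW c' c'2.
  have [W3|] := ltnP 2 #|W|.
    exfalso; apply: stuck.
    have [o] : exists o, o \in W :\: [set c; c'].
      apply/card_gt0P; rewrite cardsDS; first by rewrite cards2; case: (c != c'); lia.
      by apply/fintype.subsetP => j; rewrite !inE => /orP[]/eqP ->.
    rewrite !inE negb_or => /andP[/andP[/eqP oc /eqP oc'] o2]; have [d_o fo] := uW o o2.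
    have [s [s1 ]] : exists y, d y = 1%N /\ y \notin [:: u].
      by apply: pick_nbr; apply: leq_trans x4.
    rewrite !inE => /eqP su; have fs := f1 s1.
    have uc := eW c c2.
    apply: (@improve_nonadjacent e x c u s c' o); wit.
  move=> Wle; right; exists x, u, c, c'.
  have WE : W = [set c; c'].
    apply/esym/eqP; rewrite eqEcard; apply/andP; split.
      by apply/fintype.subsetP => j; rewrite !inE => /orP[]/eqP ->.
    by rewrite cards2; move/eqP: cc => ->.
  split.
  - by distinct.
  - by rewrite xu eW // eW.
  - move=> w; rewrite !inE !negb_or => /and4P[wx wu wc wc'].
    rewrite Nedge //; have : w \notin W by rewrite WE !inE negb_or wc.
    by rewrite inE; move: wx; rewrite -d0; clear; lia.
- by exfalso; apply: (mixed c' c) => //; [right | lia].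
- by exfalso; apply: (mixed c c') => //; [left | lia].
- by left; apply: (inN c c') => //; [left | lia | lia].
Qed.

Let nbr3 u t : d u = 1%N -> (1 < d t)%N -> e u t -> (3 <= deg e x)%N.
Proof.
move=> u1 t2 ut; have := wide u1 t2 ut; have := cardW; have := xmax u.
by move: (deg e u) (deg e x) #|W|; clear -n7; lia.
Qed.

(** On a path x, u, w, w' of depths 0 to 3, x is private to u and w' is private to w. The two
    outside vertices are sought among the neighbours of x: only the extra edge can join one of these
    to u or w, and then deg x >= 4 leaves two others. *)
Let case_depth3 w' : d w' = 3%N -> False.
Proof.
move=> w'3; apply: stuck.
have [w fw'] : exists w, f w' = w by exists (f w').
have [|] := @fP w'; first by rewrite w'3.
rewrite fw' w'3 => ew' -[/esym w2].
have [u fw] : exists u, f w = u by exists (f w).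
have [|] := @fP w; first by rewrite w2.
rewrite fw w2 => ew -[/esym u1].
have fu := f1 u1; have w22 : (1 < d w)%N by rewrite w2.
have uw : e u w by rewrite sym_e.
have x3 := nbr3 u1 w22 uw.
have xu : e x u by rewrite -d1P u1.
have [y [y' [y1 y'1 yu y'u [yy' [ny nwy ny' nwy']]]]] : exists y y',
  [/\ d y = 1%N, d y' = 1%N, y <> u, y' <> u &
      y <> y' /\ [/\ ~~ e u y, ~~ e w y, ~~ e u y' & ~~ e w y']].
  have [y [y1 ]] : exists y, d y = 1%N /\ y \notin [:: u] by apply: pick_nbr; apply: ltnW.
  rewrite !inE => /eqP yu; have fy := f1 y1.
  have [y' [y'1 ]] : exists y', d y' = 1%N /\ y' \notin [:: u; y] by apply: pick_nbr.
  rewrite !inE !negb_or => /andP[/eqP y'u /eqP y'y]; have fy' := f1 y'1.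
  have third a : d a = 1%N -> a <> u -> e u a || e w a -> exists z z',
    [/\ d z = 1%N, d z' = 1%N, z <> u, z' <> u & z <> z' /\ z <> a /\ z' <> a].
    move=> a1 au uwa; have [z [z1 ]] : exists z, d z = 1%N /\ z \notin [:: u; a].
      exact: pick_nbr.
    rewrite !inE !negb_or => /andP[/eqP zu /eqP za].
    have x4 : (4 <= deg e x)%N.
      have fa := f1 a1.
      case/orP: uwa => [ua|wa]; first exact: (wider u1 w22 uw a1 ua).
      (* If deg x <= 3, then |W| >= 3 and a has a second neighbour w'' in W. As wa is the extra
         edge, w'' is a child of a, so u misses both w'' of depth 2 and w' of depth 3, against
         [miss]. *)
      rewrite leqNgt; apply/negP => x4.
      have W3 : (2 < #|W|)%N by move: cardW x4; clear -n7; lia.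
      have aw : e a w by rewrite sym_e.
      have [w'' ] : exists w'', w'' \in (W :&: nbrs e a) :\ w.
        have wWN : w \in W :&: nbrs e a by rewrite !inE w22.
        apply/card_gt0P; have := wide0 a1 w22 aw; rewrite [X in (_ <= X + _)%N](cardsD1 w) wWN.
        by move: #|_ :\ w| #|W| W3; clear; lia.
      rewrite !inE => /and3P[/eqP w''w w''2 aw''].
      have cw : (w = c /\ a = c') \/ (w = c' /\ a = c).
        by case: (edgeP wa) => -[]; ground; intros;
          first [by left | by right | exfalso; congruence | lia].
      have fw'' : f w'' = a.
        by case: (edgeP aw'') => -[]; ground; move=> E1 E2 //; exfalso; case: cw => -[];
          intros; first [congruence | lia].
      have w''w' : w'' = w'.
        have E : d w'' = 2%N.
          have [|_] := @fP w''; first by rewrite -lt0n ltnW.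
          by rewrite fw'' a1.
        apply: (miss u1 w22 uw) => //; first by rewrite w'3.
          by case: cw => -[cw1 cw2]; nonedge.
        by case: cw => -[cw1 cw2]; nonedge.
      by apply: w''w; congruence.
    have [z' [z'1 ]] : exists z', d z' = 1%N /\ z' \notin [:: u; a; z] by exact: pick_nbr.
    rewrite !inE !negb_or => /and3P[/eqP z'u /eqP z'a /eqP z'z].
    by exists z, z'; split=> //; split=> //; congruence.
  have bad a z : d a = 1%N -> a <> u -> e u a || e w a -> d z = 1%N -> z <> a -> z <> u ->
      ~~ e u z /\ ~~ e w z.
    move=> a1 au uwa z1 za zu; have fa := f1 a1; have fz := f1 z1.
    have cc : [\/ u = c /\ a = c', u = c' /\ a = c, w = c /\ a = c' | w = c' /\ a = c].
      case/orP: uwa => /edgeP[] [];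
        try by [move=> *; constructor 1 | move=> *; constructor 2 ]; try by ground; intros; exfalso; first [congruence | lia].
      - by constructor 3.
      - by constructor 4.
    by split; case: cc => -[cc1 cc2]; nonedge.
  have [by_|] := boolP (e u y || e w y).
    have [z [z' [z1 z'1 zu z'u [zz' [zy z'y]]]]] := third y y1 yu by_.
    have [] := bad y z y1 yu by_ z1 zy zu; have [] := bad y z' y1 yu by_ z'1 z'y z'u.
    by exists z, z'.
  rewrite negb_or => /andP[uy wy].
  have [by_|] := boolP (e u y' || e w y').
    have [z [z' [z1 z'1 zu z'u [zz' [zy z'y]]]]] := third y' y'1 y'u by_.
    have [] := bad y' z y'1 y'u by_ z1 zy zu; have [] := bad y' z' y'1 y'u by_ z'1 z'y z'u.
    by exists z, z'.
  rewrite negb_or => /andP[uy' wy'].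
  by exists y, y'; split=> //; split=> //; congruence.
have w'u : w' != u by apply/eqP; congruence.
apply: (@improve_adjacent e u w x w' y y') => //.
- by rewrite sym_e.
- by apply/eqP; congruence.
- by rewrite sym_e -d1P w2.
- by rewrite sym_e.
- by apply/negP => /dlip; rewrite u1 w'3.
- by apply/eqP.
Qed.

(* The extra edge closes the 4-cycle x u1 w1 u2. *)
Let case_square u1 u2 w1 w2 : d u1 = 1%N -> d u2 = 1%N -> d w1 = 2%N -> d w2 = 2%N ->
  f w1 = u1 -> f w2 = u2 -> u1 <> u2 -> e u2 w1 -> False.
Proof.
move=> u11 u21 w12 w22 fw1 fw2 u12 u2w1; apply: stuck.
have uw1 : e u1 w1 by rewrite -fw1 fE // w12.
have fu1 := f1 u11; have fu2 := f1 u21.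
have cw : (u2 = c /\ w1 = c') \/ (u2 = c' /\ w1 = c).
  by case: (edgeP u2w1) => -[]; ground; intros;
    first [by left | by right | exfalso; congruence | lia].
have x3 : (3 <= deg e x)%N by apply: (nbr3 u11 _ uw1); rewrite w12.
have [y [y1 ]] : exists y, d y = 1%N /\ y \notin [:: u1; u2] by exact: pick_nbr.
rewrite !inE !negb_or => /andP[/eqP yu1 /eqP yu2]; have fy := f1 y1.
have w1u2 : e w1 u2 by rewrite sym_e.
by case: cw => -[cw1 cw2]; apply: (@improve_adjacent e u1 w1 x u2 w2 y); wit.
Qed.

(** The branches at u1 and u2 are merged by a move, with w1 and w2 as private neighbours once the
    4-cycles are excluded. At most one extra edge is around, so enough neighbours of x remain
    outside. *)
Let case_two_branches u1 u2 w1 w2 : d u1 = 1%N -> d u2 = 1%N -> d w1 = 2%N -> d w2 = 2%N ->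
  f w1 = u1 -> f w2 = u2 -> u1 <> u2 -> False.
Proof.
move=> u11 u21 w12 w22 fw1 fw2 u12.
have uw1 : e u1 w1 by rewrite -fw1 fE // w12.
have uw2 : e u2 w2 by rewrite -fw2 fE // w22.
have fu1 := f1 u11; have fu2 := f1 u21.
have [/(case_square u11 u21 w12 w22 fw1 fw2 u12)//|u2w1] := boolP (e u2 w1).
have [/(case_square u21 u11 w22 w12 fw2 fw1 (nesym u12))//|u1w2] := boolP (e u1 w2).
have w1_far : (1 < d w1)%N by rewrite w12.
have w2_far : (1 < d w2)%N by rewrite w22.
apply: stuck; have x3 := nbr3 u11 w1_far uw1.
have w1u2 : w1 <> u2 by congruence.
have w2u1 : w2 <> u1 by congruence.
have [adj|nadj] := boolP (e u1 u2).
  have x4 := wider u11 w1_far uw1 u21 adj.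
  have cu : (u1 = c /\ u2 = c') \/ (u1 = c' /\ u2 = c).
    by case: (edgeP adj) => -[]; ground; intros;
      first [by left | by right | exfalso; congruence | lia].
  have [y [y1 ]] : exists y, d y = 1%N /\ y \notin [:: u1; u2] by apply: pick_nbr; exact: ltnW.
  rewrite !inE !negb_or => /andP[/eqP yu1 /eqP yu2]; have fy := f1 y1.
  have [y' [y'1 ]] : exists y', d y' = 1%N /\ y' \notin [:: u1; u2; y] by exact: pick_nbr.
  rewrite !inE !negb_or => /and3P[/eqP y'u1 /eqP y'u2 /eqP y'y]; have fy' := f1 y'1.
  by case: cu => -[cu1 cu2]; apply: (@improve_adjacent e u1 u2 w1 w2 y y'); wit.
have [y [y1 yu1 yu2 [nu1 nu2]]] : exists y,
    [/\ d y = 1%N, y <> u1, y <> u2 & ~~ e u1 y /\ ~~ e u2 y].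
  have [y [y1 ]] : exists y, d y = 1%N /\ y \notin [:: u1; u2] by exact: pick_nbr.
  rewrite !inE !negb_or => /andP[/eqP yu1 /eqP yu2]; have fy := f1 y1.
  have [uy|] := boolP (e u1 y || e u2 y); last by rewrite negb_or => /andP[]; exists y.
  have x4 : (4 <= deg e x)%N.
    by case/orP: uy => [/(wider u11 w1_far uw1 y1)|/(wider u21 w2_far uw2 y1)].
  have cy : [\/ u1 = c /\ y = c', u1 = c' /\ y = c, u2 = c /\ y = c' | u2 = c' /\ y = c].
    by case/orP: uy => /edgeP[] []; ground; intros;
      first [by constructor 1 | by constructor 2 | by constructor 3 | by constructor 4
            | exfalso; congruence].
  have [z [z1 ]] : exists z, d z = 1%N /\ z \notin [:: u1; u2; y] by exact: pick_nbr.
  rewrite !inE !negb_or => /and3P[/eqP zu1 /eqP zu2 /eqP zy]; have fz := f1 z1.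
  by exists z; split=> //; case: cy => -[cy1 cy2]; split; nonedge.
apply: (@improve_nonadjacent e u1 u2 x w1 w2 y) => //; try by apply/eqP.
- by rewrite sym_e -d1P u11.
- by rewrite sym_e -d1P u21.
Qed.

(** A vertex at depth 3 or more would have one at depth exactly 3 among its ancestors or be one
    itself; so all of W is at depth 2, and its vertices share one parent. *)
Lemma stuck_cases : double_hub e \/ hung_triangle e.
Proof.
have depth2 v : (d v <= 2)%N.
  have [m] := ubnP (d v); elim: m v => // m IH v; rewrite ltnS => dv.
  rewrite leqNgt; apply/negP => v3.
  have [|_ E] := @fP v; first by rewrite -lt0n ltnW // ltnW.
  have f2 : (d (f v) <= 2)%N by apply: IH; rewrite -E.
  by apply: (@case_depth3 v); move: E v3 f2; clear; lia.
have W_depth w : (1 < d w)%N -> d w = 2%N by have := depth2 w; clear; lia.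
have par w : d w = 2%N -> d (f w) = 1%N.
  by move=> w2; have [|_] := @fP w; rewrite w2 // => -[].
have /card_gt0P[w0] : (0 < #|W|)%N by exact: ltnW W2.
rewrite inE => /W_depth w02; apply: (@case_children (f w0) (par _ w02)) => w /W_depth w2.
split=> //; apply/eqP; apply: contraT => /eqP fw; exfalso.
exact: (@case_two_branches (f w) (f w0) w w0 (par _ w2) (par _ w02)).
Qed.

End Cases.

Lemma improve_cases e : unicyc e -> small_deg e ->
  [\/ improvable e, double_hub e | hung_triangle e].
Proof.
move=> ue sd; have [|stuck] := pselect (improvable e); first by constructor 1.
pose i0 : 'I_n := Ordinal (leq_ltn_trans (leq0n 6) n7).
pose x := [arg max_(i > i0) deg e i].
have xmax i : (deg e i <= deg e x)%N by rewrite /x; case: arg_maxnP => // j _; apply.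
have [d [f [c [c' [B ecc [dc dc'] tcc edgeP]]]]] := unicyc_structure x ue.
have [|] := stuck_cases ue sd xmax stuck B ecc dc dc' tcc edgeP.
  by constructor 2.
by constructor 3.
Qed.

End Improve.

(** * Graphs with five special vertices *)

(** The bijection carries the edges of e0 into those of e, and e has no more edges than e0, so
    nothing is left over. Identifying a graph thus takes only a check of the edges of e0. *)
Lemma graph_iso_embedding n (e e0 : rel 'I_n) (s : seq 'I_n) x0 :
  uniq s -> size s = n -> (forall i j : 'I_n, e0 i j -> e (nth x0 s i) (nth x0 s j)) ->
  (\sum_i deg e i <= \sum_i deg e0 i)%N -> graph_iso e e0.
Proof.
move=> us ss emb cnt; apply: graph_iso_sym.
have inj : injective (fun i : 'I_n => nth x0 s i).
  by move=> i j /eqP; rewrite nth_uniq ?ss // => /eqP/val_inj.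
exists (perm inj) => a b; rewrite !permE.
have -> : e0 a b = ((a, b) \in [set ab : 'I_n * 'I_n | e0 ab.1 ab.2]) by rewrite inE.
suff -> : [set ab : 'I_n * 'I_n | e0 ab.1 ab.2] =
    [set ab : 'I_n * 'I_n | e (nth x0 s ab.1) (nth x0 s ab.2)] by rewrite inE.
apply/eqP; rewrite eqEcard; apply/andP; split.
  by apply/fintype.subsetP => ab; rewrite !inE; apply: emb.
rewrite -sum_deg_pairs; apply: leq_trans cnt; rewrite sum_deg_pairs.
pose h (ab : 'I_n * 'I_n) := (perm inj ab.1, perm inj ab.2).
have hinj : injective h by move=> [a1 b1] [a2 b2] [/perm_inj -> /perm_inj ->].
rewrite -(card_imset _ hinj); apply: subset_leq_card; apply/fintype.subsetP => ab.
by move/imsetP => [cd + ->]; rewrite !inE /h /= !permE.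
Qed.

Section Hub.
Variable (k : nat).
Implicit Types (E : seq (nat * nat)).

(* Five special vertices 0..4 spanned by the edge list E; every other vertex is a leaf at 0. *)
Definition hub_nat E (i j : nat) : bool :=
  [|| (i, j) \in E, (j, i) \in E, (i == 0%N) && (4 < j)%N | (j == 0%N) && (4 < i)%N].

Definition hub E : rel 'I_(5 + k) := fun x y => hub_nat E x y.

Definition hub_wf E := all (fun ij => (ij.1 < ij.2 < 5)%N) E && uniq E.

Lemma hub_sym E : symmetric (hub E).
Proof. by move=> x y; rewrite /hub /hub_nat orbCA [X in _ || (_ || X)]orbC. Qed.

Lemma hub_irr E : hub_wf E -> irreflexive (hub E).
Proof.
move=> /andP[/allP wf _] x; rewrite /hub /hub_nat.
have [/wf|_] := boolP (_ \in E); first by rewrite /= ltnn.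
by rewrite !orFb orbb; case: x => -[|x] hx.
Qed.

Definition hub_deg E (i : nat) : nat :=
  (count (hub_nat E i) (iota 0 5) + (if i == 0%N then k else 0))%N.

Lemma hub_special_leaf E i j : hub_wf E -> (i < 5)%N -> hub_nat E i (5 + j) = (i == 0%N).
Proof.
move=> /andP[/allP wf _] i5; rewrite /hub_nat.
have [/wf|_] := boolP (_ \in E); first by rewrite /=; lia.
have [/wf|_] := boolP (_ \in E); first by rewrite /=; lia.
by lia.
Qed.

Lemma hub_leaf_leaf E i j : hub_wf E -> hub_nat E (5 + i) (5 + j) = false.
Proof.
move=> /andP[/allP wf _]; rewrite /hub_nat.
have [/wf|_] := boolP (_ \in E); first by rewrite /=; lia.
have [/wf|_] := boolP (_ \in E); first by rewrite /=; lia.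
by lia.
Qed.

Lemma hub_natC E i j : hub_nat E i j = hub_nat E j i.
Proof. by rewrite /hub_nat orbCA [X in _ || (_ || X)]orbC. Qed.

Lemma deg_sum n (e : rel 'I_n) i : deg e i = (\sum_j e i j)%N.
Proof. by rewrite /deg -sum1_card big_mkcond; apply: eq_bigr => j _; rewrite inE; case: (e i j). Qed.

Lemma deg_hub_special E (i : 'I_5) : hub_wf E -> deg (hub E) (lshift k i) = hub_deg E i.
Proof.
move=> wf; rewrite deg_sum big_split_ord /hub_deg; congr addn.
  rewrite -[RHS]sum1_count [RHS]big_mkcond -[RHS]/(\sum_(0 <= j < 5) _)%N big_mkord.
  by apply: eq_bigr => j _; rewrite /hub /=; case: (hub_nat _ _ _).
rewrite (eq_bigr (fun=> nat_of_bool (i == 0%N :> nat))) => [|j _]; last first.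
  by rewrite /hub /= hub_special_leaf.
by rewrite sum_nat_const card_ord; case: ifP; rewrite ?muln1 ?muln0.
Qed.

Lemma deg_hub_leaf E (j : 'I_k) : hub_wf E -> deg (hub E) (rshift 5 j) = 1%N.
Proof.
move=> wf; rewrite deg_sum big_split_ord /= [X in (_ + X)%N]big1 => [|i _]; last first.
  by rewrite /hub /= hub_leaf_leaf.
rewrite addn0 (eq_bigr (fun i : 'I_5 => nat_of_bool (val i == 0%N))) => [|i _]; last first.
  by rewrite /hub /= hub_natC hub_special_leaf.
by rewrite !big_ord_recr big_ord0.
Qed.

Lemma sum_deg_hub E : hub_wf E ->
  (\sum_i deg (hub E) i = \sum_(i < 5) hub_deg E i + k)%N.
Proof.
move=> wf; rewrite big_split_ord /=; congr addn.
  by apply: eq_bigr => i _; apply: deg_hub_special.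
rewrite (eq_bigr (fun=> 1%N)) => [|i _]; last exact: deg_hub_leaf.
by rewrite sum_nat_const card_ord muln1.
Qed.

Lemma hub_iso E (e : rel 'I_(5 + k)) (l : seq 'I_(5 + k)) x : hub_wf E ->
  symmetric e -> (\sum_i deg e i <= \sum_i deg (hub E) i)%N ->
  uniq l -> size l = 5%N -> nth x l 0 = x ->
  (forall i j, (i, j) \in E -> e (nth x l i) (nth x l j)) ->
  (forall w, w \notin l -> e x w) -> graph_iso e (hub E).
Proof.
move=> wf sym_e cnt ul sl l0 lE lrest.
pose r := [seq w <- enum 'I_(5 + k) | w \notin l].
have us : uniq (l ++ r).
  rewrite cat_uniq ul filter_uniq ?enum_uniq //= andbT; apply/hasPn => w.
  by rewrite mem_filter => /andP[].
have ss : size (l ++ r) = (5 + k)%N.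
  rewrite -[RHS](card_ord (5 + k)) -cardsT -(card_uniqP us); apply: eq_card => w.
  by rewrite mem_cat mem_filter mem_enum !inE andbT orbN.
have sr : size r = k by move: ss; rewrite size_cat sl => /addnI.
have emb i j : ((i, j) \in E) || (i == 0%N) && (4 < j)%N -> (j < 5 + k)%N ->
    e (nth x (l ++ r) i) (nth x (l ++ r) j).
  case/orP=> [ij _|/andP[/eqP -> j4] jk].
    have /andP[/allP/(_ _ ij) /= ij5 _] := wf.
    by rewrite !nth_cat sl !ifT; [exact: lE | lia | lia].
  rewrite nth_cat sl /= l0; apply: lrest.
  rewrite nth_cat sl ltnNge j4 /=.
  have : nth x r (j - 5) \in r by rewrite mem_nth // sr; move: j4 jk; clear; lia.
  by rewrite mem_filter => /andP[].
apply: (@graph_iso_embedding _ _ _ (l ++ r) x us ss _ cnt) => i j.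
rewrite /hub /hub_nat => /or4P[ij|ij|ij|ij].
- by apply: emb; rewrite ?ij.
- by rewrite sym_e; apply: emb; rewrite ?ij.
- by apply: emb; rewrite ?ij ?orbT.
- by rewrite sym_e; apply: emb; rewrite ?ij ?orbT.
Qed.

End Hub.

Section HubForm.
Context {R : realType} (p : R) (k : nat).
Implicit Types (E : seq (nat * nat)) (Y : nat -> R).

Definition hub_wt E (i j : nat) : R :=
  if hub_nat E i j then pnorm p (hub_deg k E i)%:R (hub_deg k E j)%:R else 0.

Definition leaf_wt E : R := pnorm p (hub_deg k E 0)%:R 1%:R.

Definition hub_form E Y (P : R) : R :=
  \sum_(i < 5) \sum_(j < 5) hub_wt E i j * (Y i * Y j) + 2 * (leaf_wt E * (Y 0%N * (k%:R * P))).

Lemma wt_special E (i j : 'I_5) : hub_wf E ->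
  wt p (hub E) (lshift k i) (lshift k j) = hub_wt E i j.
Proof. by move=> wf; rewrite /wt !deg_hub_special. Qed.

Lemma wt_special_leaf E (i : 'I_5) (j : 'I_k) : hub_wf E ->
  wt p (hub E) (lshift k i) (rshift 5 j) = if i == 0%N :> nat then leaf_wt E else 0.
Proof.
move=> wf; rewrite /wt /hub /= hub_special_leaf // deg_hub_special // deg_hub_leaf //.
by rewrite /leaf_wt; case: eqP => // ->.
Qed.

Lemma wt_leaf_leaf E (i j : 'I_k) : hub_wf E -> wt p (hub E) (rshift 5 i) (rshift 5 j) = 0.
Proof. by move=> wf; rewrite /wt /hub /= hub_leaf_leaf. Qed.

Lemma hub_sform E (y : 'I_(5 + k) -> R) Y (P : R) : hub_wf E ->
  (forall i : 'I_5, y (lshift k i) = Y i) -> (forall j : 'I_k, y (rshift 5 j) = P) ->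
  sform p (hub E) y = hub_form E Y P.
Proof.
move=> wf yY yP; rewrite /sform /hub_form big_split_ord /=.
have rowE (i : 'I_5) : \sum_j wt p (hub E) (lshift k i) j * (y (lshift k i) * y j) =
    \sum_(j < 5) hub_wt E i j * (Y i * Y j) +
    (if i == 0%N :> nat then leaf_wt E * (Y 0%N * (k%:R * P)) else 0).
  rewrite big_split_ord /=; congr (_ + _).
    by apply: eq_bigr => j _; rewrite wt_special // !yY.
  under eq_bigr do rewrite wt_special_leaf // yY yP.
  rewrite sumr_const card_ord -mulr_natl; by case: eqP => [->|_]; ring.
have rowL (i : 'I_k) : \sum_j wt p (hub E) (rshift 5 i) j * (y (rshift 5 i) * y j) =
    leaf_wt E * (Y 0%N * P).
  rewrite big_split_ord /= [X in _ + X]big1 => [|j _]; last by rewrite wt_leaf_leaf // mul0r.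
  under eq_bigr => j _ do rewrite (wtC _ _ _ (@hub_sym k E)) wt_special_leaf // yY yP.
  rewrite (bigD1 ord0) //= big1 => [|j j0]; first by rewrite !addr0; ring.
  have -> : (j == 0%N :> nat) = false by apply: contraNF j0 => /eqP j0; apply/eqP/val_inj.
  by rewrite mul0r.
under eq_bigr do rewrite rowE.
rewrite big_split /= -addrA; congr (_ + _).
under [X in _ + X]eq_bigr do rewrite rowL.
rewrite sumr_const card_ord -mulr_natl (bigD1 ord0) //= big1 => [|j j0].
  by rewrite addr0; ring.
have -> : (j == 0%N :> nat) = false by apply: contraNF j0 => /eqP j0; apply/eqP/val_inj.
by [].
Qed.

(* The eigenvector is recorded by its special values Y and its common value P on the leaves. *)
Lemma hub_perron E : (0 < k)%N -> hub_wf E -> connected_graph (@hub k E) -> exists Y P,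
  [/\ forall i, 0 < Y i, 0 < P /\ 0 < srho p (@hub k E),
      srho p (@hub k E) * P = leaf_wt E * Y 0%N,
      forall i, (i < 5)%N -> \sum_(j < 5) hub_wt E i j * Y j +
        (if i == 0%N then leaf_wt E * (k%:R * P) else 0) = srho p (@hub k E) * Y i
    & forall E', hub_wf E' ->
        hub_form E Y P < hub_form E' Y P -> srho p (@hub k E) < srho p (@hub k E')].
Proof.
move=> k0 wf con; have [y pv] := perron_exists p (isT : (0 < 5 + k)%N) (@hub_sym k E) con.
have [y0 eig] := pv; set l := srho p (hub E) in eig *.
(* [inord] makes Y total on nat, so that positivity holds at every index. *)
pose o i : 'I_5 := inord i.
pose Y i := y (lshift k (o i)).
have yY (i : 'I_5) : y (lshift k i) = Y i by rewrite /Y /o inord_val.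
have F0 : 0 < leaf_wt E by rewrite /leaf_wt pnormC pnorm_gt0 // ltr0n.
have leaf (j : 'I_k) : l * y (rshift 5 j) = leaf_wt E * Y 0%N.
  rewrite -eig big_split_ord /= [X in _ + X]big1 => [|i _]; last by rewrite wt_leaf_leaf // mul0r.
  under eq_bigr => i _ do rewrite (wtC _ _ _ (@hub_sym k E)) wt_special_leaf // yY.
  rewrite (bigD1 ord0) //= big1 => [|i i0]; first by rewrite !addr0.
  have -> : (i == 0%N :> nat) = false by apply: contraNF i0 => /eqP i0; apply/eqP/val_inj.
  by rewrite mul0r.
have l0 : 0 < l.
  rewrite -(pmulr_lgt0 _ (y0 (rshift 5 (Ordinal k0)))) leaf.
  by rewrite mulr_gt0 // /Y.
pose P := leaf_wt E * Y 0%N / l.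
have yP (j : 'I_k) : y (rshift 5 j) = P by rewrite /P -(leaf j) mulrAC divff ?mul1r ?gt_eqF.
exists Y, P; split.
- by move=> i; apply: y0.
- by split=> //; rewrite /P divr_gt0 // mulr_gt0 // /Y.
- by rewrite /P mulrC divfK // gt_eqF.
- move=> i i5; rewrite -[i](inordK (i5 : (i < 4.+1)%N)) -/(o i) -yY -eig big_split_ord /=.
  congr (_ + _); first by apply: eq_bigr => j _; rewrite wt_special // yY.
  under eq_bigr do rewrite wt_special_leaf // yP.
  by rewrite sumr_const card_ord -mulr_natl; case: eqP => _; ring.
move=> E' wf' lt; apply: (perron_lt _ _ pv) => //; first exact: hub_sym.
by rewrite (hub_sform wf yY yP) (hub_sform wf' yY yP).
Qed.

Lemma hub_connected E : hub_wf E -> (forall i, (i < 5)%N -> (i != 0)%N ->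
    hub_nat E i 0 || [exists j : 'I_5, hub_nat E i j && hub_nat E j 0]) ->
  connected_graph (@hub k E).
Proof.
move=> wf h; have symc : connect_sym (@hub k E) by apply: sym_connect_sym; apply: hub_sym.
pose z : 'I_(5 + k) := lshift k ord0.
suff toz v : connect (@hub k E) v z.
  by move=> a b; apply: connect_trans (toz a) _; rewrite symc.
case: (split_ordP v) => i -> {v}; last first.
  by apply: connect1; rewrite /hub /= hub_natC hub_special_leaf.
have [->|i0] := eqVneq i ord0; first exact: connect0.
have /orP[i0'|/existsP[j /andP[ij j0]]] := h i (ltn_ord i) i0; first exact: connect1.
by apply: connect_trans (_ : connect _ (lshift k j) _); apply: connect1.
Qed.

End HubForm.

Section NatWeights.
Context {R : realType} (p : R).
Hypothesis p2 : 2 <= p.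
Implicit Types a b c d : nat.

Definition nwt a b : R := pnorm p a%:R b%:R.

Lemma nwtC a b : nwt a b = nwt b a.
Proof. exact: pnormC. Qed.

Lemma nwt_gt0 a b : (0 < a)%N -> 0 < nwt a b.
Proof. by move=> a0; rewrite /nwt pnorm_gt0 // ltr0n. Qed.

Lemma nwt_le a b c d : (a <= c)%N -> (b <= d)%N -> nwt a b <= nwt c d.
Proof. by move=> ac bd; apply: ler_pnorm; rewrite // ?ler0n ?ler_nat. Qed.

Lemma nwt_lt a b c d : (a < c)%N -> (b <= d)%N -> nwt a b < nwt c d.
Proof. by move=> ac bd; apply: ltr_pnorm; rewrite // ?ler0n ?ler_nat ?ltr_nat. Qed.

Lemma nwt_majorization a b c d : (a <= c)%N -> (b <= c)%N ->
  (a ^ 2 + b ^ 2 <= c ^ 2 + d ^ 2)%N -> nwt a b <= nwt c d.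
Proof.
move=> ac bc s; apply: pnorm_majorization; rewrite ?ler0n ?ler_nat //.
by rewrite -!natrX -!natrD ler_nat.
Qed.

Lemma nwt_ratio a b c d : (0 < a)%N -> (b <= a)%N -> (0 < c)%N -> (a * d <= b * c)%N ->
  nwt a b ^+ 2 * (c ^ 2 + d ^ 2)%:R <= nwt c d ^+ 2 * (a ^ 2 + b ^ 2)%:R.
Proof.
move=> a0 ba c0 h; rewrite !natrD !natrX; apply: pnorm_ratio => //.
- by rewrite ltr0n.
- by rewrite ler0n ler_nat.
- by rewrite ltr0n.
- by rewrite -!natrM ler_nat.
Qed.

Lemma nwt_convex a b : (0 < a)%N -> nwt a b.+1 - nwt a b <= nwt a b.+2 - nwt a b.+1.
Proof.
move=> a0; have h : 0 <= (b%:R : R) <= b.+1%:R by rewrite ler0n ler_nat leqnSn.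
have a0' : 0 < (a%:R : R) by rewrite ltr0n.
by have := pnorm_increment p2 h ler01 a0'; rewrite !natr1 ![nwt a _]nwtC.
Qed.

End NatWeights.

(** * Polynomial inequalities behind U4 < U3 *)

Section PureBounds.
Context {R : realType}.

(** Here t is the squared radius and u, v are squares, all normalized; the bounds are the values at
    p = 2, with 54 = 20 + 2 * 17. The left side bounds (sqrt(t u) + sqrt v)^2, its cross term being
    estimated by 2 sqrt(t u v) <= 20 t + u v / 20. *)
Lemma U4_char_upper (K t a b u v : R) : 3 <= K ->
  (K + 3) ^+ 3 + (K + 3) <= t -> a <= K * ((K + 2) ^+ 2 + 1) + (K + 2) ^+ 2 + 4 -> b <= 54 ->
  0 <= u <= (K + 2) ^+ 2 + 16 -> 0 <= v <= 20 * ((K + 2) ^+ 2 + 4) ->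
  t * u + v + 20 * t + u * v / 20 < (t - a) * (t - b).
Proof.
move=> K3 tT aA b54 /andP[u0 uU] /andP[v0 vV].
set T := (K + 3) ^+ 3 + (K + 3) in tT.
set A := K * ((K + 2) ^+ 2 + 1) + (K + 2) ^+ 2 + 4 in aA.
set U := (K + 2) ^+ 2 + 16 in uU; set V := 20 * _ in vV.
(* Powers of K - 3 let [lra] prove positivity of polynomials in K by expansion at K = 3. *)
have j0 : 0 <= K - 3 by lra.
have j2 := mulr_ge0 j0 j0; have j3 := mulr_ge0 j2 j0; have j4 := mulr_ge0 j3 j0.
have j5 := mulr_ge0 j4 j0.
have TA : 0 < T - A by rewrite /T /A; lra.
have T54 : 0 < T - 54 by rewrite /T; lra.
have t0 : 0 <= t by lra.
have h1 : (t - A) * (t - 54) <= (t - a) * (t - b) by apply: ler_pM; lra.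
have h2 : t * u <= t * U by rewrite ler_wpM2l.
have h3 : u * v <= U * V by apply: ler_pM.
(* The difference of the two sides is expanded at t = T: the coefficients are 1, c1 and c0. *)
have h4 : t * U + V + 20 * t + U * V / 20 < (t - A) * (t - 54).
  have d0 : 0 <= t - T by rewrite subr_ge0.
  have c1 : 0 < (T - A) + (T - 54) - (U + 20) by rewrite /T /A /U; lra.
  have c0 : 0 < (T - A) * (T - 54) - T * (U + 20) - V - U * V / 20.
    rewrite /T /A /U /V; lra.
  have := mulr_ge0 d0 d0; have := mulr_ge0 d0 (ltW c1); lra.
lra.
Qed.

(** The unit is g = w(4,4). At p = 2, 5/8 = 20/32 and 17/32 are the squares of w(4,2)/g and
    w(4,1)/g, 78/17 = 3 * 26/17 bounds 3 w(5,1)^2 by w(4,1)^2, and 29/10 = 2 * 29/20 bounds 2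
    w(5,2)^2 by w(4,2)^2. *)
Lemma quartic_n7 (t a b : R) : 0 < t -> t ^+ 2 = t + 2 * a + 2 * b -> 5 / 8 <= a -> 17 / 32 <= b ->
  (t ^+ 2 - 78 / 17 * b) * (t ^+ 2 - 1 / 2) < 29 / 10 * a * t ^+ 2.
Proof.
move=> t0 tE a0 b0.
(* At the least a and b the equation has its positive root near 2.1008. *)
have t2 : 21 / 10 <= t.
  rewrite leNgt; apply/negP => tl.
  have : 0 < t * (21 / 10 - t) by rewrite mulr_gt0 // subr_gt0.
  lra.
have j0 : 0 <= t - 21 / 10 by lra.
have j2 := mulr_ge0 j0 j0; have j3 := mulr_ge0 j2 j0; have j4 := mulr_ge0 j3 j0.
(* After elimination of a the gap is affine in b with this nonnegative slope, so b = 17/32 is the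
   worst case. *)
have c0 : 0 <= (b - 17 / 32) * (287 / 170 * t ^+ 2 - 39 / 17).
  apply: mulr_ge0; first by lra.
  lra.
have -> : a = (t ^+ 2 - t) / 2 - b by lra.
lra.
Qed.

Lemma amgm_le (s x y : R) : 0 <= x + y -> s ^+ 2 = 4 * x * y -> s <= x + y.
Proof.
move=> xy0 sE; rewrite leNgt; apply/negP => h.
have : (x + y) ^+ 2 < s ^+ 2 by rewrite ltr_sqr // nnegrE // (le_trans xy0) // ltW.
have := sqr_ge0 (x - y); lra.
Qed.

Lemma U4_U3_n7_absurd (g l m A B C D : R) : 0 < g -> 0 < l -> 0 < m -> m <= l -> 0 < A ->
  g ^+ 2 * (4 ^ 2 + 2 ^ 2)%:R <= A * (4 ^ 2 + 4 ^ 2)%:R ->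
  g ^+ 2 * (4 ^ 2 + 1 ^ 2)%:R <= B * (4 ^ 2 + 4 ^ 2)%:R ->
  B * (5 ^ 2 + 1 ^ 2)%:R <= C * (4 ^ 2 + 1 ^ 2)%:R ->
  A * (5 ^ 2 + 2 ^ 2)%:R <= D * (4 ^ 2 + 2 ^ 2)%:R ->
  l ^+ 2 = l * g + 2 * A + 2 * B -> 3 * C < m ^+ 2 -> g ^+ 2 / 2 < m ^+ 2 ->
  (m ^+ 2 - 3 * C) * (m ^+ 2 - g ^+ 2 / 2) = 2 * D * m ^+ 2 -> False.
Proof.
move=> g0 l0 m0 ml A0 rA rB rC rD lE ma mb chr3.
have g2 : 0 < g ^+ 2 by rewrite exprn_gt0.
have gn : g != 0 by rewrite gt_eqF.
have ml2 : m ^+ 2 <= l ^+ 2 by rewrite ler_sqr // nnegrE ltW.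
(* The function (s - 3C)(1 - g^2 / (2s)) increases with s, so the equation at s = m^2 becomes an
   inequality at s = l^2. *)
have main : 2 * D * l ^+ 2 <= (l ^+ 2 - 3 * C) * (l ^+ 2 - g ^+ 2 / 2).
  have m2 : 0 < m ^+ 2 by rewrite exprn_gt0.
  have e1 : (m ^+ 2 - 3 * C) * ((m ^+ 2 - g ^+ 2 / 2) * l ^+ 2) <=
      (l ^+ 2 - 3 * C) * ((l ^+ 2 - g ^+ 2 / 2) * m ^+ 2).
    apply: ler_pM; first by rewrite subr_ge0 ltW.
    - by rewrite mulr_ge0 ?sqr_ge0 // subr_ge0 ltW.
    - by rewrite lerD2r.
    by have := ler_wpM2l (ltW g2) ml2; rewrite !mulrBl; lra.
  rewrite -(ler_pM2r m2) -[leRHS]mulrA; apply: le_trans e1.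
  by rewrite [leRHS]mulrA chr3 mulrAC.
have a58 : 5 / 8 <= A / g ^+ 2 by rewrite ler_pdivlMr //; lra.
have b17 : 17 / 32 <= B / g ^+ 2 by rewrite ler_pdivlMr //; lra.
have tE : (l / g) ^+ 2 = l / g + 2 * (A / g ^+ 2) + 2 * (B / g ^+ 2).
  have -> : (l / g) ^+ 2 = l ^+ 2 / g ^+ 2 by field.
  by rewrite lE; field.
have := quartic_n7 (divr_gt0 l0 g0) tE a58 b17.
have -> : ((l / g) ^+ 2 - 78 / 17 * (B / g ^+ 2)) * ((l / g) ^+ 2 - 1 / 2) =
    (l ^+ 2 - 78 / 17 * B) * (l ^+ 2 - g ^+ 2 / 2) / g ^+ 4 by field.
have -> : 29 / 10 * (A / g ^+ 2) * (l / g) ^+ 2 = 29 / 10 * A * l ^+ 2 / g ^+ 4 by field.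
rewrite ltr_pM2r ?invr_gt0 ?exprn_gt0 // ltNge => /negP; apply.
have h1 : 29 / 10 * A * l ^+ 2 <= 2 * D * l ^+ 2 by rewrite ler_pM2r ?exprn_gt0 //; lra.
have h2 : (l ^+ 2 - 3 * C) * (l ^+ 2 - g ^+ 2 / 2) <= (l ^+ 2 - 78 / 17 * B) * (l ^+ 2 - g ^+ 2 / 2).
  by rewrite ler_wpM2r //; lra.
lra.
Qed.

End PureBounds.

(* The primed lists are relabelings chosen so that each comparison keeps a common leaf set. *)
Definition edges_S : seq (nat * nat) := [:: (0, 1); (0, 2); (0, 3); (0, 4); (1, 2)]%N.
Definition edges_U1 : seq (nat * nat) := [:: (0, 1); (0, 2); (0, 4); (1, 2); (1, 3)]%N.
Definition edges_U1' : seq (nat * nat) := [:: (0, 1); (0, 2); (0, 3); (1, 2); (1, 4)]%N.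
Definition edges_U2 : seq (nat * nat) := [:: (0, 1); (0, 2); (0, 3); (1, 2); (3, 4)]%N.
Definition edges_U2' : seq (nat * nat) := [:: (0, 1); (0, 3); (0, 4); (1, 3); (2, 4)]%N.
Definition edges_U3 : seq (nat * nat) := [:: (0, 1); (0, 3); (0, 4); (1, 2); (2, 3)]%N.
Definition edges_U4 : seq (nat * nat) := [:: (0, 1); (0, 2); (1, 2); (1, 3); (1, 4)]%N.
Definition edges_U4' : seq (nat * nat) := [:: (0, 1); (0, 4); (1, 2); (1, 3); (1, 4)]%N.
Definition edges_hung : seq (nat * nat) := [:: (0, 1); (0, 4); (1, 2); (1, 3); (2, 3)]%N.

(** * Comparison of consecutive extremal graphs *)

Section Compare.
Context {R : realType} (p : R) (k : nat).
Hypotheses (p2 : 2 <= p) (k2 : (2 <= k)%N).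

Notation w := (nwt p).

Let k0 : (0 < k)%N. Proof. exact: ltnW. Qed.

Lemma hub_connected_check (E : seq (nat * nat)) : hub_wf E ->
  all (fun i => hub_nat E i 0 || has (fun j => hub_nat E i j && hub_nat E j 0) (iota 0 5)) (iota 1 4) ->
  connected_graph (@hub k E).
Proof.
move=> wf /allP h; apply: hub_connected => // i i5 i0.
have /h : i \in iota 1 4 by rewrite mem_iota lt0n i0.
case/orP=> [->//|/hasP[j]]; rewrite mem_iota => /andP[_ j5] hj; apply/orP; right.
by apply/existsP; exists (Ordinal j5).
Qed.

Local Notation deg_rule E a b c d e := ((hub_deg k E 0 = (a + k)%N) * (hub_deg k E 1 = b%N) *
  (hub_deg k E 2 = c%N) * (hub_deg k E 3 = d%N) * (hub_deg k E 4 = e%N))%type.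

Let degU1 : deg_rule edges_U1' 3 3 2 1 1. Proof. by []. Qed.
Let degU2 : deg_rule edges_U2 3 2 2 2 1. Proof. by []. Qed.
Let degU2' : deg_rule edges_U2' 3 2 1 2 2. Proof. by []. Qed.
Let degU3 : deg_rule edges_U3 3 2 2 2 1. Proof. by []. Qed.
Let degU4 : deg_rule edges_U4 2 4 2 1 1. Proof. by []. Qed.
Let degU4' : deg_rule edges_U4' 2 4 1 1 2. Proof. by []. Qed.
Let degH : deg_rule edges_hung 2 3 2 2 1. Proof. by []. Qed.

Let leafE E : leaf_wt p k E = w (hub_deg k E 0) 1. Proof. by []. Qed.

Ltac unfold_hub rule :=
  rewrite ?leafE /hub_wt /= ?(mul0r, add0r, addr0) -?/(w _ _) ?rule.
Ltac row r i rule :=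
  have := r i isT; rewrite !big_ord_recr !big_ord0; unfold_hub rule.
Ltac unfold_form rule :=
  rewrite {1}/hub_form !big_ord_recr !big_ord0; unfold_hub rule.

Lemma hub_rho_lt (E E' : seq (nat * nat)) : hub_wf E -> hub_wf E' -> connected_graph (@hub k E) ->
  (forall l Y P, (forall i, 0 < Y i) -> 0 < P -> 0 < l -> l * P = leaf_wt p k E * Y 0%N ->
    (forall i, (i < 5)%N -> \sum_(j < 5) hub_wt p k E i j * Y j +
        (if i == 0%N then leaf_wt p k E * (k%:R * P) else 0) = l * Y i) ->
    hub_form p k E Y P < hub_form p k E' Y P) ->
  srho p (@hub k E) < srho p (@hub k E').
Proof.
move=> wf wf' con h; have [Y [P [Y0 [P0 l0] leaf row cmp]]] := hub_perron p k0 wf con.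
exact: cmp (h _ _ _ Y0 P0 l0 leaf row).
Qed.

(** The pendant vertex 4 passes from 3 to 1. The eigenvalue equations give q <= a <= b, so what the
    edge 03 loses is regained by 01 through convexity, and the edges 12 and 34 are replaced by
    heavier terms. *)
Lemma rho_U2_lt_U1 : srho p (@hub k edges_U2) < srho p (@hub k edges_U1').
Proof.
apply: hub_rho_lt => //; first exact: hub_connected_check.
move=> l Y P Y0 P0 l0 leaf row.
row row 1%N degU2; row row 2%N degU2; row row 3%N degU2; row row 4%N degU2.
unfold_form degU2; unfold_form degU1.
rewrite !(nwtC _ 2 (3 + k)) !(nwtC _ 1 (3 + k)) !(nwtC _ 3 (3 + k)) !(nwtC _ 1 2) !(nwtC _ 2 3) !(nwtC _ 1 3).
move: (Y 0%N) (Y 1%N) (Y 2%N) (Y 3%N) (Y 4%N) (Y0 0%N) (Y0 1%N) (Y0 2%N) (Y0 3%N) (Y0 4%N).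
move=> x b c a q x0 b0 c0 a0 q0 r4 r3 r2 r1; set rest := 2 * (_ * (_ * (k%:R * P))).
have cvx : w (3 + k) 2 - w (3 + k) 1 <= w (3 + k) 3 - w (3 + k) 2 by apply: nwt_convex.
have m21 : w 2 1 <= w 2 2 by apply: nwt_le.
have m31 : w 2 1 < w 3 1 by apply: nwt_lt.
have m32 : w 2 2 < w 3 2 by apply: nwt_lt.
have m2 : w (3 + k) 1 <= w (3 + k) 2 by apply: nwt_le.
have w21 : 0 < w 2 1 by apply: nwt_gt0.
have wm : 0 < w (3 + k) 2 by apply: nwt_gt0.
have bc : b = c.
  apply/eqP; rewrite -subr_eq0; have /eqP : (l + w 2 2) * (b - c) = 0 by lra.
  by rewrite mulf_eq0 gt_eqF //; lra.
subst c; have lw : w 2 2 < l.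
  rewrite -subr_gt0 -(pmulr_lgt0 _ b0); have := mulr_gt0 wm x0; lra.
have qa : q <= a.
  rewrite -subr_ge0 -(pmulr_rge0 _ l0).
  have : 0 <= (l - w 2 1) * a by rewrite mulr_ge0 ?(ltW a0) // subr_ge0; lra.
  lra.
have ab : a <= b.
  rewrite leNgt; apply/negP => ba.
  have h : (l - w 2 2) * (a - b) <= 0.
    by have : w 2 1 * q <= w 2 2 * a by [apply: ler_pM; lra]; lra.
  by move: h; rewrite leNgt mulr_gt0 // subr_gt0.
have e1 : (w (3 + k) 2 - w (3 + k) 1) * (x * a) <= (w (3 + k) 3 - w (3 + k) 2) * (x * b).
  apply: ler_pM => //; first by rewrite subr_ge0.
    by rewrite mulr_ge0 // ltW.
  by rewrite ler_wpM2l // ltW.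
have e2 : w 2 1 * (a * q) < w 3 1 * (b * q).
  apply: lt_le_trans (_ : w 3 1 * (a * q) <= _).
    by rewrite ltr_pM2r // mulr_gt0.
  by rewrite ler_wpM2l ?ler_wpM2r // ltW // nwt_gt0.
have e3 : w 2 2 * (b * b) < w 3 2 * (b * b) by rewrite ltr_pM2r // mulr_gt0.
lra.
Qed.

(** Multiplying the row of the centre of U3 by l counts walks of length two: each of its 3 + K
    neighbours returns at least F^2 x. *)
Lemma sqr_eigen_ge (l x b z P F M g K : R) : 0 < x -> 0 <= z -> 0 < F -> F <= M -> 0 <= g ->
  l * P = F * x -> M * x + g * z = l * b -> M * b + M * b + F * P + F * (K * P) = l * x ->
  (3 + K) * F ^+ 2 <= l ^+ 2.
Proof.
move=> x0 z0 F0 FM g0 rP r1 r0; rewrite -(ler_pM2r x0).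
have -> : l ^+ 2 * x = M * (l * b) + M * (l * b) + (1 + K) * F * (l * P).
  by rewrite expr2 -mulrA -r0; ring.
rewrite -r1 rP; have : F * (F * x) <= M * (M * x + g * z).
  apply: ler_pM => //; [exact: ltW | by rewrite mulr_ge0 // ltW |].
  have : F * x <= M * x by rewrite ler_pM2r.
  by have := mulr_ge0 g0 z0; lra.
by lra.
Qed.

(** Vertex 2 leaves the 4-cycle and hangs on the leaf 4, while 1 and 3 become adjacent. The new edge
    13 pays for 12 and 23 as soon as 2z <= b, which is l >= 4 w(2,2) by the row of vertex 2. *)
Lemma rho_U3_lt_U2 : srho p (@hub k edges_U3) < srho p (@hub k edges_U2').
Proof.
apply: hub_rho_lt => //; first exact: hub_connected_check.
move=> l Y P Y0 P0 l0 leaf row.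
row row 0%N degU3; row row 1%N degU3; row row 2%N degU3; row row 3%N degU3; row row 4%N degU3.
move: leaf; rewrite leafE degU3.
unfold_form degU3; unfold_form degU2'.
rewrite !(nwtC _ 2 (3 + k)) !(nwtC _ 1 (3 + k)) !(nwtC _ 1 2).
move: (Y 0%N) (Y 1%N) (Y 2%N) (Y 3%N) (Y 4%N) (Y0 0%N) (Y0 1%N) (Y0 2%N) (Y0 3%N) (Y0 4%N).
move=> x b z d q x0 b0 z0 d0 q0 rP r4 r3 r2 r1 r0; set rest := 2 * (_ * (_ * (k%:R * P))).
have m2 : w (3 + k) 1 <= w (3 + k) 2 by apply: nwt_le.
have w21 : 0 < w 2 1 by apply: nwt_gt0.
have w22 : 0 < w 2 2 by apply: nwt_gt0.
have wm : 0 < w (3 + k) 1 by apply: nwt_gt0.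
have bd : b = d by apply: (mulfI (lt0r_neq0 l0)); rewrite -r1 -r3; ring.
subst d.
have qP : q = P by apply: (mulfI (lt0r_neq0 l0)); rewrite -r4 rP.
subst q.
(* The margin is 5 * 26/8 = 65/4 against 16. *)
have lsq : 16 * w 2 2 ^+ 2 <= l ^+ 2.
  have h : w 2 2 ^+ 2 * 26 <= w (3 + k) 1 ^+ 2 * 8.
    have := nwt_ratio p2 (isT : 0 < 2)%N (leqnn 2) (isT : 0 < 5)%N (isT : 2 * 1 <= 2 * 5)%N.
    have : w 5 1 ^+ 2 <= w (3 + k) 1 ^+ 2.
      by rewrite ler_sqr ?nnegrE ?(ltW (nwt_gt0 _ _ _)) // nwt_le //; move: k2; clear; lia.
    by lra.
  have kR : (2 : R) <= k%:R by rewrite ler_nat.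
  have lb : (3 + k%:R) * w (3 + k) 1 ^+ 2 <= l ^+ 2.
    by apply: (sqr_eigen_ge x0 (ltW z0) wm m2 (ltW w22) rP r1); rewrite -r0.
  have : 5 * w (3 + k) 1 ^+ 2 <= (3 + k%:R) * w (3 + k) 1 ^+ 2.
    by rewrite ler_wpM2r ?sqr_ge0 //; lra.
  by have := sqr_ge0 (w (3 + k) 1); lra.
have l4 : 4 * w 2 2 <= l.
  rewrite -ler_sqr ?nnegrE ?mulr_ge0 ?ler0n ?(ltW l0) ?(ltW w22) //.
  by have -> : (4 * w 2 2) ^+ 2 = 16 * w 2 2 ^+ 2 by ring.
have zb : 2 * z <= b.
  have h : (4 * w 2 2) * z <= l * z by rewrite ler_pM2r.
  by rewrite -(ler_pM2l w22); lra.
have e1 : 0 <= (w (3 + k) 2 - w (3 + k) 1) * (x * P).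
  by rewrite mulr_ge0 ?subr_ge0 // mulr_ge0 // ltW.
have e2 : 0 <= w 2 2 * (b * (b - 2 * z)) by rewrite !mulr_ge0 ?subr_ge0 // ltW.
have e3 : 0 < w 2 1 * (z * P) by rewrite !mulr_gt0.
lra.
Qed.

(** The edge 23 is replaced by 14. The crux is w(2,2) b^2 <= w(4,2) a P: a lower bound on l in terms
    of w(2,2) makes b small against a, and a <= x makes b comparable with P. *)
Lemma rho_hung_lt_U4 : srho p (@hub k edges_hung) < srho p (@hub k edges_U4').
Proof.
apply: hub_rho_lt => //; first exact: hub_connected_check.
move=> l Y P Y0 P0 l0 leaf row.
row row 0%N degH; row row 1%N degH; row row 2%N degH; row row 3%N degH; row row 4%N degH.
move: leaf; rewrite leafE degH.
unfold_form degH; unfold_form degU4'.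
rewrite ?(nwtC _ 3 (2 + k)) ?(nwtC _ 1 (2 + k)) ?(nwtC _ 4 (2 + k)) ?(nwtC _ 2 (2 + k)) ?(nwtC _ 2 3) ?(nwtC _ 1 4) ?(nwtC _ 2 4).
move: (Y 0%N) (Y 1%N) (Y 2%N) (Y 3%N) (Y 4%N) (Y0 0%N) (Y0 1%N) (Y0 2%N) (Y0 3%N) (Y0 4%N).
move=> x a b d q x0 a0 b0 d0 q0 rP r4 r3 r2 r1 r0; set rest := 2 * (_ * (_ * (k%:R * P))).
have kR : (2 : R) <= k%:R by rewrite ler_nat.
have k4 : (4 <= 2 + k)%N by move: k2; clear; lia.
have w22 : 0 < w 2 2 by apply: nwt_gt0.
have w32 : 0 < w 3 2 by apply: nwt_gt0.
have wm : 0 < w (2 + k) 1 by apply: nwt_gt0.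
have wm3 : 0 < w (2 + k) 3 by apply: nwt_gt0.
have m2 : w (2 + k) 1 <= w (2 + k) 2 by apply: nwt_le.
have m13 : w (2 + k) 1 <= w (2 + k) 3 by apply: nwt_le.
have m4 : w (2 + k) 3 < w (2 + k) 4 by rewrite (nwtC _ (2 + k) 3) (nwtC _ (2 + k) 4); apply: nwt_lt.
have c32 : w 3 2 <= w 4 1 by apply: nwt_majorization.
have c42 : w 3 2 <= w 4 2 by apply: nwt_le.
have c41 : w 4 1 <= w (2 + k) 1 by apply: nwt_le.
have w41 : 0 < w 4 1 by apply: nwt_gt0.
have sq41 : w 4 1 ^+ 2 <= w (2 + k) 1 ^+ 2 by rewrite ler_sqr // nnegrE ltW.
have bd : b = d.
  apply/eqP; rewrite -subr_eq0; have /eqP : (l + w 2 2) * (b - d) = 0 by lra.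
  by rewrite mulf_eq0 gt_eqF //; lra.
subst d; have qP : q = P by apply: (mulfI (lt0r_neq0 l0)); rewrite -r4 rP.
subst q; set F := w (2 + k) 1 in wm m2 m13 c41 sq41 rP r0 r4 *.
set G := w (2 + k) 3 in wm3 m13 m4 r0 r1 *.
have Ex : l ^+ 2 * x = G * (l * a) + (1 + k%:R) * F ^+ 2 * x.
  have -> : (1 + k%:R) * F ^+ 2 * x = (1 + k%:R) * F * (l * P) by rewrite rP; ring.
  by rewrite expr2 -mulrA -r0; ring.
have F2 : 0 <= F ^+ 2 by apply: sqr_ge0.
have kF : 3 * F ^+ 2 <= (1 + k%:R) * F ^+ 2 by rewrite ler_wpM2r //; lra.
(* From l^2 >= 4 F^2 and F^2 >= 17/8 w(2,2)^2 one gets 17/2, above (27/10)^2. *)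
have lsq : (27 / 10 * w 2 2) ^+ 2 <= l ^+ 2.
  have h := nwt_ratio p2 (isT : 0 < 2)%N (leqnn 2) (isT : 0 < 4)%N (isT : 2 * 1 <= 2 * 4)%N.
  have GF : F ^+ 2 * x <= G * (l * a).
    rewrite -r1; apply: le_trans (_ : F * (F * x) <= _); first by rewrite mulrA expr2.
    apply: ler_pM; rewrite ?mulr_ge0 ?(ltW wm) ?(ltW x0) //.
    have : F * x <= G * x by rewrite ler_pM2r.
    by have := mulr_gt0 w32 b0; lra.
  have : 4 * F ^+ 2 <= l ^+ 2.
    rewrite -(ler_pM2r x0) Ex.
    have : 3 * F ^+ 2 * x <= (1 + k%:R) * F ^+ 2 * x by rewrite ler_pM2r.
    by lra.
  have -> : (27 / 10 * w 2 2) ^+ 2 = 729 / 100 * w 2 2 ^+ 2 by field.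
  lra.
have lg : 27 / 10 * w 2 2 <= l.
  by move: lsq; rewrite ler_sqr // nnegrE; [rewrite mulr_ge0 // ltW | exact: ltW].
have gb : 17 / 10 * (w 2 2 * b) <= w 3 2 * a.
  have : (27 / 10 * w 2 2) * b <= l * b by rewrite ler_pM2r.
  by lra.
have lb : l * b <= 27 / 17 * (w 3 2 * a) by lra.
(* Elimination gives (l^2 - c) a <= G l x and (l^2 - (1 + k) F^2) x = G l a with c <= (1 + k) F^2,
   which excludes x < a. *)
have ax : a <= x.
  rewrite leNgt; apply/negP => xa.
  set c := 54 / 17 * w 3 2 ^+ 2.
  have la : (l ^+ 2 - c) * a <= G * (l * x).
    have -> : (l ^+ 2 - c) * a = l * (l * a) - c * a by ring.
    rewrite -r1 /c; have : w 3 2 * (l * b) <= w 3 2 * (27 / 17 * (w 3 2 * a)) by rewrite ler_pM2l.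
    by lra.
  have cF : c <= (1 + k%:R) * F ^+ 2.
    have := nwt_ratio p2 (isT : 0 < 3)%N (isT : 2 <= 3)%N (isT : 0 < 4)%N (isT : 3 * 1 <= 2 * 4)%N.
    by rewrite /c; have := sqr_ge0 (w 3 2); lra.
  have pos : 0 < (l ^+ 2 - c) * x.
    have : 0 < G * (l * a) by rewrite !mulr_gt0.
    have : c * x <= (1 + k%:R) * F ^+ 2 * x by rewrite ler_pM2r.
    by rewrite mulrBl Ex; lra.
  have lc : 0 < l ^+ 2 - c by rewrite -(pmulr_lgt0 _ x0).
  have h1 : (l ^+ 2 - c) * x < (l ^+ 2 - c) * a by rewrite ltr_pM2l.
  have h2 : G * (l * x) < G * (l * a) by rewrite !ltr_pM2l.
  have h3 : c * x <= (1 + k%:R) * F ^+ 2 * x by rewrite ler_pM2r.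
  have h4 : (l ^+ 2 - c) * x = G * (l * a) + (1 + k%:R) * F ^+ 2 * x - c * x.
    by rewrite mulrBl Ex.
  by lra.
have bP : b <= 27 / 17 * P.
  rewrite -(ler_pM2l l0); have : w 3 2 * a <= F * x.
    by apply: ler_pM => //; [exact: ltW | exact: ltW | lra].
  by lra.
(* The two estimates combine since 10/17 * 27/17 = 270/289 < 1. *)
have e1 : w 2 2 * (b * b) <= w 4 2 * (a * P).
  have t1 : w 2 2 * b <= 10 / 17 * (w 4 2 * a).
    have : w 3 2 * a <= w 4 2 * a by rewrite ler_pM2r.
    by lra.
  have : (w 2 2 * b) * b <= (10 / 17 * (w 4 2 * a)) * (27 / 17 * P).
    by apply: ler_pM => //; [rewrite mulr_ge0 // ltW | exact: ltW].
  have : 0 < w 4 2 * (a * P) by rewrite !mulr_gt0 // nwt_gt0.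
  by lra.
have e2 : 0 < (w (2 + k) 4 - G) * (x * a) by rewrite !mulr_gt0 // subr_gt0.
have e3 : 0 <= (w (2 + k) 2 - F) * (x * P).
  by rewrite mulr_ge0 ?subr_ge0 // mulr_ge0 // ltW.
have e4 : 0 <= (w 4 1 - w 3 2) * (a * b).
  by rewrite mulr_ge0 ?subr_ge0 // mulr_ge0 // ltW.
lra.
Qed.

(* Eliminating all coordinates but those of the two hubs from the eigenvalue equation. *)
Lemma rho_U4_char (l u v a b : R) : l = srho p (@hub k edges_U4) ->
  u = w (2 + k) 4 -> v = w (2 + k) 2 * w 4 2 ->
  a = k%:R * w (2 + k) 1 ^+ 2 + w (2 + k) 2 ^+ 2 -> b = w 4 2 ^+ 2 + 2 * w 4 1 ^+ 2 ->
  [/\ 0 < l, a < l ^+ 2, b < l ^+ 2 & (l ^+ 2 - a) * (l ^+ 2 - b) = (l * u + v) ^+ 2].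
Proof.
move=> El Eu Ev Ea Eb; have [Y [P [Y0 [P0]]]] :=
  @hub_perron R p k edges_U4 k0 isT (@hub_connected_check edges_U4 isT isT).
rewrite -El => l0 leaf row _.
row row 0%N degU4; row row 1%N degU4; row row 2%N degU4; row row 3%N degU4; row row 4%N degU4.
move: leaf; rewrite leafE degU4.
rewrite ?(nwtC _ 4 (2 + k)) ?(nwtC _ 2 (2 + k)) ?(nwtC _ 2 4) ?(nwtC _ 1 4).
move: (Y 0%N) (Y 1%N) (Y 2%N) (Y 3%N) (Y 4%N) (Y0 0%N) (Y0 1%N) (Y0 2%N) (Y0 3%N) (Y0 4%N).
move=> x y z q q' x0 y0 z0 q0 q'0 rP r4 r3 r2 r1 r0.
have wu : 0 < u by rewrite Eu nwt_gt0.
have wv : 0 < v by rewrite Ev mulr_gt0 ?nwt_gt0.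
have Ex : (l ^+ 2 - a) * x = (l * u + v) * y.
  have -> : (l ^+ 2 - a) * x = l * (l * x) - a * x by ring.
  have -> : a * x = k%:R * w (2 + k) 1 * (l * P) + w (2 + k) 2 * (w (2 + k) 2 * x).
    by rewrite Ea rP; ring.
  have -> : w (2 + k) 2 * x = l * z - w 4 2 * y by rewrite -r2; ring.
  by rewrite -r0 Eu Ev; ring.
have Ey : (l ^+ 2 - b) * y = (l * u + v) * x.
  have -> : (l ^+ 2 - b) * y = l * (l * y) - b * y by ring.
  have -> : b * y = w 4 2 * (w 4 2 * y) + w 4 1 * (l * q) + w 4 1 * (l * q').
    by rewrite Eb -r3 -r4; ring.
  have -> : w 4 2 * y = l * z - w (2 + k) 2 * x by rewrite -r2; ring.
  by rewrite -r1 Eu Ev; ring.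
have luv : 0 < l * u + v by rewrite addr_gt0 // mulr_gt0.
split=> //.
- by rewrite -subr_gt0 -(pmulr_lgt0 _ x0) Ex mulr_gt0.
- by rewrite -subr_gt0 -(pmulr_lgt0 _ y0) Ey mulr_gt0.
apply: (mulIf (lt0r_neq0 (mulr_gt0 x0 y0))).
by rewrite mulrACA Ex Ey; ring.
Qed.

Lemma rho_U3_sqr_ge : (3 + k%:R) * w (3 + k) 1 ^+ 2 <= srho p (@hub k edges_U3) ^+ 2.
Proof.
have [Y [P [Y0 [P0 l0] leaf row _]]] :=
  @hub_perron R p k edges_U3 k0 isT (@hub_connected_check edges_U3 isT isT).
set l := srho _ _ in l0 leaf row *.
row row 0%N degU3; row row 1%N degU3; row row 3%N degU3; row row 4%N degU3.
move: leaf; rewrite leafE degU3 ?(nwtC _ 2 (3 + k)) ?(nwtC _ 1 (3 + k)).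
move=> rP r4 r3 r1 r0.
have bd : Y 1%N = Y 3%N.
  by apply: (mulfI (lt0r_neq0 l0)); rewrite -r1 -r3; ring.
have qP : Y 4%N = P by apply: (mulfI (lt0r_neq0 l0)); rewrite -r4 rP.
rewrite -bd qP in r0.
by apply: (sqr_eigen_ge (Y0 0%N) (ltW (Y0 2%N)) _ _ (ltW _) rP r1 r0);
  rewrite ?nwt_gt0 ?nwt_le.
Qed.

(** The symmetry of the 4-cycle and the equal leaf values reduce the system to the coordinates of
    the centre and of its neighbours on the cycle. *)
Lemma rho_U3_char (l : R) : l = srho p (@hub k edges_U3) ->
  let a := (1 + k%:R) * w (3 + k) 1 ^+ 2 in let b := 2 * w 2 2 ^+ 2 in
  [/\ 0 < l, a < l ^+ 2, b < l ^+ 2 &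
      (l ^+ 2 - a) * (l ^+ 2 - b) = 2 * w (3 + k) 2 ^+ 2 * l ^+ 2].
Proof.
move=> El a b; have [Y [P [Y0 [P0]]]] :=
  @hub_perron R p k edges_U3 k0 isT (@hub_connected_check edges_U3 isT isT).
rewrite -El => l0 leaf row _.
row row 0%N degU3; row row 1%N degU3; row row 2%N degU3; row row 3%N degU3; row row 4%N degU3.
move: leaf; rewrite leafE degU3 ?(nwtC _ 2 (3 + k)) ?(nwtC _ 1 (3 + k)).
move: (Y 0%N) (Y 1%N) (Y 2%N) (Y 3%N) (Y 4%N) (Y0 0%N) (Y0 1%N) (Y0 2%N) (Y0 3%N) (Y0 4%N).
move=> x y z y' q x0 y0 z0 y'0 q0 rP r4 r3 r2 r1 r0.
have yE : y = y' by apply: (mulfI (lt0r_neq0 l0)); rewrite -r1 -r3; ring.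
have qP : q = P by apply: (mulfI (lt0r_neq0 l0)); rewrite -r4 rP.
subst y' q; set M := w (3 + k) 2 in r0 r1 r3 *.
have M0 : 0 < M by apply: nwt_gt0.
have Ex : (l ^+ 2 - a) * x = 2 * M * (l * y).
  have -> : (l ^+ 2 - a) * x = l * (l * x) - (1 + k%:R) * w (3 + k) 1 * (w (3 + k) 1 * x).
    by rewrite /a; ring.
  by rewrite -rP -r0; ring.
have Ey : (l ^+ 2 - b) * y = l * M * x.
  have -> : (l ^+ 2 - b) * y = l * (l * y) - w 2 2 * (w 2 2 * y + w 2 2 * y) by rewrite /b; ring.
  by rewrite r2 -r1; ring.
split=> //.
- by rewrite -subr_gt0 -(pmulr_lgt0 _ x0) Ex !mulr_gt0.
- by rewrite -subr_gt0 -(pmulr_lgt0 _ y0) Ey !mulr_gt0.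
apply: (mulIf (lt0r_neq0 (mulr_gt0 x0 y0))).
by rewrite mulrACA Ex Ey; ring.
Qed.

(* Otherwise the lower bound for rho(U3) would make the characteristic polynomial of U4 positive at
   rho(U4). Dividing by c turns w(3+k,1)^2 into (3+k)^2 + 1, the value that w(a,b)^2 = a^2 + b^2
   takes at p = 2, which is the worst case by nwt_ratio. *)
Lemma rho_U4_lt_U3_big : (3 <= k)%N -> srho p (@hub k edges_U4) < srho p (@hub k edges_U3).
Proof.
have sum54 (x y : R) : x <= 20 -> y <= 17 -> x + 2 * y <= 54 by lra.
move=> k3; have lb := rho_U3_sqr_ge.
move El : (srho p (@hub k edges_U4)) => l; move El3 : (srho p (@hub k edges_U3)) lb => l3 lb.
rewrite ltNge; apply/negP => le34.
have [l0 _ _ chr] := rho_U4_char (esym El) erefl erefl erefl erefl.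
have [l30 _ _ _] := rho_U3_char (esym El3).
have {}lb : (3 + k%:R) * w (3 + k) 1 ^+ 2 <= l ^+ 2.
  by apply: le_trans lb _; rewrite ler_sqr // nnegrE ltW.
have k4 : (4 <= 2 + k)%N by move: k3; clear; lia.
pose D : R := (k%:R + 3) ^+ 2 + 1; pose F := w (3 + k) 1; pose c := F ^+ 2 / D.
have KR : (3 : R) <= k%:R by rewrite ler_nat.
have D0 : 0 < D by rewrite /D ltr_wpDl // sqr_ge0.
have F0 : 0 < F by apply: nwt_gt0.
have c0 : 0 < c by rewrite divr_gt0 // exprn_gt0.
have cn0 : c != 0 by rewrite gt_eqF.
have ratio a b (z : R) : (0 < a)%N -> (b <= a)%N -> (a * 1 <= b * (3 + k))%N ->
    a%:R ^+ 2 + b%:R ^+ 2 = z -> w a b ^+ 2 / c <= z.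
  move=> a0 ba h <-; have := nwt_ratio p2 a0 ba (isT : 0 < 3 + k)%N h.
  rewrite !natrD !natrX expr1n natrD -/F.
  have -> : (3 + k%:R) ^+ 2 + 1 = D by rewrite /D [3 + _]addrC.
  move: (w a b ^+ 2) (a%:R ^+ 2 + _) => U V UV.
  by rewrite ler_pdivrMr // /c mulrA ler_pdivlMr // [V * _]mulrC.
have r1 : w (2 + k) 4 ^+ 2 / c <= (k%:R + 2) ^+ 2 + 16.
  by apply: ratio => //; [move: k3; clear; lia | rewrite natrD; ring].
have r2 : w (2 + k) 2 ^+ 2 / c <= (k%:R + 2) ^+ 2 + 4.
  by apply: ratio => //; [move: k3; clear; lia | rewrite natrD; ring].
have r3 : w (2 + k) 1 ^+ 2 / c <= (k%:R + 2) ^+ 2 + 1.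
  by apply: ratio => //; [move: k3; clear; lia | rewrite natrD; ring].
have r4 : w 4 2 ^+ 2 / c <= 20.
  by apply: ratio => //; [move: k3; clear; lia | ring].
have r5 : w 4 1 ^+ 2 / c <= 17.
  by apply: ratio => //; [move: k3; clear; lia | ring].
have c_ge0 x y : 0 <= w x y ^+ 2 / c by rewrite divr_ge0 ?sqr_ge0 // ltW.
set u := w (2 + k) 4 in chr r1; set v := w (2 + k) 2 * w 4 2 in chr.
set a := k%:R * _ + _ in chr; set b := w 4 2 ^+ 2 + _ in chr.
have vE : v ^+ 2 / c ^+ 2 = w (2 + k) 2 ^+ 2 / c * (w 4 2 ^+ 2 / c) by rewrite /v; field.
have aE : a / c = k%:R * (w (2 + k) 1 ^+ 2 / c) + w (2 + k) 2 ^+ 2 / c by rewrite /a; field.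
have bE : b / c = w 4 2 ^+ 2 / c + 2 * (w 4 1 ^+ 2 / c) by rewrite /b; field.
have tT : (k%:R + 3) ^+ 3 + (k%:R + 3) <= l ^+ 2 / c.
  rewrite ler_pdivlMr //; apply: le_trans lb.
  have -> : (k%:R + 3) ^+ 3 + (k%:R + 3) = (k%:R + 3) * D by rewrite /D; ring.
  by rewrite /c -/F -mulrA [D * _]mulrC divfK ?gt_eqF // addrC.
have aA : a / c <= k%:R * ((k%:R + 2) ^+ 2 + 1) + (k%:R + 2) ^+ 2 + 4.
  by rewrite aE -addrA lerD // ler_wpM2l.
have b54 : b / c <= 54 by rewrite bE sum54.
have v0 : 0 <= v ^+ 2 / c ^+ 2 <= 20 * ((k%:R + 2) ^+ 2 + 4).
  rewrite vE mulr_ge0 //= [leRHS]mulrC; exact: ler_pM.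
have u0 : 0 <= u ^+ 2 / c <= (k%:R + 2) ^+ 2 + 16 by rewrite c_ge0.
clearbody u v a b c; move: (U4_char_upper KR tT aA b54 u0 v0).
clear r1 r2 r3 r4 r5 ratio lb aE bE vE tT aA b54 c_ge0.
have -> : (l ^+ 2 / c - a / c) * (l ^+ 2 / c - b / c) = (l ^+ 2 - a) * (l ^+ 2 - b) / c ^+ 2 by field.
rewrite chr; set t := l ^+ 2 / c; set u' := u ^+ 2 / c; set v' := v ^+ 2 / c ^+ 2.
have -> : (l * u + v) ^+ 2 / c ^+ 2 = t * u' + v' + 2 * (l * u * v / c ^+ 2).
  by rewrite /t /u' /v'; field.
have t0 : 0 <= t by rewrite divr_ge0 ?sqr_ge0 // ltW.
have /andP[u'0 _] := u0; have /andP[v'0 _] := v0.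
have z0 : 0 <= 20 * t + u' * v' / 20.
  by apply: addr_ge0; [rewrite mulr_ge0 | rewrite divr_ge0 // mulr_ge0].
(* The summands are chosen with product t u' v', to match the bound of [U4_char_upper]. *)
have amgm : 2 * (l * u * v / c ^+ 2) <= 20 * t + u' * v' / 20.
  by apply: amgm_le => //; rewrite /t /u' /v'; field.
by rewrite ltNge => /negP; apply; rewrite -[leRHS]addrA lerD2l.
Qed.

Lemma rho_U4_lt_U3_n7 : k = 2%N -> srho p (@hub k edges_U4) < srho p (@hub k edges_U3).
Proof.
move=> k2'.
move El : (srho p (@hub k edges_U4)) => l; move El3 : (srho p (@hub k edges_U3)) => m.
rewrite ltNge; apply/negP => ml.
have [l0 la lb chr4] := rho_U4_char (esym El) erefl erefl erefl erefl.
have [m0 ma mb chr3] := rho_U3_char (esym El3).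
rewrite k2' /= in la lb chr4 ma mb chr3.
set g := w 4 4 in chr4.
have g0 : 0 < g by apply: nwt_gt0.
have gE : g = 2 * w 2 2.
  rewrite /g /nwt -[4%N]/(2 * 2)%N natrM.
  by apply: pnorm_homo.
have w42 : 0 < w 4 2 by apply: nwt_gt0.
have w52 : 0 < w 5 2 by apply: nwt_gt0.
have bE : 2 * w 2 2 ^+ 2 = g ^+ 2 / 2 by rewrite gE; field.
rewrite bE in mb chr3.
have rA := nwt_ratio p2 (isT : 0 < 4)%N (leqnn 4) (isT : 0 < 4)%N (isT : 4 * 2 <= 4 * 4)%N.
have rB := nwt_ratio p2 (isT : 0 < 4)%N (leqnn 4) (isT : 0 < 4)%N (isT : 4 * 1 <= 4 * 4)%N.
have rC := nwt_ratio p2 (isT : 0 < 4)%N (isT : 1 <= 4)%N (isT : 0 < 5)%N (isT : 4 * 1 <= 1 * 5)%N.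
have rD := nwt_ratio p2 (isT : 0 < 4)%N (isT : 2 <= 4)%N (isT : 0 < 5)%N (isT : 4 * 2 <= 2 * 5)%N.
rewrite -[w 4 2 * w 4 2]expr2 in chr4; rewrite -/g in rA rB.
have A0 : 0 < w 4 2 ^+ 2 by rewrite exprn_gt0.
move: (w 4 2 ^+ 2) (w 4 1 ^+ 2) (w 5 1 ^+ 2) (w 5 2 ^+ 2) A0 rA rB rC rD la lb chr4 ma mb chr3.
move: g g0 {gE bE w42 w52} => g g0 A B C D A0 rA rB rC rD la lb chr4 ma mb chr3.
(* For k = 2 both hubs of U4 have degree 4, so the two factors of the characteristic equation
   coincide and a square root can be taken. *)
have lE : l ^+ 2 = l * g + 2 * A + 2 * B.
  have h : (l ^+ 2 - (A + 2 * B)) ^+ 2 = (l * g + A) ^+ 2 by rewrite -chr4; ring.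
  have {}h : l ^+ 2 - (A + 2 * B) = l * g + A.
    apply/eqP; rewrite -(@eqrXn2 _ 2) // ?h ?eqxx //; first by rewrite subr_ge0 ltW.
    by rewrite ltW // addr_gt0 // mulr_gt0.
  by rewrite -[l ^+ 2](subrK (A + 2 * B)) h; ring.
have three : (1 + 2%:R : R) = 3 by ring.
rewrite three in ma chr3.
exact: (U4_U3_n7_absurd g0 l0 m0 ml A0 rA rB rC rD lE ma mb chr3).
Qed.

Lemma rho_U4_lt_U3 : srho p (@hub k edges_U4) < srho p (@hub k edges_U3).
Proof.
have [k3|k3] := ltnP 2 k; first exact: rho_U4_lt_U3_big.
by apply: rho_U4_lt_U3_n7; apply/eqP; rewrite eqn_leq k3.
Qed.

End Compare.

(** * Two adjacent hubs on a triangle *)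

Section DoubleHub.
Context {R : realType} {n : nat} (p : R).
Hypothesis p2 : 2 <= p.
Variables (e : rel 'I_n) (x u z : 'I_n).
Hypotheses (ue : unicyc e) (un : uniq [:: x; u; z]) (xu : e x u) (xz : e x z) (uz : e u z).
Hypothesis cover : forall w, w \notin [:: x; u; z] -> e x w || e u w.

Let irr_e : irreflexive e. Proof. by case: ue. Qed.
Let sym_e : symmetric e. Proof. by case: ue. Qed.
Let n0 : (0 < n)%N. Proof. exact: leq_ltn_trans (ltn_ord x). Qed.

Let oth i := [&& i != x, i != u & i != z].

Let xu' : x != u. Proof. by move: un; rewrite /= !inE negb_or => /andP[/andP[]]. Qed.
Let xz' : x != z. Proof. by move: un; rewrite /= !inE negb_or => /andP[/andP[]]. Qed.
Let uz' : u != z. Proof. by move: un; rewrite /= !inE negb_or => /and3P[]. Qed.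

Let big3 (T : Type) (idx : T) (op : Monoid.com_law idx) (F : 'I_n -> T) :
  \big[op/idx]_i F i = op (F x) (op (F u) (op (F z) (\big[op/idx]_(i | oth i) F i))).
Proof.
rewrite (bigD1 x) //= (bigD1 u) /=; last by rewrite eq_sym.
rewrite (bigD1 z) /=; last by rewrite eq_sym xz' eq_sym.
by congr (op _ (op _ (op _ _))); apply: eq_bigl => i; rewrite /oth andbA.
Qed.

Let sum3 (F : 'I_n -> nat) :
  (\sum_i F i = F x + (F u + (F z + \sum_(i | oth i) F i)))%N.
Proof. exact: big3. Qed.

Let oth_cover w : oth w -> e x w || e u w.
Proof. by move=> /and3P[wx wu wz]; apply: cover; rewrite !inE !negb_or wx wu. Qed.

Let deg_ge w : (e w x + e w u <= deg e w)%N.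
Proof.
by rewrite deg_sum (bigD1 x) //= (bigD1 u) /=; [rewrite addnA leq_addr | rewrite eq_sym].
Qed.

Let sum_oth1 : (\sum_(i | oth i) 1 = n - 3)%N.
Proof.
have := sum3 (fun=> 1%N); rewrite sum_nat_const card_ord muln1.
by clear; lia.
Qed.

Let deg_hub_eq h h' : h = x /\ h' = u \/ h = u /\ h' = x ->
  deg e h = (2 + \sum_(i | oth i) e h i)%N.
Proof.
move=> hh; rewrite deg_sum sum3.
by case: hh => -[-> _]; rewrite irr_e ?xu ?xz ?uz ?(sym_e u x) ?xu.
Qed.

(** The two hubs have degrees summing to at least 4 + (n - 3), z has degree at least 2 and each
    other vertex at least 1. This already adds up to 2n, so every bound is attained. *)
Let tight : deg e z = 2%N /\ forall w, oth w -> deg e w = 1%N.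
Proof.
have [_ _ _ cnt] := ue; have := sum3 (deg e); rewrite cnt.
have Ex := @deg_hub_eq x u (or_introl (conj erefl erefl)).
have Eu := @deg_hub_eq u x (or_intror (conj erefl erefl)).
have Ez : (2 <= deg e z)%N by have := deg_ge z; rewrite !(sym_e z) xz uz.
have S1 : (n - 3 <= \sum_(i | oth i) e x i + \sum_(i | oth i) e u i)%N.
  rewrite -sum_oth1 -big_split /=; apply: leq_sum => i /oth_cover.
  by case: (e x i); case: (e u i).
have d1 w : oth w -> (1 <= deg e w)%N.
  by move=> /oth_cover/orP[] h; rewrite sym_e in h; apply: deg_gt0 h.
have S2 : (n - 3 <= \sum_(i | oth i) deg e i)%N by rewrite -sum_oth1 leq_sum.
have n3 : (3 <= n)%N.
  by have := max_card (mem [:: x; u; z]); rewrite (card_uniqP un) card_ord.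
move=> E; have [Ez2 E2] : deg e z = 2%N /\ (\sum_(i | oth i) deg e i = n - 3)%N.
  by move: E Ez S1 S2 n3; rewrite Ex Eu; clear; lia.
split=> // w ow; apply/eqP; rewrite eqn_leq d1 // andbT leqNgt; apply/negP => w2.
move: E2; rewrite -sum_oth1 (bigD1 w) //= [RHS](bigD1 w) //= => E2.
have : (\sum_(i | oth i && (i != w)) 1 <= \sum_(i | oth i && (i != w)) deg e i)%N.
  by apply: leq_sum => i /andP[/d1].
by move/(leq_add w2); rewrite E2 leq_add2r.
Qed.

Let leaf w h : oth w -> e h w -> forall j, e w j = (j == h).
Proof.
move=> ow hw j; have [_ /(_ w ow)] := tight; rewrite /deg => /eqP/cards1P[a E].
have wh : h \in [set a] by rewrite -E inE sym_e.
have -> : e w j = (j \in [set a]) by rewrite -E inE.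
by move: wh; rewrite !inE => /eqP ->.
Qed.

Section Vector.
Variable y : 'I_n -> R.
Hypothesis py : perron_vec p e y.

Let l := srho p e.
Let y0 i : 0 < y i. Proof. by case: py. Qed.
Let eig i : \sum_j wt p e i j * y j = l * y i. Proof. by case: py. Qed.

Let leaf_val w h : oth w -> e h w -> l * y w = pnorm p (deg e h)%:R 1 * y h.
Proof.
move=> ow hw; rewrite -eig (bigD1 h) //= big1 => [|j jh].
  by rewrite addr0 /wt (leaf ow hw) eqxx (proj2 tight) // pnormC.
by rewrite /wt (leaf ow hw) (negPf jh) mul0r.
Qed.

Let l0 : 0 < l.
Proof.
rewrite -(pmulr_lgt0 _ (y0 x)) -eig (bigD1 u) //=; apply: ltr_pwDl.
  by rewrite mulr_gt0 // wt_gt0.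
by apply: sumr_ge0 => j _; rewrite mulr_ge0 ?wt_ge0 // ltW.
Qed.

(** The row of a hub multiplied by l, with its leaves eliminated through [leaf_val]. *)
Let hub_row h h' : h = x /\ h' = u \/ h = u /\ h' = x ->
  (l ^+ 2 - (deg e h - 2)%:R * pnorm p (deg e h)%:R 1 ^+ 2) * y h =
  l * (pnorm p (deg e h)%:R (deg e h')%:R * y h' + pnorm p (deg e h)%:R 2 * y z).
Proof.
move=> hh; set F := pnorm p (deg e h)%:R 1.
have S : l * \sum_(i | oth i) wt p e h i * y i = (deg e h - 2)%:R * F ^+ 2 * y h.
  rewrite mulr_sumr (eq_bigr (fun i => (e h i)%:R * (F ^+ 2 * y h))) => [|i oi].
    rewrite -mulr_suml -natr_sum (deg_hub_eq hh) addKn; ring.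
  rewrite /wt; case: (boolP (e h i)) => hi; last by rewrite !mul0r mulr0.
  by rewrite /= (proj2 tight i oi) -[pnorm _ _ _]/F mulrCA (leaf_val oi hi) -/F; ring.
have := eig h; rewrite big3 /= => E.
have {}E : pnorm p (deg e h)%:R (deg e h')%:R * y h' + (pnorm p (deg e h)%:R 2 * y z +
    \sum_(i | oth i) wt p e h i * y i) = l * y h.
  rewrite -E /wt -(proj1 tight); case: hh => -[-> ->].
    by rewrite irr_e xu xz mul0r add0r.
  by rewrite irr_e sym_e xu uz mul0r add0r.
have -> : (l ^+ 2 - (deg e h - 2)%:R * F ^+ 2) * y h = l * (l * y h) - (deg e h - 2)%:R * F ^+ 2 * y h.
  by ring.
by rewrite -S -E; ring.
Qed.

Hypothesis du : (deg e u <= deg e x)%N.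

(** In the two instances of [hub_row], x has at least as many leaves and at least as heavy edges as
    u. If y x < y u, the left side for x would be smaller than that for u while its right side is
    not. *)
Lemma double_hub_perron_le : y u <= y x.
Proof.
have rx := @hub_row x u (or_introl (conj erefl erefl)).
have ru := @hub_row u x (or_intror (conj erefl erefl)).
rewrite leNgt; apply/negP => yxu.
move: rx ru; rewrite (pnormC _ (deg e u)%:R (deg e x)%:R).
set D := deg e x; set d := deg e u; set f := pnorm p D%:R d%:R => rx ru.
have f0 : 0 < f by rewrite pnorm_gt0 // ltr0n (deg_gt0 xu).
have F2 : pnorm p d%:R 2 <= pnorm p D%:R 2 by apply: ler_pnorm; rewrite ?ler0n ?ler_nat ?lexx.
have F1 : pnorm p d%:R 1 <= pnorm p D%:R 1.
  by apply: ler_pnorm; rewrite ?ler0n ?ler_nat ?ler01 ?lexx.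
have cC : (d - 2)%:R * pnorm p d%:R 1 ^+ 2 <= (D - 2)%:R * pnorm p D%:R 1 ^+ 2.
  apply: ler_pM; rewrite ?ler0n ?sqr_ge0 ?ler_nat ?leq_sub2r //.
  by rewrite ler_sqr ?nnegrE ?pnorm_ge0.
move: ((d - 2)%:R * _) ((D - 2)%:R * _) rx ru cC => a b rx ru ab.
have pos : 0 < (l ^+ 2 - b) * y x.
  rewrite rx !mulr_gt0 //; apply: ltr_pwDl; first by rewrite mulr_gt0.
  by rewrite mulr_ge0 ?pnorm_ge0 // ltW.
have lb : 0 < l ^+ 2 - b by rewrite -(pmulr_lgt0 _ (y0 x)).
have h1 : (l ^+ 2 - b) * y x < (l ^+ 2 - b) * y u by rewrite ltr_pM2l.
have h2 : (l ^+ 2 - b) * y u <= (l ^+ 2 - a) * y u by rewrite ler_pM2r // lerD2l lerN2.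
have h3 : l * (f * y x + pnorm p d%:R 2 * y z) <= l * (f * y u + pnorm p D%:R 2 * y z).
  by rewrite ler_pM2l // lerD // ?ler_pM2l ?ler_pM2r // ltW.
lra.
Qed.

Lemma double_hub_leaf_le v w : oth v -> oth w -> e u v -> e x w -> y v <= y w.
Proof.
move=> ov ow uv xw; rewrite -(ler_pM2l l0) (leaf_val ov uv) (leaf_val ow xw).
apply: ler_pM; rewrite ?pnorm_ge0 ?(ltW (y0 _)) ?double_hub_perron_le //.
by apply: ler_pnorm; rewrite ?ler0n ?ler_nat ?ler01 ?lexx.
Qed.

End Vector.

Let leaves h := [set i | oth i && e h i].

Lemma card_leaves h h' : h = x /\ h' = u \/ h = u /\ h' = x -> (#|leaves h| + 2 = deg e h)%N.
Proof.
move=> hh; rewrite (deg_hub_eq hh) addnC; congr addn.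
rewrite -sum1_card big_mkcond [RHS]big_mkcond /=; apply: eq_bigr => i _.
by rewrite inE; case: (oth i); case: (e h i).
Qed.

(** A full Kelmans move would overshoot the degree bound n - 3; taking one leaf at a time lets the
    process stop at U4. *)
Lemma double_hub_step w : oth w -> e u w -> (deg e u <= deg e x)%N ->
  let e' := mv e x u [set w] in
  [/\ unicyc e', deg e' x = (deg e x).+1, forall i, (deg e' i <= (deg e x).+1)%N
    & srho p e < srho p e'].
Proof.
move=> ow uw du e'; have := ow => /and3P[wx wu wz].
have TT : [set w] \subset private_nbrs e x u.
  apply/fintype.subsetP => j; rewrite !inE => /eqP ->; rewrite uw wx sym_e.
  by rewrite (leaf ow uw) xu'.
have [_ _ con_e cnt] := ue.
have degx : deg e' x = (deg e x).+1 by rewrite (deg_mv_u irr_e TT xu') cards1 addn1.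
have maxdeg : forall i, (deg e i <= deg e x)%N.
  move=> i; have [->//|ix] := eqVneq i x; have [->//|iu] := eqVneq i u.
  have x2 : (2 <= deg e x)%N by rewrite -(@card_leaves x u) ?leq_addl //; left.
  have [->|iz] := eqVneq i z; first by rewrite (proj1 tight).
  have oi : oth i by rewrite /oth ix iu iz.
  by rewrite (proj2 tight i oi) ltnW.
split=> //.
- split; [exact: mv_irr TT | exact: mv_sym | apply: mv_connected => //; by left |].
  by rewrite sum_deg_mv.
- move=> i; have [->|ix] := eqVneq i x; first by rewrite degx.
  have [->|iu] := eqVneq i u.
    apply: leq_trans (leqW (maxdeg u)); rewrite -(deg_mv_v irr_e TT xu').
    exact: leq_addr.
  by rewrite (deg_mv_other irr_e sym_e TT) // leqW.
have [y py] := perron_exists p n0 sym_e con_e.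
apply: (perron_lt n0 _ py); first exact: mv_sym.
have y0 : forall i, 0 < y i by case: py.
(* The kept neighbours of u are z, matched with itself, and leaves, matched with leaves of x by
   their rank; u has no more leaves than x. *)
pose phi j := if j == z then z else nth z (enum (leaves x)) (index j (enum (leaves u))).
have leaf_le : (#|leaves u| <= #|leaves x|)%N.
  rewrite -(leq_add2r 2) (@card_leaves x u); last by left.
  by rewrite (@card_leaves u x) //; right.
have in_leaves j : j \in nbrs e u -> j \notin [set w] -> j != x -> j != z -> j \in leaves u.
  move=> uj _ jx jz; rewrite inE in uj; rewrite inE uj andbT /oth jx jz andbT /=.
  by apply: contraTneq uj => ->; rewrite irr_e.
have idx j : j \in leaves u -> (index j (enum (leaves u)) < size (enum (leaves x)))%N.
  by move=> ju; rewrite -cardE; apply: leq_trans leaf_le; rewrite cardE index_mem mem_enum.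
have phiL j : j \in leaves u -> nth z (enum (leaves x)) (index j (enum (leaves u))) \in leaves x.
  by move=> /idx; rewrite -mem_enum; apply: mem_nth.
have lz : z \notin leaves x by rewrite inE /oth eqxx !andbF.
apply: (@mv_sform_lt _ _ _ _ _ _ _ _ p2 irr_e sym_e TT xu' phi) => //.
- exact: double_hub_perron_le.
- by rewrite cards1.
- by rewrite cards1 addn1 ltnS.
- move=> i j; rewrite !inE => /and3P[ui iw ix] /and3P[uj jw jx]; rewrite /phi.
  have [->|iz] := eqVneq i z; have [->|jz] := eqVneq j z.
  + by move=> _; exact: erefl.
  + have jL : j \in leaves u by apply: in_leaves; rewrite // inE.
    by move=> E; move: (phiL j jL); rewrite -E (negPf lz).
  + have iL : i \in leaves u by apply: in_leaves; rewrite // inE.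
    by move=> E; move: (phiL i iL); rewrite E (negPf lz).
  have iL : i \in leaves u by apply: in_leaves; rewrite // inE.
  have jL : j \in leaves u by apply: in_leaves; rewrite // inE.
  move=> /eqP; rewrite nth_uniq ?enum_uniq ?idx // => /eqP E.
  have iE : i \in enum (leaves u) by rewrite mem_enum.
  have jE : j \in enum (leaves u) by rewrite mem_enum.
  by rewrite -(nth_index z iE) E nth_index.
move=> j; rewrite !inE => /and3P[uj jw jx]; rewrite /phi.
have [->|jz] := eqVneq j z; first by rewrite xz eq_sym uz'.
have jL : j \in leaves u by apply: in_leaves; rewrite // inE.
have := phiL j jL; set i := nth _ _ _; rewrite inE => /andP[oi xi].
move: jL; rewrite inE => /andP[oj _].
split=> //; first by case/and3P: oi.
  by rewrite (proj2 tight i oi) (proj2 tight j oj).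
exact: (double_hub_leaf_le py du).
Qed.

End DoubleHub.

(** * Identification of the extremal graphs *)

Section Named.
Variable k : nat.

Lemma sym_of_hub (b : nat -> nat -> bool) E :
  (forall i j, b i j || b j i = hub_nat E i j) -> @sym_of (5 + k) b = @hub k E.
Proof. by move=> h; apply/funext => x; apply/funext => y; apply: h. Qed.

Lemma SneE : Sne (5 + k) = @hub k edges_S.
Proof. by apply: sym_of_hub; case=> [|[|[|[|[|i]]]]]; case=> [|[|[|[|[|j]]]]]. Qed.
Lemma U1E : U1 (5 + k) = @hub k edges_U1.
Proof. by apply: sym_of_hub; case=> [|[|[|[|[|i]]]]]; case=> [|[|[|[|[|j]]]]]. Qed.
Lemma U2E : U2 (5 + k) = @hub k edges_U2.
Proof. by apply: sym_of_hub; case=> [|[|[|[|[|i]]]]]; case=> [|[|[|[|[|j]]]]]. Qed.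
Lemma U3E : U3 (5 + k) = @hub k edges_U3.
Proof. by apply: sym_of_hub; case=> [|[|[|[|[|i]]]]]; case=> [|[|[|[|[|j]]]]]. Qed.
Lemma U4E : U4 (5 + k) = @hub k edges_U4.
Proof. by apply: sym_of_hub; case=> [|[|[|[|[|i]]]]]; case=> [|[|[|[|[|j]]]]]. Qed.

Lemma sum_deg_five (E : seq (nat * nat)) : hub_wf E ->
  sumn [seq count (hub_nat E i) (iota 0 5) | i <- iota 0 5] = 10%N ->
  (\sum_i deg (@hub k E) i = 2 * (5 + k))%N.
Proof.
move=> wf s10; rewrite sum_deg_hub //.
rewrite (eq_bigr (fun i : 'I_5 => count (hub_nat E i) (iota 0 5) + (if val i == 0 then k else 0))%N) //.
rewrite big_split /= [X in (_ + X + _)%N](_ : _ = k); last first.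
  by rewrite !big_ord_recr big_ord0 /= !addn0 add0n.
move: s10; rewrite sumnE big_map -[iota 0 5]/(index_iota 0 5) big_mkord => ->.
by clear; lia.
Qed.

Lemma extend_uniq (T : finType) (l : seq T) m : uniq l -> (size l <= m <= #|T|)%N ->
  exists r, uniq (l ++ r) /\ size (l ++ r) = m.
Proof.
move=> ul /andP[lm mT]; pose r := [seq w <- enum T | w \notin l].
have ur : uniq r by rewrite filter_uniq ?enum_uniq.
have sr : (size r = #|T| - size l)%N.
  rewrite -(card_uniqP ur) -(card_uniqP ul) -(cardC (mem l)) addKn.
  by apply: eq_card => w; rewrite !inE mem_filter mem_enum andbT.
exists (take (m - size l) r); split.
  rewrite cat_uniq ul take_uniq // andbT /=; apply/hasPn => w /mem_take.
  by rewrite mem_filter => /andP[].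
by rewrite size_cat size_takel ?sr ?subnKC // leq_sub2r.
Qed.

(* The list l need only contain the special vertices that are not mere leaves of x. *)
Lemma hub_iso_prefix E (e : rel 'I_(5 + k)) (l : seq 'I_(5 + k)) x : hub_wf E ->
  sumn [seq count (hub_nat E i) (iota 0 5) | i <- iota 0 5] = 10%N ->
  unicyc e -> uniq l -> (0 < size l <= 5)%N -> nth x l 0 = x ->
  (forall w, w \notin l -> e x w) ->
  all (fun ij : nat * nat => if (ij.2 < size l)%N then e (nth x l ij.1) (nth x l ij.2)
     else ij.1 == 0%N) E -> graph_iso e (@hub k E).
Proof.
move=> wf s10 [irr_e sym_e _ cnt] ul /andP[l1 l5] l0 lrest /allP lE.
have [|r [ulr slr]] := @extend_uniq _ l 5 ul; first by rewrite l5 card_ord leq_addr.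
have nl i : (i < size l)%N -> nth x (l ++ r) i = nth x l i by move=> il; rewrite nth_cat il.
have rl w : w \in r -> w \notin l.
  by move: ulr; rewrite cat_uniq => /and3P[_ /hasPn h _] /h.
apply: (@hub_iso k E e (l ++ r) x wf sym_e _ ulr slr) => //.
- by rewrite sum_deg_five // cnt.
- by rewrite nl.
- move=> i j ij; have /andP[/allP/(_ _ ij) /= /andP[lt_ij j5] _] := wf.
  have := lE _ ij; rewrite /=; case: ltnP => [jl|jl].
    by rewrite !nl // (ltn_trans lt_ij).
  move=> /eqP ->; rewrite nl // l0; apply/lrest/rl.
  by rewrite nth_cat ltnNge jl /= mem_nth // ltn_subLR // -size_cat slr.
- by move=> w; rewrite mem_cat negb_or => /andP[/lrest].
Qed.

Lemma hub_relabel E E' (s : seq nat) : hub_wf E -> hub_wf E' ->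
  sumn [seq count (hub_nat E i) (iota 0 5) | i <- iota 0 5] = 10%N ->
  sumn [seq count (hub_nat E' i) (iota 0 5) | i <- iota 0 5] = 10%N ->
  perm_eq s (iota 0 5) -> nth 0%N s 0 = 0%N ->
  all (fun ij => hub_nat E' (nth 0 s ij.1) (nth 0 s ij.2))%N E ->
  graph_iso (@hub k E') (@hub k E).
Proof.
move=> wf wf' s10 s10' ps s0 /allP sE.
have ss : size s = 5%N by rewrite (perm_size ps).
pose g i : 'I_(5 + k) := lshift k (inord i).
pose l := [seq g i | i <- s].
have gK i : (i < 5)%N -> val (g i) = i by move=> i5; rewrite /= inordK.
have s5 i : i \in s -> (i < 5)%N by rewrite (perm_mem ps) mem_iota.
have nl i x : (i < 5)%N -> nth x l i = g (nth 0%N s i).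
  by move=> i5; rewrite (nth_map 0%N) ?ss.
apply: (@hub_iso k E (hub E') l (g 0%N)) => //; first exact: hub_sym.
- by rewrite !sum_deg_five.
- rewrite map_inj_in_uniq ?(perm_uniq ps) ?iota_uniq // => i j /s5 i5 /s5 j5.
  by move=> /(congr1 val); rewrite !gK.
- by rewrite size_map.
- by rewrite nl // s0.
- move=> i j ij; have /andP[/allP/(_ _ ij) /= /andP[lt_ij j5] _] := wf.
  have i5 := ltn_trans lt_ij j5.
  rewrite !nl // /hub !gK; try by apply/s5/mem_nth; rewrite ss.
  exact: sE ij.
move=> w wl; have [w5|w5] := ltnP w 5.
  case/negP: wl; apply/mapP; exists (val w); first by rewrite (perm_mem ps) mem_iota.
  by apply/val_inj; rewrite gK.
rewrite /hub gK // -[val w](subnKC w5) hub_special_leaf //.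
Qed.

Lemma hub_unicyc (E : seq (nat * nat)) : hub_wf E ->
  sumn [seq count (hub_nat E i) (iota 0 5) | i <- iota 0 5] = 10%N ->
  all (fun i => hub_nat E i 0 || has (fun j => hub_nat E i j && hub_nat E j 0) (iota 0 5)) (iota 1 4) ->
  unicyc (@hub k E).
Proof.
move=> wf s10 con; split; [exact: hub_irr | exact: hub_sym | exact: hub_connected_check |].
exact: sum_deg_five.
Qed.

(** * Unicyclic graphs with a vertex of degree at least n - 2 *)

Section Classify.
Variables (e : rel 'I_(5 + k)) (x : 'I_(5 + k)).
Hypothesis ue : unicyc e.

Let irr_e : irreflexive e. Proof. by case: ue. Qed.
Let sym_e : symmetric e. Proof. by case: ue. Qed.

Let far := [set w | (w != x) && ~~ e x w].

Lemma card_far : (#|far| + deg e x = 4 + k)%N.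
Proof.
have E : [set~ x] = far :|: nbrs e x.
  apply/setP => w; rewrite !inE; case: eqVneq => [->|wx] /=; first by rewrite irr_e.
  by case: (e x w).
have := cardsC1 x; rewrite card_ord /= => <-; rewrite E.
rewrite -[RHS]addn0 -[X in (_ = _ + X)%N](_ : #|far :&: nbrs e x| = 0%N) ?cardsUI //.
by apply: eq_card0 => w; rewrite !inE; case: (e x w); rewrite ?andbF.
Qed.

Lemma classify_star : deg e x = (4 + k)%N -> graph_iso e (Sne (5 + k)).
Proof.
move=> dx; have adj w : w != x -> e x w.
  move=> wx; apply: contraT => xw; have : w \in far by rewrite inE wx.
  have : #|far| = 0%N by have := card_far; rewrite dx; clear; lia.
  by move/eqP; rewrite cards_eq0 => /eqP ->; rewrite inE.
have [d [f [c [c' [[d0 _ _] ecc [dc dc'] _ _]]]]] := unicyc_structure x ue.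
have cx : c != x by rewrite -d0 -lt0n.
have cx' : c' != x by rewrite -d0 -lt0n.
have cc' : c != c' by apply: contraTneq ecc => ->; rewrite irr_e.
rewrite SneE; apply: (@hub_iso_prefix _ _ [:: x; c; c'] x) => //=.
- by rewrite !inE negb_or ![x == _]eq_sym cx cx' cc'.
- by move=> w; rewrite !inE !negb_or => /and3P[/adj].
- by rewrite ecc !adj.
Qed.

(** Let w be the only vertex far from x and a its parent. The extra edge closes a 4-cycle if it
    meets w (U3), a triangle at a if it meets a but not w (U1), and a triangle away from both
    otherwise (U2). *)
Lemma classify_almost_star : deg e x = (3 + k)%N ->
  [\/ graph_iso e (U1 (5 + k)), graph_iso e (U2 (5 + k)) | graph_iso e (U3 (5 + k))].
Proof.
move=> dx; have /cards1P[w farE] : #|far| == 1%N by have := card_far; rewrite dx; clear; lia.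
have : w \in far by rewrite farE inE.
rewrite inE => /andP[wx nxw].
have adj v : v != x -> v != w -> e x v.
  move=> vx vw; apply: contraT => xv; have : v \in far by rewrite inE vx.
  by rewrite farE inE (negPf vw).
have [d [f [c [c' [[d0 fP dl] ecc [dc dc'] tcc _]]]]] := unicyc_structure x ue.
have cx : c != x by rewrite -d0 -lt0n.
have cx' : c' != x by rewrite -d0 -lt0n.
have cc' : c != c' by apply: contraTneq ecc => ->; rewrite irr_e.
have [wa _] := fP w wx; set a := f w in wa.
have aw : e a w by rewrite sym_e.
have aw' : a != w by apply: contraTneq aw => ->; rewrite irr_e.
have ax : a != x by apply: contraTneq aw => ->.
have tw b : b = a -> tree_edge x f b w by move=> ->; rewrite /tree_edge wx eqxx.
have square b : e b w -> b != x -> b != a -> graph_iso e (U3 (5 + k)).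
  move=> bw bx ba; have bw' : b != w by apply: contraTneq bw => ->; rewrite irr_e.
  rewrite U3E; apply: (@hub_iso_prefix _ _ [:: x; a; w; b] x) => //=.
  - by rewrite !inE !negb_or ![x == _]eq_sym ax wx bx aw' eq_sym ba eq_sym bw'.
  - by move=> v; rewrite !inE !negb_or => /and4P[vx _ vw _]; apply: adj.
  - by rewrite aw (sym_e w) bw !adj.
have triangle b : e a b -> b != x -> b != w -> graph_iso e (U1 (5 + k)).
  move=> ab bx bw; have ba : b != a by apply: contraTneq ab => ->; rewrite irr_e.
  rewrite U1E; apply: (@hub_iso_prefix _ _ [:: x; a; b; w] x) => //=.
  - by rewrite !inE !negb_or ![x == _]eq_sym ax wx bx aw' [a == b]eq_sym ba bw.
  - by move=> v; rewrite !inE !negb_or => /and4P[vx _ _ vw]; apply: adj.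
  - by rewrite ab aw !adj.
have [cw|cw] := eqVneq c w.
  constructor 3; apply: (square c') => //; first by rewrite -cw sym_e.
  by apply: contra tcc => /eqP/tw; rewrite cw tree_edge_sym.
have [cw'|cw'] := eqVneq c' w.
  constructor 3; apply: (square c) => //; first by rewrite -cw'.
  by apply: contra tcc => /eqP/tw; rewrite cw'.
have [ca|ca] := eqVneq c a; first by constructor 1; apply: (triangle c') => //; rewrite -ca.
have [ca'|ca'] := eqVneq c' a.
  by constructor 1; apply: (triangle c) => //; rewrite -ca' sym_e.
constructor 2; rewrite U2E; apply: (@hub_iso_prefix _ _ [:: x; c; c'; a; w] x) => //=.
- by rewrite !inE !negb_or ![x == _]eq_sym ax wx cx cx' cc' ca cw ca' cw' aw'.
- by move=> v; rewrite !inE !negb_or => /and5P[vx _ _ _ vw]; apply: adj.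
- by rewrite ecc aw !adj.
Qed.

End Classify.

End Named.

(** * Maximality of U4 and the final chain *)

Section Main.
Context {R : realType} (p : R) (k : nat).
Hypotheses (p2 : 2 <= p) (k2 : (2 <= k)%N).

Let n7 : (7 <= 5 + k)%N. Proof. by rewrite -[7%N]/(5 + 2)%N leq_add2l. Qed.
Let n0 : (0 < 5 + k)%N. Proof. by []. Qed.

Lemma srho_hub_iso E E' : graph_iso (@hub k E) (@hub k E') ->
  srho p (@hub k E) = srho p (@hub k E').
Proof. by move=> iso; apply: srho_iso => //; apply: hub_sym. Qed.

(** U1 is a double hub whose second hub 1 has the single leaf 3; moving that leaf to 0 yields the
    star with an edge. *)
Lemma rho_U1_lt_Sne : srho p (U1 (5 + k)) < srho p (Sne (5 + k)).
Proof.
have ue : unicyc (U1 (5 + k)) by rewrite U1E; apply: hub_unicyc.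
pose v i : 'I_(5 + k) := lshift k (inord i).
have vK i : (i < 5)%N -> val (v i) = i by move=> i5; rewrite /= inordK.
have e01 : U1 (5 + k) (v 0%N) (v 1%N) by rewrite /U1 /sym_of !vK.
have e02 : U1 (5 + k) (v 0%N) (v 2%N) by rewrite /U1 /sym_of !vK.
have e12 : U1 (5 + k) (v 1%N) (v 2%N) by rewrite /U1 /sym_of !vK.
have e13 : U1 (5 + k) (v 1%N) (v 3%N) by rewrite /U1 /sym_of !vK.
have neq i j : (i < 5)%N -> (j < 5)%N -> i != j -> v i != v j.
  by move=> i5 j5; apply: contraNneq => /(congr1 val); rewrite !vK // => ->.
have un : uniq [:: v 0%N; v 1%N; v 2%N] by rewrite /= !inE !negb_or !neq.
have cover w : w \notin [:: v 0%N; v 1%N; v 2%N] -> U1 (5 + k) (v 0%N) w || U1 (5 + k) (v 1%N) w.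
  rewrite !inE !negb_or -!val_eqE !vK //.
  by rewrite /U1 /sym_of !vK //; case: w => -[|[|[|[|w]]]] hw.
have d0 : deg (U1 (5 + k)) (v 0%N) = (3 + k)%N.
  by rewrite U1E deg_hub_special // inordK.
have d1 : deg (U1 (5 + k)) (v 1%N) = 3%N.
  by rewrite U1E deg_hub_special // inordK.
have [|||ue' dx _ lt] := @double_hub_step R _ p p2 _ _ _ _ ue un e01 e02 e12 cover (v 3%N).
- by rewrite !neq.
- exact: e13.
- by rewrite d0 d1 leq_addr.
apply: lt_le_trans lt _; rewrite d0 in dx.
have iso := classify_star ue' dx; have [_ se' _ _] := ue'.
by rewrite (srho_iso p n0 se' _ iso) // SneE; apply: hub_sym.
Qed.

Lemma small_deg_cases (e : rel 'I_(5 + k)) : unicyc e -> small_deg e ->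
  [\/ improvable p e, graph_iso e (U4 (5 + k)) | srho p e < srho p (U4 (5 + k))].
Proof.
move=> ue sd; have [irr_e sym_e _ _] := ue.
have [imp|[x [u [z [un /and3P[xu xz uz] du cover]]]]|[x [u [w1 [w2 [un /and4P[xu uw1 uw2 ww] adj]]]]]] :=
  improve_cases p2 n7 ue sd; first by constructor 1.
- have cf := card_far x ue; set far := [set _ | _] in cf.
  have farP w : w \in far -> [&& w != x, w != u & w != z] /\ e u w.
    rewrite inE => /andP[wx xw].
    have wu : w != u by apply: contraNneq xw => ->.
    have wz : w != z by apply: contraNneq xw => ->.
    have := cover w; rewrite !inE !negb_or wx wu wz (negPf xw) => /(_ isT) uw.
    by split.
  (* The vertices far from x are leaves of u, and |far| + deg x = n - 1. With three or more of them
     deg x + 1 <= n - 3, so a leaf may still move; with two the graph is U4. *)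
  have [big|small] := ltnP 2 #|far|.
    constructor 1; have /card_gt0P[w /farP[ow uw]] : (0 < #|far|)%N by apply: ltn_trans big.
    have [ue' _ sd' lt] := double_hub_step p2 ue un xu xz uz cover ow uw du.
    exists (mv e x u [set w]); split=> // i; apply: leq_trans (sd' i) _.
    by move: cf big; clear; lia.
  have /cards2P[w1 [w2 [w12 farE]]] : #|far| == 2%N.
    by have := sd x; move: cf small; clear; lia.
  have [/and3P[w1x w1u w1z] uw1] : [&& w1 != x, w1 != u & w1 != z] /\ e u w1.
    by apply: farP; rewrite farE !inE eqxx.
  have [/and3P[w2x w2u w2z] uw2] : [&& w2 != x, w2 != u & w2 != z] /\ e u w2.
    by apply: farP; rewrite farE !inE eqxx orbT.
  constructor 2; rewrite U4E; apply: (@hub_iso_prefix _ _ _ [:: x; u; z; w1; w2] x) => //=.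
  + move: un; rewrite /= !inE !negb_or => /andP[/andP[-> ->] /andP[-> _]].
    rewrite ![x == _]eq_sym ![u == w1]eq_sym ![u == w2]eq_sym ![z == _]eq_sym.
    by rewrite w1x w2x w1u w2u w1z w2z w12.
  + move=> w; rewrite !inE !negb_or => /and5P[wx _ _ ww1 ww2].
    apply: contraT => xw; have : w \in far by rewrite inE wx.
    by rewrite farE !inE (negPf ww1) (negPf ww2).
  + by rewrite xu xz uz uw1 uw2.
constructor 3.
have iso : graph_iso e (@hub k edges_hung).
  apply: (@hub_iso_prefix _ _ _ [:: x; u; w1; w2] x) => //=.
  by rewrite xu uw1 uw2 ww.
rewrite (srho_iso p n0 sym_e _ iso); last exact: hub_sym.
apply: lt_le_trans (rho_hung_lt_U4 p2 k2) _.
by rewrite U4E (srho_hub_iso (@hub_relabel k edges_U4 edges_U4' [:: 0; 1; 4; 2; 3]%N isT isT erefl erefl isT erefl isT)).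
Qed.

(** Induction on the number of graphs of the class with a larger spectral radius. Relations are
    coded as finite functions to make that set finite. *)
Lemma small_deg_rho (e : rel 'I_(5 + k)) : unicyc e -> small_deg e ->
  graph_iso e (U4 (5 + k)) \/ srho p e < srho p (U4 (5 + k)).
Proof.
pose gr (g : {ffun 'I_(5 + k) * 'I_(5 + k) -> bool}) : rel 'I_(5 + k) := fun a b => g (a, b).
pose code (e' : rel 'I_(5 + k)) := [ffun ab : 'I_(5 + k) * 'I_(5 + k) => e' ab.1 ab.2].
have codeK e' : gr (code e') = e'.
  by apply/funext => a; apply/funext => b; rewrite /gr ffunE.
pose above (e' : rel 'I_(5 + k)) : {set {ffun 'I_(5 + k) * 'I_(5 + k) -> bool}} :=
  [set g | `[< unicyc (gr g) /\ small_deg (gr g) >] && (srho p e' < srho p (gr g))]%SET.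
have [m] := ubnP #|above e|; elim: m e => // m IH e; rewrite ltnS => am ue sd.
have [[e' [ue' sd' lt]]||] := small_deg_cases ue sd; [|by left|by right].
right; have sub : above e' \proper above e.
  apply/fintype.properP; split.
    apply/fintype.subsetP => g; rewrite !inE => /andP[-> lt'].
    exact: lt_trans lt lt'.
  exists (code e'); rewrite !inE codeK ?ltxx ?andbF // lt andbT.
  by apply/asboolP.
have [iso|lt'] := IH e' (leq_trans (proper_card sub) am) ue' sd'; last exact: lt_trans lt lt'.
have [_ se' _ _] := ue'.
by apply: lt_le_trans lt _; rewrite (srho_iso p n0 se' _ iso) // U4E; apply: hub_sym.
Qed.

End Main.

Theorem theorem4p2 (R : realType) (n : nat) (p : R) :
  (7 <= n)%N -> 2 <= p ->
  (forall G : rel 'I_n, simple_graph G -> unicyclic G ->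
     ~ graph_iso G (Sne n) -> ~ graph_iso G (U1 n) -> ~ graph_iso G (U2 n) ->
     ~ graph_iso G (U3 n) -> ~ graph_iso G (U4 n) ->
     rho (psombor_mx p G) < rho (psombor_mx p (U4 n))) /\
  rho (psombor_mx p (U4 n)) < rho (psombor_mx p (U3 n)) /\
  rho (psombor_mx p (U3 n)) < rho (psombor_mx p (U2 n)) /\
  rho (psombor_mx p (U2 n)) < rho (psombor_mx p (U1 n)) /\
  rho (psombor_mx p (U1 n)) < rho (psombor_mx p (Sne n)).
Proof.
move=> n7 p2; have [k En] : exists k, n = (5 + k)%N.
  by exists (n - 5)%N; rewrite subnKC // (leq_trans _ n7).
subst n; have k2 : (2 <= k)%N by rewrite -(leq_add2l 5).
split; last split; last split; last split.
- move=> G sG uG nS nU1 nU2 nU3 nU4; have ue := unicyclic_unicyc sG uG.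
  have [sd|nsd] := pselect (small_deg G).
    by have [|lt] := small_deg_rho p2 k2 ue sd.
  (* Some degree is at least n - 2 = 3 + k, hence equal to 3 + k or 4 + k, and the graph is one of
     the excluded ones. *)
  exfalso; have [x dx] : exists x, (2 + k < deg G x)%N.
    apply/existsP; apply: contra_notT nsd => /existsPn h i.
    by have := h i; rewrite -leqNgt.
  have := card_far x ue; have [d3|d3] := eqVneq (deg G x) (3 + k)%N => cf.
    by have [] := classify_almost_star ue d3.
  by apply: nS; apply: (classify_star ue (x := x)); move: cf dx d3; clear; lia.
- by rewrite U4E U3E; apply: rho_U4_lt_U3.
- rewrite U3E U2E; apply: lt_le_trans (rho_U3_lt_U2 p2 k2) _.
  by rewrite (srho_hub_iso p (@hub_relabel k edges_U2 edges_U2' [:: 0; 1; 3; 4; 2]%N isT isT erefl erefl isT erefl isT)).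
- rewrite U2E U1E; apply: lt_le_trans (rho_U2_lt_U1 p2 k2) _.
  by rewrite (srho_hub_iso p (@hub_relabel k edges_U1 edges_U1' [:: 0; 1; 2; 4; 3]%N isT isT erefl erefl isT erefl isT)).
- exact: rho_U1_lt_Sne.
Qed.
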